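(* Assume that $\Lambda_1=\{\mu_m\}_{m\ge1}$ satisfies, for some $\kappa_1,\theta_1>0$, $\#\{m\ge1:\mu_m\le r\}\le\kappa_1r^{\theta_1}$ for all $r>0$, and that $\mathcal B_1=\{\psi_m\}_{m\ge1}$ is an orthonormal basis of $L^2(\Omega)$ for which there is $\beta>0$ such that $$\int_\Omega\Big|\sum_{\sqrt{\mu_m}\le\lambda}b_m\psi_m(x)\Big|^2dx\le e^{\beta\lambda}\int_\omega\Big|\sum_{\sqrt{\mu_m}\le\lambda}b_m\psi_m(x)\Big|^2dx$$ for all $\lambda>0$ and all $\{b_m\}_{m\ge1}\in\ell^2$. Then for every $T>0$ there exists a constant $\mathcal K(T,\omega)>0$ such that for every $y_0\in L^2(\Omega)$ there is $u\in L^2((0,T)\times\omega)$ with $$\|u\|^2_{L^2((0,T)\times\omega)}\le\mathcal K(T,\omega)\,\|y_0\|^2_{L^2(\Omega)}$$ for which the weak solution $y$ of $$\partial_ty-\Delta y=1_\omega u\ \text{ in }(0,T)\times\Omega,\qquad y=0\ \text{ on }(0,T)\times\partial\Omega,\qquad y(0,\cdot)=y_0\ \text{ in }\Omega$$ satisfies $y(T,\cdot)=0$ in $\Omega$; moreover these constants satisfy $$\limsup_{T\to0^+}\,T\ln\mathcal K(T,\omega)\le2\beta^2.$$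
   Context: $\Omega\subset\mathbb R^d$ ($d\ge1$) is a sufficiently smooth bounded domain, $\omega\subset\Omega$ is an arbitrary nonempty open subset, and $\{\mu_m,\psi_m\}_{m\ge1}$ are the eigenvalues (non-decreasing, repeated with multiplicity) and $L^2(\Omega)$-normalized eigenfunctions of the Dirichlet Laplacian $-\Delta$ on $\Omega$. *)

(* Defs.v *)
From HB Require Import structures.
From mathcomp Require Import all_boot all_order all_algebra.
From mathcomp Require Import all_classical all_reals all_analysis.

Set Implicit Arguments.
Unset Strict Implicit.
Unset Printing Implicit Defensive.
Import Order.TTheory GRing.Theory Num.Theory.
Import numFieldNormedType.Exports.

Local Open Scope classical_set_scope.
Local Open Scope ring_scope.

(* R^n is 'rV[R]_n, with the product sigma-algebra (generated by the           *)
(* coordinates), which is the Borel one. *)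
Section measurable_rV.
Context {disp : measure_display} {T : measurableType disp}.
Variable n : nat.

Let coords : 'I_n -> 'rV[T]_n -> T := fun i x => x ord0 i.

Let rV_set0 : g_sigma_preimage coords set0.
Proof. exact: sigma_algebra0. Qed.

Let rV_setC A : g_sigma_preimage coords A -> g_sigma_preimage coords (~` A).
Proof. exact: sigma_algebraC. Qed.

Let rV_bigcup (F : _^nat) : (forall i, g_sigma_preimage coords (F i)) ->
  g_sigma_preimage coords (\bigcup_i (F i)).
Proof. exact: sigma_algebra_bigcup. Qed.

HB.instance Definition _ := @isMeasurable.Build (measure_tuple_display disp)
  'rV[T]_n (g_sigma_preimage coords) rV_set0 rV_setC rV_bigcup.

Lemma measurable_coord (i : 'I_n) :
  measurable_fun [set: 'rV[T]_n] (fun x => x ord0 i).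
Proof.
move=> _ Y mY; rewrite setTI; apply: sub_sigma_algebra => /=.
rewrite -bigcup_seq/=; exists i => /=; first by rewrite mem_index_enum.
by exists Y => //; rewrite setTI.
Qed.

Lemma measurable_fun_coordP d1 (T1 : measurableType d1) (f : T1 -> 'rV[T]_n) :
  (forall i, measurable_fun [set: T1] (fun t => f t ord0 i)) ->
  measurable_fun [set: T1] f.
Proof.
move=> mf _ A mA; rewrite setTI; move: A mA.
have sT : sigma_algebra [set: 'rV[T]_n] [set A | measurable (f @^-1` A)].
  split => /=.
  - by rewrite preimage_set0.
  - by move=> A mA; rewrite setTD preimage_setC; exact: measurableC.
  - by move=> F mF; rewrite preimage_bigcup; exact: bigcup_measurable.
apply: smallest_sub => //.
rewrite -bigcup_seq => A/= [i _ [B mB <-]] /=.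
by have := mf i measurableT B mB; rewrite !setTI.
Qed.

End measurable_rV.

Section lebesgue_rV.
Context {R : realType}.

Definition consrV n (p : R * 'rV[R]_n) : 'rV[R]_n.+1 :=
  \row_i oapp (p.2 ord0) p.1 (unlift ord0 i).

Lemma measurable_consrV n : measurable_fun setT (@consrV n).
Proof.
apply: measurable_fun_coordP => i.
rewrite (_ : (fun _ => _) = fun p : R * 'rV[R]_n =>
  oapp (p.2 ord0) p.1 (unlift ord0 i)); last first.
  by apply/funext => p; rewrite mxE.
case: (unlift ord0 i) => [j|] /=; last exact: measurable_fst.
apply: (@measurableT_comp _ _ _ _ _ _ (fun x : 'rV[R]_n => x ord0 j)) => //.
exact: measurable_coord.
Qed.


Definition unconsrV n (x : 'rV[R]_n.+1) : R * 'rV[R]_n :=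
  (x ord0 ord0, \row_i x ord0 (lift ord0 i)).

Lemma unconsrVK n : cancel (@unconsrV n) (@consrV n).
Proof.
move=> x; apply/rowP => i; rewrite mxE /=.
by case: unliftP => [j|] -> //=; rewrite mxE.
Qed.

Lemma measurable_unconsrV n : measurable_fun setT (@unconsrV n).
Proof.
apply: measurable_fun_pair; first exact: measurable_coord.
apply: measurable_fun_coordP => i.
rewrite (_ : (fun _ => _) = fun x : 'rV[R]_n.+1 => x ord0 (lift ord0 i)).
  exact: measurable_coord.
by apply/funext => x; rewrite mxE.
Qed.

Section lebesgue_cons.
Variables (n : nat) (m : {sigma_finite_measure set 'rV[R]_n -> \bar R}).

Definition lebesgue_cons : set 'rV[R]_n.+1 -> \bar R :=
  pushforward (@lebesgue_measure R \x m)%E (@consrV n).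

HB.instance Definition _ := Measure.copy lebesgue_cons
  (measure_function_pushforward__canonical__measure_function_Measure
    (@lebesgue_measure R \x m)%E (@measurable_consrV n)).

Let lebesgue_cons_sigma_finite : sigma_finite setT lebesgue_cons.
Proof.
have /sigma_finiteP[F [TF ndF mF]] := sigma_finiteT (@lebesgue_measure R).
have /sigma_finiteP[G [TG ndG mG]] := sigma_finiteT m.
exists (fun i => @unconsrV n @^-1` (F i `*` G i)).
  apply/seteqP; split => // x _; rewrite -preimage_bigcup /=.
  have [i _ Fi] : (\bigcup_i F i) (x ord0 ord0) by rewrite -TF.
  have [j _ Gj] : (\bigcup_i G i) (\row_i x ord0 (lift ord0 i)) by rewrite -TG.
  exists (maxn i j) => //; split => /=.
    by move: Fi; exact/subsetPset/ndF/leq_maxl.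
  by move: Gj; exact/subsetPset/ndG/leq_maxr.
move=> i; have [mFi Fi] := mF i; have [mGi Gi] := mG i; split.
  rewrite -[X in measurable X]setTI; apply: measurable_unconsrV => //.
  exact: measurableX.
rewrite /lebesgue_cons /pushforward -comp_preimage.
rewrite (_ : _ \o _ = id); last first.
  apply/funext => -[x v]; rewrite /unconsrV /=; congr pair.
    by rewrite mxE unlift_none.
  by apply/rowP => j; rewrite !mxE liftK.
by rewrite preimage_id product_measure1E// lte_mul_pinfty// ge0_fin_numE.
Qed.

HB.instance Definition _ := Measure_isSigmaFinite.Build _ _ _
  lebesgue_cons lebesgue_cons_sigma_finite.

End lebesgue_cons.

Fixpoint lebesgue_rV n : {sigma_finite_measure set 'rV[R]_n -> \bar R} :=
  match n with
  | 0 => \d_(0 : 'rV[R]_0)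
  | n'.+1 => lebesgue_cons (lebesgue_rV n')
  end.

Lemma measurable_box n (a b : 'I_n -> R) :
  measurable [set x : 'rV[R]_n | forall i, x ord0 i \in `[a i, b i]].
Proof.
rewrite (_ : mkset _ =
  \bigcap_(i in [set: 'I_n]) ((fun x : 'rV[R]_n => x ord0 i) @^-1` `[a i, b i])).
  apply: fin_bigcap_measurable => // i _; rewrite -[X in measurable X]setTI.
  exact: measurable_coord.
by apply/seteqP; split => x /= h i => [_|]; exact: h.
Qed.

Lemma lebesgue_rV_box n (a b : 'I_n -> R) : (forall i, a i <= b i) ->
  lebesgue_rV n [set x | forall i, x ord0 i \in `[a i, b i]] =
  (\prod_(i < n) (b i - a i))%:E.
Proof.
elim: n a b => [|n IH] a b ab.
  by rewrite big_ord0 /= diracE mem_set// => -[].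
rewrite big_ord_recl EFinM -IH => [|i]; last exact: ab.
transitivity ((@lebesgue_measure R \x lebesgue_rV n)%E (`[a ord0, b ord0]%classic `*`
  [set x : 'rV[R]_n | forall i, x ord0 i \in `[a (lift ord0 i), b (lift ord0 i)]])); last first.
  rewrite product_measure1E//; last exact: measurable_box.
  congr (_ * _)%E; transitivity (@lebesgue_measure R `[a ord0, b ord0]%classic) => //.
  rewrite lebesgue_measure_itv /= lte_fin.
  have := ab ord0; rewrite le_eqVlt => /orP[/eqP ->|->] //.
  by rewrite ltxx subrr.
congr ((@lebesgue_measure R \x lebesgue_rV n)%E _).
apply/seteqP; split => -[x v] /=.
  move=> h; split; first by have := h ord0; rewrite mxE unlift_none.
  by move=> i; have := h (lift ord0 i); rewrite mxE liftK.
by move=> [hx hv] i; rewrite mxE; case: unliftP => [j|] -> /=.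
Qed.

End lebesgue_rV.

Section function_spaces.
Context {R : realType}.

Definition sqnorm disp (T : measurableType disp) (mu : set T -> \bar R)
    (A : set T) (f : T -> R) : \bar R :=
  (\int[mu]_(x in A) (f x ^+ 2)%:E)%E.

Definition L2 disp (T : measurableType disp) (mu : set T -> \bar R)
    (A : set T) (f : T -> R) : Prop :=
  measurable_fun A f /\ (sqnorm mu A f < +oo)%E.

Definition inner disp (T : measurableType disp)
    (mu : {measure set T -> \bar R}) (A : set T) (f g : T -> R) : R :=
  \int[mu]_(x in A) (f x * g x).

Variable d : nat.
Implicit Types (f v phi : 'rV[R]_d -> R) (Omega : set 'rV[R]_d).

Definition partial (i : 'I_d) f : 'rV[R]_d -> R :=
  fun x => 'D_(delta_mx ord0 i) f x.

Definition Ck (k : nat) f : Prop :=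
  forall s : seq 'I_d, (size s <= k)%N ->
    continuous (foldr partial f s) /\
    ((size s < k)%N -> forall (i : 'I_d) (x : 'rV[R]_d),
      derivable (foldr partial f s) x (delta_mx ord0 i)).

Definition test_function Omega phi : Prop :=
  [/\ forall k, Ck k phi, compact (closure [set x | phi x != 0]) &
      closure [set x | phi x != 0] `<=` Omega].

(* The boundary of Omega is, near each of its points, the graph of a C^k       *)
(* function of the coordinates other than the i-th, with Omega on one side     *)
(* (e selects which one). *)
Definition Ck_boundary (k : nat) Omega : Prop :=
  forall x0, (closure Omega `\` Omega°) x0 ->
  exists (i : 'I_d) (e : bool) (gamma : 'rV[R]_d -> R),
    [/\ Ck k gamma,
        forall x y : 'rV[R]_d, (forall j, j != i -> x ord0 j = y ord0 j) ->
          gamma x = gamma y &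
        \forall x \near x0,
          Omega x <-> 0 < (-1) ^+ e * (x ord0 i - gamma x)].

Definition domain Omega : Prop :=
  [/\ open Omega, connected Omega, Omega !=set0 & bounded_set Omega].

Definition cylinder (T : R) Omega : set (R * 'rV[R]_d) :=
  `]0, T[%classic `*` Omega.

(* H10 Omega f G : f belongs to the closure H^1_0(Omega) of the test functions *)
(* in the H^1(Omega) norm, and G is its weak gradient, i.e. the L^2 limit of   *)
(* the gradients of the approximating test functions. *)
Definition H10 Omega f (G : 'I_d -> 'rV[R]_d -> R) : Prop :=
  [/\ L2 (lebesgue_rV d) Omega f,
      forall i, L2 (lebesgue_rV d) Omega (G i) &
      exists phi : nat -> 'rV[R]_d -> R,
        [/\ forall n, test_function Omega (phi n),
            sqnorm (lebesgue_rV d) Omega (phi n \- f) @[n --> \oo] --> 0%E &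
            forall i, sqnorm (lebesgue_rV d) Omega
              (partial i (phi n) \- G i) @[n --> \oo] --> 0%E]].

Definition grad_inner Omega (G H : 'I_d -> 'rV[R]_d -> R) : R :=
  \int[lebesgue_rV d]_(x in Omega) (\sum_(i < d) G i x * H i x).

(* psi belongs to H^1_0(Omega) and - Delta psi = mu psi in the weak sense. *)
Definition dirichlet_eigen Omega (mu : R) (psi : 'rV[R]_d -> R) : Prop :=
  exists2 G, H10 Omega psi G &
    forall v Gv, H10 Omega v Gv ->
      grad_inner Omega G Gv = mu * inner (lebesgue_rV d) Omega psi v.

(* The last clause says that each eigenspace is spanned by the psi m with mu m *)
(* equal to the eigenvalue: no eigenvalue is missing, and (as the psi m are    *)
(* linearly independent) each is repeated according to its multiplicity. *)
Definition dirichlet_spectrum Omega (mu : nat -> R)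
    (psi : nat -> 'rV[R]_d -> R) : Prop :=
  [/\ {homo mu : m n / (m <= n)%N >-> m <= n},
      forall m, dirichlet_eigen Omega (mu m) (psi m),
      forall m, sqnorm (lebesgue_rV d) Omega (psi m) = 1%E &
      forall r f, dirichlet_eigen Omega r f ->
        exists (N : nat) (c : nat -> R),
          {ae lebesgue_rV d, forall x, Omega x ->
             f x = \sum_(m < N | mu m == r) c m * psi m x}].

Definition orthonormal_basis Omega (psi : nat -> 'rV[R]_d -> R) : Prop :=
  [/\ forall m, L2 (lebesgue_rV d) Omega (psi m),
      forall m n, inner (lebesgue_rV d) Omega (psi m) (psi n) = (m == n)%:R &
      forall f, L2 (lebesgue_rV d) Omega f ->
        sqnorm (lebesgue_rV d) Omega (fun x => f x -
          \sum_(m < n) inner (lebesgue_rV d) Omega f (psi m) * psi m x)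
        @[n --> \oo] --> 0%E].

(* A finite sum as soon as only finitely many mu m are <= lambda^2; \sum_(_ \in _) *)
(* would be 0 otherwise. *)
Definition low_modes (mu : nat -> R) (psi : nat -> 'rV[R]_d -> R)
    (lambda : R) (b : nat -> R) : 'rV[R]_d -> R :=
  fun x => \sum_(m \in [set m | Num.sqrt (mu m) <= lambda]) b m * psi m x.

(* y in C([0,T]; L^2(Omega)) with y in L^2(0,T; H^1_0(Omega)), gradient G,     *)
(* solves y_t - Delta y = f weakly: for every v in H^1_0(Omega),               *)
(*   d/dt <y(t), v> + <grad y(t), grad v> = <f(t), v>,   y(0) = y0,            *)
(* the first equation being integrated over [0, t]. *)
Definition weak_heat_solution Omega (T : R) (f : R * 'rV[R]_d -> R)
    (y0 : 'rV[R]_d -> R) (y : R -> 'rV[R]_d -> R) : Prop :=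
  [/\ forall t, t \in `[0, T] -> L2 (lebesgue_rV d) Omega (y t),
      forall t, t \in `[0, T] ->
        sqnorm (lebesgue_rV d) Omega (y s \- y t)
          @[s --> within `[0, T]%classic (nbhs t)] --> 0%E,
      {ae lebesgue_rV d, forall x, Omega x -> y 0 x = y0 x} &
      exists G : 'I_d -> R * 'rV[R]_d -> R,
        [/\ forall i, L2 (lebesgue_measure \x lebesgue_rV d)%E (cylinder T Omega)
              (G i),
            {ae lebesgue_measure, forall t, t \in `]0, T[ ->
               H10 Omega (y t) (fun i x => G i (t, x))} &
            forall v Gv, H10 Omega v Gv -> forall t, t \in `[0, T] ->
              inner (lebesgue_rV d) Omega (y t) v
                - inner (lebesgue_rV d) Omega (y 0) v
                + \int[lebesgue_measure]_(s in `[0, t])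
                    grad_inner Omega (fun i x => G i (s, x)) Gv
              = \int[lebesgue_measure]_(s in `[0, t])
                    inner (lebesgue_rV d) Omega (fun x => f (s, x)) v]].

End function_spaces.

(* Main.v *)
Require Import Defs.
From HB Require Import structures.
From mathcomp Require Import all_boot all_order all_algebra.
From mathcomp Require Import all_classical all_reals all_analysis.
From mathcomp Require Import measurable_realfun ring lra.

(** Testing the weak formulation with the eigenfunction [psi k] and applying Duhamel's
    formula shows that, at time [T], every weak solution has the coefficient
    [exp (- mu k T) * (<y0, psi k> + <1_omega u, exp (mu k t) psi k>)] on [psi k], the
    second inner product being taken in space-time ([weak_solution_modal]). Since the
    [psi k] form a basis, [u] steers [y0] to 0 as soon as it solves the moment problem
    [<u, exp (mu k t) psi k> = - <y0, psi k>] for all [k] on the cylinder over [omega].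
    A solution with [|u|^2 <= K |y0|^2] exists ([moment_problem], a form of Riesz'
    representation theorem) once the observability inequality
    [sum (b k)^2 <= K * |sum b k exp (mu k t) psi k|^2] holds for finite sums, with the
    norm on the right-hand side taken over the cylinder.

    That inequality ([observability]) follows from the spectral inequality by the method
    of Lebeau and Robbiano. The sum [z t] of the [b k exp (mu k t) psi k] is a heat flow
    run backwards. At a given time its modes of frequency at most [lambda] are seen from
    [omega] at the price [exp (beta lambda)], while the other ones are at least
    [exp (lambda^2 tau)] times larger after a delay [tau]. With [lambda] close to
    [beta / tau] the two effects balance on a window of length [tau] in such a way that
    the estimates on consecutive windows of lengths [T/2], [T/4], [T/8], and so on,
    telescope. The first window dictates the cost [K], which is [exp (2 beta^2 / T)] up to
    factors that disappear in the limit of [T ln K] ([limsup_control_cost]).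

    A weak solution for the control so obtained is built as the limit of its Galerkin sums
    ([weak_heat_solution_exists]). Duhamel's formula bounds the k-th mode and its energy
    by the terms of one summable series, which yields convergence uniformly in time in
    L2, convergence of the gradients in space-time, and hence [y t] in [H10] for almost
    every time. *)

Set Implicit Arguments.
Unset Strict Implicit.
Unset Printing Implicit Defensive.
Import Order.TTheory GRing.Theory Num.Theory.
Import numFieldNormedType.Exports.

Local Open Scope classical_set_scope.
Local Open Scope ring_scope.

(** * Square-integrable functions *)

Section L2_space.
Context {disp : measure_display} {X : measurableType disp} {R : realType}.
Variables (mu : {measure set X -> \bar R}) (A : set X).
Hypothesis mA : measurable A.
Implicit Types f g h : X -> R.

Let sq_ge0 f x : (0 <= (f x ^+ 2)%:E)%E.
Proof. by rewrite lee_fin sqr_ge0. Qed.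

Lemma sqnorm_ge0 f : (0 <= sqnorm mu A f)%E.
Proof. by apply: integral_ge0 => x _; exact: sq_ge0. Qed.

Lemma measurable_sqr f : measurable_fun A f ->
  measurable_fun A (fun x => (f x ^+ 2)%:E : \bar R).
Proof. by move=> mf; apply/measurable_EFinP; exact: measurable_funX. Qed.

Lemma L2_mul_integrable f g : L2 mu A f -> L2 mu A g ->
  mu.-integrable A (fun x => (f x * g x)%:E : \bar R).
Proof.
move=> [mf fy] [mg gy]; apply/integrableP; split.
  by apply/measurable_EFinP; exact: measurable_funM.
apply: (@le_lt_trans _ _ (sqnorm mu A f + sqnorm mu A g)%E); last first.
  exact: lte_add_pinfty.
rewrite /sqnorm -ge0_integralD//; [|exact: measurable_sqr..].
apply: ge0_le_integral => //.
- apply: measurableT_comp => //; apply/measurable_EFinP.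
  exact: measurable_funM.
- by apply: emeasurable_funD; exact: measurable_sqr.
- move=> x _ /=; rewrite lee_fin ler_norml.
  have := sqr_ge0 (f x + g x); have := sqr_ge0 (f x - g x).
  have := sqr_ge0 (f x); have := sqr_ge0 (g x).
  by rewrite !expr2 => ? ? ? ?; apply/andP; split; nra.
Qed.

Lemma sqnormZ f c : measurable_fun A f ->
  sqnorm mu A (fun x => c * f x) = ((c ^+ 2)%:E * sqnorm mu A f)%E.
Proof.
move=> mf; rewrite /sqnorm.
under eq_integral do rewrite exprMn EFinM.
by rewrite ge0_integralZl//; [exact: measurable_sqr|rewrite lee_fin sqr_ge0].
Qed.

Lemma sqnormD_le f g : measurable_fun A f -> measurable_fun A g ->
  (sqnorm mu A (fun x => f x + g x)%R <= 2%:E * sqnorm mu A f + 2%:E * sqnorm mu A g)%E.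
Proof.
move=> mf mg; rewrite /sqnorm -!ge0_integralZl//; [|exact: measurable_sqr..].
rewrite -ge0_integralD//; first last.
- by apply: measurable_funeM; exact: measurable_sqr.
- by move=> x _; exact: mule_ge0.
- by apply: measurable_funeM; exact: measurable_sqr.
- by move=> x _; exact: mule_ge0.
apply: ge0_le_integral => //.
- by move=> x _; rewrite lee_fin sqr_ge0.
- by apply: (@measurable_sqr (fun x => f x + g x)); exact: measurable_funD.
- by apply: emeasurable_funD; apply: measurable_funeM; exact: measurable_sqr.
- move=> x _ /=; rewrite -!EFinM -EFinD lee_fin.
  by have := sqr_ge0 (f x - g x); rewrite !expr2; nra.
Qed.

Lemma L2_Z f c : L2 mu A f -> L2 mu A (fun x => c * f x).
Proof.
move=> [mf fy]; split; first exact: measurable_funM.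
by rewrite sqnormZ// lte_mul_pinfty// lee_fin sqr_ge0.
Qed.

Lemma L2_D f g : L2 mu A f -> L2 mu A g -> L2 mu A (fun x => f x + g x).
Proof.
move=> [mf fy] [mg gy]; split; first exact: measurable_funD.
apply: le_lt_trans (sqnormD_le mf mg) _.
by apply: lte_add_pinfty; apply: lte_mul_pinfty.
Qed.

Lemma L2_0 : L2 mu A (fun=> 0).
Proof.
split; first exact: measurable_cst.
by rewrite /sqnorm; under eq_integral do rewrite expr0n/=; rewrite integral0.
Qed.

Lemma L2_B f g : L2 mu A f -> L2 mu A g -> L2 mu A (fun x => f x - g x).
Proof.
move=> Lf Lg; rewrite (_ : (fun x => _) = fun x => f x + -1 * g x).
  by apply: L2_D => //; exact: L2_Z.
by apply/funext => x; rewrite mulN1r.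
Qed.

Lemma L2_sum I (r : seq I) (P : pred I) (F : I -> X -> R) :
  (forall i, P i -> L2 mu A (F i)) -> L2 mu A (fun x => \sum_(i <- r | P i) F i x).
Proof.
move=> LF; elim: r => [|i r IH].
  by under eq_fun do rewrite big_nil; exact: L2_0.
under eq_fun do rewrite big_cons.
by case Pi: (P i) => //; apply: L2_D => //; exact: LF.
Qed.

Lemma sqnormE f : L2 mu A f -> sqnorm mu A f = (inner mu A f f)%:E.
Proof.
move=> Lf; rewrite /inner /Rintegral fineK.
  by rewrite /sqnorm; under eq_integral do rewrite expr2.
by apply: integrable_fin_num => //; exact: L2_mul_integrable.
Qed.

Lemma innerC f g : inner mu A f g = inner mu A g f.
Proof. by apply: eq_Rintegral => x _; rewrite mulrC. Qed.

Lemma inner_ge0 f : 0 <= inner mu A f f.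
Proof. by apply: Rintegral_ge0 => x _; rewrite -expr2 sqr_ge0. Qed.

Lemma innerDl f g h : L2 mu A f -> L2 mu A g -> L2 mu A h ->
  inner mu A (fun x => f x + g x) h = inner mu A f h + inner mu A g h.
Proof.
move=> Lf Lg Lh; rewrite /inner -RintegralD//; [|exact: L2_mul_integrable..].
by apply: eq_Rintegral => x _; rewrite mulrDl.
Qed.

Lemma innerZl c f g : L2 mu A f -> L2 mu A g ->
  inner mu A (fun x => c * f x) g = c * inner mu A f g.
Proof.
move=> Lf Lg; rewrite /inner -RintegralZl//; last exact: L2_mul_integrable.
by apply: eq_Rintegral => x _; rewrite mulrA.
Qed.

Lemma innerBl f g h : L2 mu A f -> L2 mu A g -> L2 mu A h ->
  inner mu A (fun x => f x - g x) h = inner mu A f h - inner mu A g h.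
Proof.
move=> Lf Lg Lh; rewrite /inner -RintegralB//; [|exact: L2_mul_integrable..].
by apply: eq_Rintegral => x _; rewrite mulrBl.
Qed.

Lemma inner0l f : inner mu A (fun=> 0) f = 0.
Proof.
rewrite /inner /Rintegral; under eq_integral do rewrite mul0r.
by rewrite integral0.
Qed.

Lemma inner_suml I (r : seq I) (P : pred I) (F : I -> X -> R) g :
  (forall i, P i -> L2 mu A (F i)) -> L2 mu A g ->
  inner mu A (fun x => \sum_(i <- r | P i) F i x) g =
  \sum_(i <- r | P i) inner mu A (F i) g.
Proof.
move=> LF Lg; elim: r => [|i r IH].
  by rewrite big_nil; under [X in inner mu A X _]eq_fun do rewrite big_nil; exact: inner0l.
rewrite big_cons; under [X in inner mu A X _]eq_fun do rewrite big_cons.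
case Pi: (P i) => //; rewrite innerDl ?IH//; first exact: LF.
exact: L2_sum.
Qed.

Lemma innerDr f g h : L2 mu A f -> L2 mu A g -> L2 mu A h ->
  inner mu A h (fun x => f x + g x) = inner mu A h f + inner mu A h g.
Proof. by move=> *; rewrite innerC innerDl// (innerC f) (innerC g). Qed.

Lemma innerBr f g h : L2 mu A f -> L2 mu A g -> L2 mu A h ->
  inner mu A h (fun x => f x - g x) = inner mu A h f - inner mu A h g.
Proof. by move=> *; rewrite innerC innerBl// (innerC f) (innerC g). Qed.

Lemma innerZr c f g : L2 mu A f -> L2 mu A g ->
  inner mu A g (fun x => c * f x) = c * inner mu A g f.
Proof. by move=> *; rewrite innerC innerZl// (innerC f). Qed.

Lemma inner_sumr I (r : seq I) (P : pred I) (F : I -> X -> R) g :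
  (forall i, P i -> L2 mu A (F i)) -> L2 mu A g ->
  inner mu A g (fun x => \sum_(i <- r | P i) F i x) =
  \sum_(i <- r | P i) inner mu A g (F i).
Proof.
by move=> *; rewrite innerC inner_suml//; apply: eq_bigr => i _; exact: innerC.
Qed.

(** The squared norm of [a f - b g] is nonnegative for all [a] and [b]; the choice
    [a = <g, g>], [b = <f, g>] gives the inequality times [<g, g>]. *)
Lemma cauchy_schwarz f g : L2 mu A f -> L2 mu A g ->
  inner mu A f g ^+ 2 <= inner mu A f f * inner mu A g g.
Proof.
move=> Lf Lg.
have key (a b : R) : 0 <= a ^+ 2 * inner mu A f f - (a * b * inner mu A f g) *+ 2
    + b ^+ 2 * inner mu A g g.
  have := inner_ge0 (fun x => a * f x - b * g x).
  have Laf := L2_Z a Lf; have Lbg := L2_Z b Lg.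
  rewrite innerBl//; last exact: L2_B.
  rewrite !innerBr// !innerZl// ?innerZr//; [|exact: L2_Z..].
  rewrite (innerC g f); lra.
have f0 := inner_ge0 f; have g0 := inner_ge0 g.
set F := inner mu A f f in key f0 *; set G := inner mu A g g in key g0 *.
set H := inner mu A f g in key *.
have [G0|G0] := eqVneq G 0.
  have [->|H0] := eqVneq H 0; first by rewrite G0 mulr0 expr0n.
  (* With G = 0 the form is affine in b: this b makes it F - 2 (F + 1) < 0. *)
  have := key 1 ((F + 1) / H); rewrite G0 mulr0 addr0 expr1n !mul1r divfK//.
  by lra.
have {G0} G0 : 0 < G by rewrite lt_def G0.
have := key G H; rewrite (_ : _ + _ = G * (F * G - H ^+ 2)); last by ring.
by rewrite pmulr_rge0// subr_ge0.
Qed.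

Lemma inner_sqrD f g : L2 mu A f -> L2 mu A g ->
  inner mu A (fun x => f x + g x) (fun x => f x + g x) =
  inner mu A f f + inner mu A f g *+ 2 + inner mu A g g.
Proof.
move=> Lf Lg; have Lfg := L2_D Lf Lg.
rewrite innerDl// !innerDr// (innerC g f); lra.
Qed.

Lemma inner_sqrB f g : L2 mu A f -> L2 mu A g ->
  inner mu A (fun x => f x - g x) (fun x => f x - g x) =
  inner mu A f f - inner mu A f g *+ 2 + inner mu A g g.
Proof.
move=> Lf Lg; have Lfg := L2_B Lf Lg.
rewrite innerBl// !innerBr// (innerC g f); lra.
Qed.

Lemma inner_sqrD_le f g : L2 mu A f -> L2 mu A g ->
  inner mu A (fun x => f x + g x) (fun x => f x + g x) <=
  2 * inner mu A f f + 2 * inner mu A g g.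
Proof.
move=> Lf Lg; rewrite inner_sqrD//; have := inner_ge0 (fun x => f x - g x).
by rewrite inner_sqrB//; lra.
Qed.

Lemma sqnorm_eq f g : (forall x, A x -> f x = g x) -> sqnorm mu A f = sqnorm mu A g.
Proof. by move=> fg; apply: eq_integral => x /set_mem Ax; rewrite fg. Qed.

Lemma inner_eq f g f' g' : (forall x, A x -> f x = f' x) ->
  (forall x, A x -> g x = g' x) -> inner mu A f g = inner mu A f' g'.
Proof. by move=> ff gg; apply: eq_Rintegral => x /set_mem Ax; rewrite ff// gg. Qed.

Lemma L2_eq f g : (forall x, A x -> f x = g x) -> L2 mu A f -> L2 mu A g.
Proof.
move=> fg [mf fy]; split; last by rewrite -(sqnorm_eq fg).
by apply: eq_measurable_fun mf => x /set_mem; exact: fg.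
Qed.

Lemma sqnorm_eq0_ae f : measurable_fun A f -> sqnorm mu A f = 0%E ->
  {ae mu, forall x, A x -> f x = 0}.
Proof.
move=> mf f0.
have : ae_eq mu A (fun x => (f x ^+ 2)%:E) (cst 0%E).
  apply/ae_eq_integral_abs => //; first exact: measurable_sqr.
  by rewrite -{}[RHS]f0; apply: eq_integral => x _; rewrite gee0_abs.
by apply: filterS => x fx Ax; have := fx Ax => -[/eqP]; rewrite sqrf_eq0 => /eqP.
Qed.

End L2_space.

(** * Completeness of L2 *)

Lemma limf_esup_le {T : choiceType} {Y : filteredType T} {R : realType}
    (f : Y -> \bar R) (F : set (set Y)) (c : \bar R) :
  F [set x | (f x <= c)%E] -> (limf_esup f F <= c)%E.
Proof.
move=> Fc; apply: ge_ereal_inf; exists (ereal_sup (f @` [set x | (f x <= c)%E])).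
  by exists [set x | (f x <= c)%E].
by apply: ge_ereal_sup => _ [x xc <-].
Qed.

Lemma geometric_half_lty {R : realType} :
  (\sum_(k <oo) ((2^-1 : R) ^+ k)%:E < +oo)%E.
Proof.
have := @cvg_geometric_eseries_half R 2 0; rewrite expr0 divr1 => c2.
under eq_eseriesr => k _.
  rewrite (_ : 2^-1 ^+ k = 2 / (2 ^ (k + 1))%:R); last first.
    by rewrite addn1 natrX exprS invfM mulrA divff// !mul1r exprVn.
  over.
by rewrite (cvg_lim _ c2)// ltry.
Qed.

Section L2_complete.
Context {disp : measure_display} {X : measurableType disp} {R : realType}.
Variables (mu : {measure set X -> \bar R}) (A : set X).
Hypothesis mA : measurable A.

(** The terms [h k] are absolutely summable because [|h k| <= 2^-k + 2^k (h k)^2]. *)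
Lemma cvg_weighted_sqr (h : nat -> R) (u : nat -> R) :
  (forall n, h n = u n.+1 - u n) ->
  (\sum_(k <oo) (2 ^+ k * h k ^+ 2)%:E < +oo)%E -> cvgn u.
Proof.
move=> hE hy.
have p0 k : (0 <= (2 ^+ k * h k ^+ 2)%:E)%E.
  by rewrite lee_fin mulr_ge0 ?sqr_ge0// exprn_ge0.
have S0 : (0 <= \sum_(k <oo) (2 ^+ k * h k ^+ 2)%:E)%E by exact: nneseries_ge0.
set S := (\sum_(k <oo) (2 ^+ k * h k ^+ 2)%:E)%E in hy S0.
have cabs : cvgn [normed series h].
  apply: nondecreasing_is_cvgn; first by apply: nondecreasing_series => k _ _; exact: normr_ge0.
  exists (2 + fine S) => _ [n _ <-] /=.
  have : \sum_(0 <= k < n) (2 ^+ k * h k ^+ 2) <= fine S.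
    rewrite -lee_fin fineK ?ge0_fin_numE// -sumEFin.
    by apply: nneseries_lim_ge => k _ _.
  have : \sum_(0 <= k < n) geometric 1 2^-1 k <= 2 :> R.
    have e : 1 * (1 - 2^-1)^-1 = 2 :> R by field.
    rewrite -[leRHS]e.
    apply: (@geometric_le_lim R n 1 2^-1); [by []|by rewrite invr_gt0|].
    by rewrite ger0_norm ?invr_ge0// invf_lt1// ltr1n.
  move=> h1 h2; apply: (le_trans _ (lerD h1 h2)).
  rewrite seriesEnat /= -big_split /=; apply: ler_sum_nat => k _.
  rewrite mul1r exprVn -real_normK ?num_real//.
  have k0 : 0 < 2 ^+ k :> R by exact: exprn_gt0.
  have := sqr_ge0 (2 ^+ k * `|h k| - 1); have := normr_ge0 (h k).
  move: (2 ^+ k) k0 (`|h k|) => p p0' q q0 pq.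
  rewrite -(ler_pM2l p0') mulrDr mulfV ?gt_eqF//; nra.
have := normed_cvg cabs.
have -> : u = (fun n => u 0 + series h n).
  apply/funext => n; elim: n => [|n IH]; first by rewrite /series/= big_geq// addr0.
  by rewrite seriesSr addrA -IH hE addrC subrK.
by move=> ch; apply: is_cvgD => //; exact: is_cvg_cst.
Qed.

(** Completeness in a quantitative form: the squared distances are bounded by the
    increments of a convergent sequence [v], and the limit inherits the rate [V - v n].
    Along a subsequence [M] the squared increments are at most [4^-k], so the sum of
    [2^k (h k)^2] has a finite integral and is finite almost everywhere; there
    [cvg_weighted_sqr] gives pointwise convergence, and Fatou's lemma transfers the
    bounds to the limit. Setting the limit to 0 elsewhere makes it measurable on the
    whole space, which allows it to be used on larger sets than [A]. *)
Lemma L2_complete (f : nat -> X -> R) (v : nat -> R) (V : R) :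
  (forall n, L2 mu A (f n)) ->
  (forall m n, (m <= n)%N ->
    inner mu A (fun x => f n x - f m x) (fun x => f n x - f m x) <= v n - v m) ->
  v @ \oo --> V ->
  exists g : X -> R, [/\ measurable_fun setT g, forall x, ~ A x -> g x = 0, L2 mu A g &
    forall n, inner mu A (fun x => g x - f n x) (fun x => g x - f n x) <= V - v n].
Proof.
move=> Lf fv vV.
have ndv : {homo v : m n / (m <= n)%N >-> m <= n}.
  by move=> m n mn; rewrite -subr_ge0; exact: le_trans (inner_ge0 _ _ _) (fv _ _ mn).
have vleV n : v n <= V.
  by rewrite -(cvg_lim _ vV)//; apply: nondecreasing_cvgn_le => //; apply/cvg_ex; exists V.
have /choice[N HN] : forall k, exists n, V - v n <= 4^-1 ^+ k.
  move=> k; have /cvgrPdist_le /(_ (4^-1 ^+ k)) := vV.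
  have -> : 0 < 4^-1 ^+ k :> R by rewrite exprn_gt0.
  move=> /(_ isT) [n _ /(_ n)] /= /(_ (leqnn _)) h; exists n.
  exact: le_trans (ler_norm _) h.
(* Partial sums of N make the subsequence monotone while keeping its rate. *)
pose M k := (\sum_(j < k.+1) (N j).+1)%N.
have MS k : (M k <= M k.+1)%N by rewrite /M [leqRHS]big_ord_recr leq_addr.
have Mv k : V - v (M k) <= 4^-1 ^+ k.
  apply: le_trans (HN k); rewrite lerD2l lerN2; apply: ndv.
  by rewrite /M big_ord_recr /= (leq_trans (leqnSn _))// leq_addl.
have kM k : (k <= M k)%N.
  elim: k => // k IH; rewrite /M big_ord_recr /= -[X in (X <= _)%N]addn1.
  exact: leq_add.
pose h k x := f (M k.+1) x - f (M k) x.
have Lh k : L2 mu A (h k) by exact: L2_B.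
pose S x := (\sum_(k <oo) (2 ^+ k * h k x ^+ 2)%:E)%E.
have t0 k x : (0 <= (2 ^+ k * h k x ^+ 2)%:E)%E.
  by rewrite lee_fin mulr_ge0 ?sqr_ge0// exprn_ge0.
have mt k : measurable_fun A (fun x => (2 ^+ k * h k x ^+ 2)%:E : \bar R).
  apply/measurable_EFinP; apply: measurable_funM => //.
  by apply: measurable_funX; have [] := Lh k.
have mS : measurable_fun A S by exact: ge0_emeasurable_sum.
have S0 x : (0 <= S x)%E by apply: nneseries_ge0.
have intS : (\int[mu]_(x in A) S x < +oo)%E.
  rewrite integral_nneseries//.
  apply: le_lt_trans (@geometric_half_lty R).
  apply: lee_nneseries => [k _ _|k _].
    exact: integral_ge0.
  under eq_integral do rewrite EFinM.
  rewrite ge0_integralZl//; last 2 first.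
    by apply: measurable_sqr; have [] := Lh k.
    by move=> x _; rewrite lee_fin sqr_ge0.
  rewrite -/(sqnorm mu A (h k)) (sqnormE mA (Lh k)) -EFinM lee_fin.
  have : inner mu A (h k) (h k) <= 4^-1 ^+ k.
    by apply: le_trans (fv _ _ (MS k)) _; apply: le_trans (Mv k); rewrite lerD2r.
  have p2 : 0 <= 2 ^+ k :> R by exact: exprn_ge0.
  move=> /(ler_wpM2l p2) /le_trans; apply.
  by rewrite -exprMn (_ : 2 * 4^-1 = 2^-1)//; field.
pose B := A `&` [set x | (S x < +oo)%E].
have mB : measurable B by apply: measurable_lte => //; exact: measurable_cst.
pose N0 := A `\` B.
have mN0 : measurable N0 by exact: measurableD.
have muN0 : mu N0 = 0%E.
  apply/negligibleP => //.
  have /(integrable_ae mA) : mu.-integrable A S.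
    by apply/integrableP; split => //; under eq_integral do rewrite gee0_abs//.
  apply: negligibleS => x [Ax /= nBx] /= /(_ Ax) Sx; apply: nBx; split => //=.
  by rewrite -ge0_fin_numE.
have BE : B = A `\` N0.
  by rewrite /N0 setDD; apply/seteqP; split => [x [Ax Sx]|x [Ax []]].
have cB x : B x -> cvgn (fun k => f (M k) x).
  by case=> Ax Sx; apply: (@cvg_weighted_sqr (fun k => h k x)).
pose g x : R := if x \in B then limn (fun k => f (M k) x) else 0.
have gB x : B x -> f (M k) x @[k --> \oo] --> g x.
  by move=> Bx; rewrite /g mem_set//; exact: cB.
have mfn n : measurable_fun A (f n) by have [] := Lf n.
have BA : B `<=` A by exact: subIsetl.
have mgB : measurable_fun B g.
  apply: (measurable_fun_cvg (fun k => measurable_funS mA BA (mfn (M k)))).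
  exact: gB.
have mg : measurable_fun setT g.
  have -> : g = g \_ B.
    by apply/funext => x; rewrite patchE /g; case: ifP.
  by apply/(measurable_restrictT g mB).
have mgA : measurable_fun A g by exact: measurable_funS mg.
have key n : (sqnorm mu A (fun x => g x - f n x)%R <= (V - v n)%:E)%E.
  rewrite /sqnorm (@ge0_negligible_integral _ _ _ mu A N0)//; last 2 first.
    by apply: measurable_sqr; exact: measurable_funB.
    by move=> x _; rewrite lee_fin sqr_ge0.
  rewrite -BE.
  rewrite (eq_integral (fun x => limn_einf
    (fun k => ((f (M k) x - f n x) ^+ 2)%:E))); last first.
    move=> x /set_mem Bx; apply/esym.
    have [-> //] : (limn_einf (fun k => ((f (M k) x - f n x) ^+ 2)%:E) =
      ((g x - f n x) ^+ 2)%:E) *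
      (limn_esup (fun k => ((f (M k) x - f n x) ^+ 2)%:E) = ((g x - f n x) ^+ 2)%:E).
    apply: cvg_limn_einf_sup; apply: cvg_EFin; first exact: nearW.
    rewrite /comp/=; under eq_fun do rewrite expr2; rewrite expr2.
    by apply: cvgM; (apply: cvgB; [exact: gB|exact: cvg_cst]).
  apply: le_trans (fatou _ _ _ _) _ => //.
  - move=> k; apply: measurable_sqr; apply: measurable_funB.
      exact: measurable_funS (mfn _).
    exact: measurable_funS (mfn _).
  - by move=> k x _; rewrite lee_fin sqr_ge0.
  apply: le_trans (limn_einf_sup _) _; apply: limf_esup_le.
  exists n => // k /= nk; apply: (@le_trans _ _ (sqnorm mu A (fun x => f (M k) x - f n x))).
    apply: ge0_subset_integral => //.
      by apply: measurable_sqr; exact: measurable_funB.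
    by move=> x _; rewrite lee_fin sqr_ge0.
  rewrite sqnormE//; last exact: L2_B.
  rewrite lee_fin; apply: le_trans (fv _ _ (leq_trans nk (kM k))) _.
  by rewrite lerD2r.
have Lgf n : L2 mu A (fun x => g x - f n x).
  split; first exact: measurable_funB.
  exact: le_lt_trans (key n) (ltry _).
have Lg : L2 mu A g.
  by apply: L2_eq (L2_D mA (Lgf 0%N) (Lf 0%N)) => x _; rewrite subrK.
exists g; split => //.
  by move=> x Ax; rewrite /g memNset// => -[].
by move=> n; rewrite -lee_fin -sqnormE.
Qed.
End L2_complete.

(** * Moment problems *)

Section moment_problem.
Context {disp : measure_display} {X : measurableType disp} {R : realType}.
Variables (mu : {measure set X -> \bar R}) (A : set X).
Hypothesis mA : measurable A.

Lemma inner_sum_sum (e : nat -> X -> R) (b b' : nat -> R) (n n' : nat) :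
  (forall m, L2 mu A (e m)) ->
  inner mu A (fun x => \sum_(i < n) b i * e i x) (fun x => \sum_(j < n') b' j * e j x) =
  \sum_(i < n) b i * \sum_(j < n') b' j * inner mu A (e i) (e j).
Proof.
move=> Le; rewrite inner_suml//; last 2 first.
- by move=> i _; exact: L2_Z.
- by apply: L2_sum => // i _; exact: L2_Z.
apply: eq_bigr => i _; rewrite innerZl//; last by apply: L2_sum => // j _; exact: L2_Z.
congr (_ * _); rewrite inner_sumr//; last by move=> j _; exact: L2_Z.
by apply: eq_bigr => j _; rewrite innerZr.
Qed.

Variables (e : nat -> X -> R) (c : nat -> R) (K : R).
Hypothesis Le : forall m, L2 mu A (e m).
Hypothesis K0 : 0 <= K.
Hypothesis ec : forall N (b : nat -> R), (\sum_(m < N) b m * c m) ^+ 2 <=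
  K * inner mu A (fun x => \sum_(m < N) b m * e m x) (fun x => \sum_(m < N) b m * e m x).

Let extend N (w : 'I_N -> R) (i : nat) : R := oapp w 0 (insub i).

Let extendE N (w : 'I_N -> R) (i : 'I_N) : extend w i = w i.
Proof. by rewrite /extend valK. Qed.

Let L2_comb N (b : nat -> R) : L2 mu A (fun x => \sum_(m < N) b m * e m x).
Proof. by apply: L2_sum => // m _; exact: L2_Z. Qed.

(** The system for [b] has the Gram matrix [Q] of the [e j]. It is solvable even when
    the [e j] are linearly dependent: a vector [w] of the kernel of [Q] is a combination
    of norm zero, and the assumed inequality forces [sum w m * c m = 0]. *)
Lemma finite_moment_problem N : exists b : nat -> R, forall m, (m < N)%N ->
  inner mu A (fun x => \sum_(j < N) b j * e j x) (e m) = c m.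
Proof.
pose Q : 'M[R]_N := \matrix_(i, j) inner mu A (e i) (e j).
pose r : 'rV[R]_N := \row_j c j.
have : (r <= Q)%MS.
  rewrite submxE; apply/eqP/rowP => k; rewrite [RHS]mxE mxE.
  pose w := extend (fun i => cokermx Q i k).
  have := ec N w; rewrite inner_sum_sum//.
  have -> : \sum_(i < N) w i * (\sum_(j < N) w j * inner mu A (e i) (e j)) = 0.
    apply: big1 => i _; have := congr1 (fun B : 'M[R]_N => B i k) (mulmx_coker Q).
    rewrite [X in _ = X]mxE mxE => Qw.
    rewrite -[RHS](mulr0 (w i)); congr (_ * _); apply: etrans Qw.
    by apply: eq_bigr => j _; rewrite mxE /w extendE mulrC.
  rewrite mulr0 => s0; have /eqP : (\sum_(m < N) w m * c m) ^+ 2 = 0.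
    by apply/le_anti; rewrite s0 sqr_ge0.
  rewrite sqrf_eq0 => /eqP {s0} s0; rewrite -[RHS]s0.
  by apply: eq_bigr => j _; rewrite mxE /w extendE mulrC.
case/submxP => D rD; exists (extend (fun i => D 0 i)) => m mN.
rewrite inner_suml//; last by move=> j _; exact: L2_Z.
have := congr1 (fun B : 'rV[R]_N => B 0 (Ordinal mN)) rD; rewrite !mxE /= => ->.
by apply: eq_bigr => j _; rewrite mxE /= extendE innerZl.
Qed.

(** The inequality [(sum b m * c m)^2 <= K |sum b m e m|^2] says that [e m |-> c m]
    extends to a bounded functional on the span of the [e m]; [u] is its Riesz
    representative, obtained as the limit of the solutions [u n] of the first [n]
    equations lying in the span of the first [n] vectors. Such [u n] are the orthogonal
    projections of one another, so their squared norms [v n] increase,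
    [|u n - u m|^2 = v n - v m], and the inequality tested on [u n] itself gives
    [v n <= K]. *)
Lemma moment_problem : exists u : X -> R, [/\ measurable_fun setT u,
  forall x, ~ A x -> u x = 0, L2 mu A u, forall m, inner mu A u (e m) = c m &
  inner mu A u u <= K].
Proof.
have /choice[b bE] := finite_moment_problem.
pose u n x := \sum_(j < n) b n j * e j x.
pose v n := \sum_(j < n) b n j * c j.
have Lu n : L2 mu A (u n) by exact: L2_comb.
have innu n g : L2 mu A g -> (forall m, (m < n)%N -> inner mu A g (e m) = c m) ->
    inner mu A g (u n) = v n.
  move=> Lg gc; rewrite inner_sumr//; last by move=> j _; exact: L2_Z.
  by apply: eq_bigr => j _; rewrite innerZr// gc.
have uc n m : (m < n)%N -> inner mu A (u n) (e m) = c m by exact: bE.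
have vE n : inner mu A (u n) (u n) = v n by apply: innu => // m; exact: uc.
have uv m n : (m <= n)%N ->
    inner mu A (fun x => u n x - u m x) (fun x => u n x - u m x) = v n - v m.
  move=> mn; rewrite inner_sqrB// !vE innu//; first lra.
  by move=> k km; apply: uc; exact: leq_trans mn.
have vK n : v n <= K.
  have := ec n (b n); rewrite -/(v n) -/(u n) vE.
  have := inner_ge0 mu A (u n); rewrite vE le_eqVlt => /predU1P[<- //|v0].
  by rewrite expr2 ler_pM2r.
have ndv : {homo v : m n / (m <= n)%N >-> m <= n}.
  by move=> m n mn; rewrite -subr_ge0 -uv//; exact: inner_ge0.
have cv : cvgn v.
  by apply: nondecreasing_is_cvgn => //; exists K => _ [n _ <-]; exact: vK.
have uv' m n : (m <= n)%N ->
    inner mu A (fun x => u n x - u m x) (fun x => u n x - u m x) <= v n - v m.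
  by move=> /uv ->.
have [g [mg gA Lg gu]] := L2_complete mA Lu uv' cv.
set V := limn v in gu.
have VK : V <= K by apply: limr_le => //; exact: nearW.
have gc m : inner mu A g (e m) = c m.
  apply/eqP; rewrite -subr_eq0 -sqrf_eq0 eq_le sqr_ge0 andbT.
  set E := inner mu A (e m) (e m).
  have cE : (V - v n) * E @[n --> \oo] --> 0.
    by rewrite -[0](mul0r E) -(subrr V); apply: cvgMl; apply: cvgB => //; exact: cvg_cst.
  rewrite -(cvg_lim _ cE)//; apply: limr_ge; first by apply/cvg_ex; exists 0.
  exists m.+1 => // n /= mn.
  rewrite -(uc n m mn) -innerBl//.
  apply: (le_trans (cauchy_schwarz mA (L2_B mA Lg (Lu n)) (Le m))).
  by rewrite ler_wpM2r ?inner_ge0// gu.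
exists g; split => //.
have := gu 0%N; rewrite inner_sqrB// vE innu//.
lra.
Qed.
End moment_problem.

(** * Measurability and integration on products *)

Section open_measurable.
Context {R : realType} {d : nat}.

(** The sigma-algebra is generated by the coordinates, so an open set has to be written
    as a countable union of boxes: those with rational centres and radii. *)
Lemma open_measurable_rV (U : set 'rV[R]_d) : open U -> measurable U.
Proof.
move=> oU.
pose box (p : 'rV[rat]_d * rat) : set 'rV[R]_d :=
  [set y : 'rV[R]_d | forall i, ball (ratr (p.1 ord0 i) : R) (ratr p.2) (y ord0 i)].
have mbox p : measurable (box p).
  rewrite (_ : box p = \bigcap_(i in [set: 'I_d])
     ((fun y : 'rV[R]_d => y ord0 i) @^-1` ball (ratr (p.1 ord0 i) : R) (ratr p.2))).
    apply: fin_bigcap_measurable => // i _; rewrite -[X in measurable X]setTI.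
    by apply: measurable_coord => //; exact: measurable_ball.
  by apply/seteqP; split => y h i; [move=> _|]; exact: h.
have -> : U = \bigcup_p (if `[< box p `<=` U >] then box p else set0).
  apply/seteqP; split => [x Ux|x [p _]]; last by case: asboolP => // + /= bx; exact.
  have /nbhs_ballP[e /= e0 eU] : nbhs x U by exact: open_nbhs_nbhs.
  have e20 : 0 < e / 2 by rewrite divr_gt0.
  have [r] := rat_in_itvoo e20; rewrite in_itv /= => /andP[r0 re].
  have /choice[q qE] : forall i : 'I_d, exists q : rat, `|ratr q - x ord0 i| < ratr r.
    move=> i; have : x ord0 i - ratr r < x ord0 i + ratr r by lra.
    move=> /rat_in_itvoo[q]; rewrite in_itv /= => /andP[q1 q2]; exists q.
    by rewrite ltr_norml; apply/andP; split; lra.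
  exists (\row_i q i, r) => //; rewrite asboolT.
    by move=> i /=; rewrite mxE; exact: qE.
  move=> y yb; apply: eU; split => // i j; rewrite ord1 /ball /=.
  have := qE j; have := yb j; rewrite mxE /ball /= => h1 h2.
  rewrite (_ : _ - _ = - (ratr (q j) - x ord0 j) + (ratr (q j) - y ord0 j)); last by ring.
  by rewrite (le_lt_trans (ler_normD _ _))// normrN; lra.
apply: countable_bigcupT_measurable; first exact: countableP.
by move=> p; case: asboolP.
Qed.

Lemma continuous_measurable_rV (f : 'rV[R]_d -> R) :
  continuous f -> measurable_fun setT f.
Proof.
move=> /continuousP cf.
apply: (measurability _ (RGenOpens.measurableE R)).
move=> _ [_ [a [b ->] <-]]; rewrite setTI; apply: open_measurable_rV.
by apply: cf; exact: interval_open.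
Qed.

End open_measurable.

Section integral_fine.
Context {disp : measure_display} {X : measurableType disp} {R : realType}.
Variables (mu : {measure set X -> \bar R}) (D : set X) (F : X -> \bar R).
Hypotheses (mD : measurable D) (iF : mu.-integrable D F).

Let aeF : ae_eq mu D (fun x => (fine (F x))%:E) F.
Proof.
by have := integrable_ae mD iF; apply: filterS => x h /h Fx; rewrite fineK.
Qed.

Let mF : measurable_fun D (fun x => (fine (F x))%:E : \bar R).
Proof.
apply/measurable_EFinP; apply: measurableT_comp => //.
exact: measurable_int iF.
Qed.

(** The inner integral of a double integral is finite only almost everywhere; these two
    lemmas allow it to be replaced by its finite part. *)
Lemma integrable_fine : mu.-integrable D (fun x => (fine (F x))%:E).
Proof.
apply/integrableP; split => //.
have /integrableP[mF' Fy] := iF; apply: le_lt_trans Fy.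
rewrite le_eqVlt; apply/orP; left; apply/eqP; apply: ge0_ae_eq_integral => //.
- exact: measurableT_comp.
- exact: measurableT_comp.
- by move: aeF; apply: filterS => x h Ax; rewrite h.
Qed.

Lemma Rintegral_fine : \int[mu]_(x in D) fine (F x) = fine (\int[mu]_(x in D) F x)%E.
Proof.
rewrite /Rintegral; congr fine; apply: ae_eq_integral => //.
exact: measurable_int iF.
Qed.

End integral_fine.

Section product_sets.
Context {d1 d2 : measure_display} {X : measurableType d1} {Y : measurableType d2}
  {R : realType}.
Variables (m1 : {sigma_finite_measure set X -> \bar R})
  (m2 : {sigma_finite_measure set Y -> \bar R}).
Variables (A : set X) (B : set Y).
Hypotheses (mA : measurable A) (mB : measurable B).

Let mAB : measurable (A `*` B). Proof. exact: measurableX. Qed.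

Lemma measurable_fun_prod1 d3 (Z : measurableType d3) (f : X -> Z) : measurable_fun A f ->
  measurable_fun (A `*` B) (fun p : X * Y => f p.1).
Proof.
move=> mf _ C mC.
rewrite (_ : _ `&` _ = (A `&` f @^-1` C) `*` B); last first.
  by apply/seteqP; split => -[x y] /= => [[[]]|[[]]].
by apply: measurableX => //; exact: mf.
Qed.

Lemma measurable_fun_prod2 d3 (Z : measurableType d3) (f : Y -> Z) : measurable_fun B f ->
  measurable_fun (A `*` B) (fun p : X * Y => f p.2).
Proof.
move=> mf _ C mC.
rewrite (_ : _ `&` _ = A `*` (B `&` f @^-1` C)); last first.
  by apply/seteqP; split => -[x y] /= => [[[]]|[? []]].
by apply: measurableX => //; exact: mf.
Qed.

Lemma measurable_fun_section d3 (Z : measurableType d3) (f : X * Y -> Z) x :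
  measurable_fun (A `*` B) f -> A x -> measurable_fun B (fun y => f (x, y)).
Proof.
move=> mf Ax _ C mC; have := measurable_xsection x (mf mAB C mC).
rewrite (_ : xsection _ _ = B `&` (fun y => f (x, y)) @^-1` C)//.
apply/seteqP; split => y; rewrite /xsection /= in_setE /=; tauto.
Qed.

Let restrictE (f : X * Y -> \bar R) x :
  (\int[m2]_y (f \_ (A `*` B)) (x, y) = ((fun x => \int[m2]_(y in B) f (x, y)) \_ A) x)%E.
Proof.
rewrite patchE; case: ifPn => [/set_mem Ax|/negP Ax].
  rewrite [RHS]integral_mkcond; apply: eq_integral => y _; rewrite !patchE.
  congr (if _ then _ else _); by apply/idP/idP => [/set_mem[_ By]|/set_mem By]; apply/mem_set.
apply: integral0_eq => y _; rewrite patchE; case: ifPn => // /set_mem [/= /mem_set].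
by move/Ax.
Qed.

Section nonnegative.
Variable f : X * Y -> \bar R.
Hypotheses (mf : measurable_fun (A `*` B) f) (f0 : forall p, (0 <= f p)%E).

Let mfr : measurable_fun setT (f \_ (A `*` B)).
Proof. by apply/(measurable_restrictT f mAB). Qed.

Let fr0 p : (0 <= (f \_ (A `*` B)) p)%E.
Proof. by rewrite patchE; case: ifP. Qed.

Lemma measurable_integral_prod :
  measurable_fun A (fun x => \int[m2]_(y in B) f (x, y))%E.
Proof.
apply/(measurable_restrictT _ mA).
have := measurable_fun_fubini_tonelli_F (m2 := m2) _ mfr fr0.
by congr (measurable_fun _ _); apply/funext => x; exact: restrictE.
Qed.

Lemma ge0_integral_prod : (\int[m1 \x m2]_(p in A `*` B) f p =
  \int[m1]_(x in A) \int[m2]_(y in B) f (x, y))%E.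
Proof.
rewrite integral_mkcond (fubini_tonelli1 _ mfr fr0) [RHS]integral_mkcond.
by apply: eq_integral => x _; exact: restrictE.
Qed.

End nonnegative.

Lemma integrable_tensor (a : X -> R) (b : Y -> R) :
  m1.-integrable A (EFin \o a) -> m2.-integrable B (EFin \o b) ->
  (m1 \x m2)%E.-integrable (A `*` B) (EFin \o (fun p : X * Y => a p.1 * b p.2)).
Proof.
move=> /integrableP[/measurable_EFinP ma ay] /integrableP[/measurable_EFinP mb yb].
have mab : measurable_fun (A `*` B) (fun p : X * Y => a p.1 * b p.2).
  apply: measurable_funM; first exact: measurable_fun_prod1.
  exact: measurable_fun_prod2.
apply/integrableP; split; first exact/measurable_EFinP.
rewrite ge0_integral_prod//=; last first.
  by apply/measurable_EFinP; exact: measurableT_comp.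
rewrite (eq_integral (fun x => (\int[m2]_(y in B) `|(b y)%:E|) * `|(a x)%:E|)%E); last first.
  move=> x _; rewrite muleC -ge0_integralZl//; last first.
    by apply: measurableT_comp => //; exact/measurable_EFinP.
  by apply: eq_integral => y _; rewrite /= normrM EFinM.
set I := (\int[m2]_(y in B) _)%E in yb *.
have I0 : (0 <= I)%E by apply: integral_ge0.
rewrite ge0_integralZl//; last first.
  by apply: measurableT_comp => //; exact/measurable_EFinP.
by apply: lte_mul_pinfty => //; rewrite ge0_fin_numE.
Qed.

Lemma L2_tensor (a : X -> R) (b : Y -> R) : L2 m1 A a -> L2 m2 B b ->
  L2 (m1 \x m2)%E (A `*` B) (fun p : X * Y => a p.1 * b p.2).
Proof.
move=> La Lb; split.
  apply: measurable_funM; first by apply: measurable_fun_prod1; have [] := La.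
  by apply: measurable_fun_prod2; have [] := Lb.
have := integrable_tensor (L2_mul_integrable mA La La) (L2_mul_integrable mB Lb Lb).
move=> /integrableP[_]; apply: le_lt_trans; rewrite le_eqVlt; apply/orP; left; apply/eqP.
apply: eq_integral => p _; rewrite gee0_abs /=; last by rewrite lee_fin mulr_ge0 -?expr2 ?sqr_ge0.
by congr EFin; rewrite expr2; ring.
Qed.

Section integrable_prod.
Variable f : X * Y -> R.
Hypothesis fi : (m1 \x m2)%E.-integrable (A `*` B) (EFin \o f).

Let fir : (m1 \x m2)%E.-integrable setT ((EFin \o f) \_ (A `*` B)).
Proof. by rewrite -integrable_mkcond. Qed.

Let F x := (\int[m2]_(y in B) (f (x, y))%:E)%E.

Let FiA : m1.-integrable A F.
Proof.
rewrite (integrable_mkcond _ mA); have := integrable_fubini_F fir.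
by congr (_.-integrable _ _); apply/funext => x; exact: restrictE.
Qed.

Lemma integrable_Rintegral_prod :
  m1.-integrable A (fun x => (\int[m2]_(y in B) f (x, y))%:E).
Proof. exact: integrable_fine FiA. Qed.

Lemma Rintegral_prod : \int[(m1 \x m2)%E]_(p in A `*` B) f p =
  \int[m1]_(x in A) \int[m2]_(y in B) f (x, y).
Proof.
rewrite [RHS](Rintegral_fine mA FiA) /Rintegral; congr fine.
rewrite integral_mkcond -(integral12_prod_meas1 fir) [RHS]integral_mkcond.
by apply: eq_integral => x _; exact: restrictE.
Qed.

Let G y := (\int[m1]_(x in A) (f (x, y))%:E)%E.

Let restrictE' y : (\int[m1]_x ((EFin \o f) \_ (A `*` B)) (x, y) = (G \_ B) y)%E.
Proof.
rewrite patchE; case: ifPn => [/set_mem By|/negP By].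
  rewrite [RHS]integral_mkcond; apply: eq_integral => x _; rewrite !patchE.
  congr (if _ then _ else _).
  by apply/idP/idP => [/set_mem[Ax _]|/set_mem Ax]; apply/mem_set.
apply: integral0_eq => x _; rewrite patchE; case: ifPn => // /set_mem [_ /= /mem_set].
by move/By.
Qed.

Let GiB : m2.-integrable B G.
Proof.
pose h := (EFin \o f) \_ (A `*` B).
have mh : measurable_fun setT h by exact: measurable_int fir.
rewrite (integrable_mkcond _ mB).
have -> : G \_ B = fun y => (\int[m1]_x h (x, y))%E.
  by apply/funext => y; rewrite -restrictE'.
apply/integrableP; split; first exact: (measurable_fubini_G fir).
apply: le_lt_trans ((integrable21ltyP m1 m2 mh).1 fir).
apply: ge0_le_integral => //.
- by apply: measurableT_comp => //; exact: (measurable_fubini_G fir).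
- apply: (measurable_fun_fubini_tonelli_G (abse \o h)) => //=.
  exact: measurableT_comp.
- move=> y _; apply: le_abse_integral => //.
  exact: measurableT_comp mh (pair2_measurable y).
Qed.

Lemma Rintegral_prod_swap :
  \int[m1]_(x in A) \int[m2]_(y in B) f (x, y) =
  \int[m2]_(y in B) \int[m1]_(x in A) f (x, y).
Proof.
rewrite -Rintegral_prod [RHS](Rintegral_fine mB GiB) /Rintegral; congr fine.
rewrite integral_mkcond -(integral21_prod_meas1 fir) [RHS]integral_mkcond.
by apply: eq_integral => y _; exact: restrictE'.
Qed.

End integrable_prod.
End product_sets.

(** * Observability from the spectral inequality *)

Section interval_integrals.
Context {R : realType}.
Notation leb := (@lebesgue_measure R).

Lemma cvg_sum (X : Type) (F : set_system X) {FF : Filter F} (I : Type) (r : seq I)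
    (P : pred I) (f : I -> X -> R) (l : I -> R) : (forall i, f i x @[x --> F] --> l i) ->
  \sum_(i <- r | P i) f i x @[x --> F] --> \sum_(i <- r | P i) l i.
Proof. by move=> fl; apply: cvg_big => //; exact: add_continuous. Qed.

Lemma continuous_integrable_itv (f : R -> R) (a b : R) : continuous f ->
  leb.-integrable `[a, b] (EFin \o f).
Proof.
move=> cf; apply: continuous_compact_integrable; first exact: segment_compact.
exact: continuous_subspaceT.
Qed.

Lemma Rintegral_itv_split (f : R -> R) (a b c : R) : a <= b -> b <= c ->
  leb.-integrable `[a, c] (EFin \o f) ->
  \int[leb]_(t in `[a, c]) f t =
  \int[leb]_(t in `[a, b]) f t + \int[leb]_(t in `[b, c]) f t.
Proof.
move=> ab bc fi; have := @Rintegral_itvB R f (BLeft a) (BRight c) b fi.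
rewrite !bnd_simp => /(_ ab bc).
rewrite Rintegral_itv_obnd_cbnd; first by move=> <-; rewrite addrC subrK.
apply: integrableS fi => //; apply: subset_itvr; first by rewrite bnd_simp.
Qed.

Lemma lebesgue_itv_cc (a b : R) : a <= b -> fine (leb `[a, b]%classic) = b - a.
Proof.
move=> ab; rewrite lebesgue_measure_itv /= lte_fin; case: ltgtP ab => //= -> _.
by rewrite subrr.
Qed.

End interval_integrals.

Section observability.
Context {disp : measure_display} {Y : measurableType disp} {R : realType}.
Notation leb := (@lebesgue_measure R).
Variables (m : {measure set Y -> \bar R}) (Om om : set Y).
Hypotheses (mOm : measurable Om) (mom : measurable om) (omOm : om `<=` Om).
Variables (mu : nat -> R) (psi : nat -> Y -> R) (beta : R).
Hypothesis mu_ge0 : forall k, 0 <= mu k.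
Hypothesis beta_gt0 : 0 < beta.
Hypothesis Lpsi : forall k, L2 m Om (psi k).
Hypothesis ortho : forall k l, inner m Om (psi k) (psi l) = (k == l)%:R.
Hypothesis spec : forall (lambda : R) N (b : nat -> R), 0 < lambda ->
  \sum_(k < N | Num.sqrt (mu k) <= lambda) b k ^+ 2 <= expR (beta * lambda) *
  inner m om (fun x => \sum_(k < N | Num.sqrt (mu k) <= lambda) b k * psi k x)
             (fun x => \sum_(k < N | Num.sqrt (mu k) <= lambda) b k * psi k x).

Lemma L2_subset (f : Y -> R) : L2 m Om f -> L2 m om f.
Proof.
move=> [mf fy]; split; first exact: measurable_funS mf.
apply: le_lt_trans fy; apply: ge0_subset_integral => //; first exact: measurable_sqr.
by move=> x _; rewrite lee_fin sqr_ge0.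
Qed.

Lemma inner_subset_le (f : Y -> R) : L2 m Om f -> inner m om f f <= inner m Om f f.
Proof.
move=> Lf; rewrite -lee_fin -!sqnormE//; last exact: L2_subset.
apply: ge0_subset_integral => //; first by apply: measurable_sqr; have [] := Lf.
by move=> x _; rewrite lee_fin sqr_ge0.
Qed.

(** Pythagoras; the predicate [P] serves to split sums by frequency. *)
Lemma orthonormal_sqr N (P : pred nat) (b : nat -> R) :
  inner m Om (fun x => \sum_(k < N | P k) b k * psi k x)
             (fun x => \sum_(k < N | P k) b k * psi k x) = \sum_(k < N | P k) b k ^+ 2.
Proof.
have Lb k : L2 m Om (fun x => b k * psi k x) by exact: L2_Z.
rewrite inner_suml//; last by apply: L2_sum.
apply: eq_bigr => k Pk; rewrite inner_sumr// (bigD1 k)//= big1 => [|j /andP[_ jk]].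
  by rewrite innerZl// innerZr// ortho eqxx mulr1 addr0 expr2.
by rewrite innerZl// innerZr// ortho eq_sym (negbTE (jk : (j : nat) != k)) !mulr0.
Qed.

Section combination.
Variables (N : nat) (b : nat -> R).

(* z is a solution of the heat equation run backwards in time: its modes grow, those of
   high frequency most. F and g are its squared norms on Om and on om. *)
Let a k t := b k * expR (mu k * t).
Let z t x := \sum_(k < N) a k t * psi k x.
Let F t := \sum_(k < N) a k t ^+ 2.
Let g t := inner m om (z t) (z t).

Let Lz (P : pred nat) t : L2 m Om (fun x => \sum_(k < N | P k) a k t * psi k x).
Proof. by apply: L2_sum => // k _; exact: L2_Z. Qed.

Let F_le s t : s <= t -> F s <= F t.
Proof.
move=> st; apply: ler_sum => k _; rewrite !exprMn ler_wpM2l ?sqr_ge0//.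
by rewrite lerXn2r ?nnegrE ?expR_ge0// ler_expR ler_wpM2l.
Qed.

Let F_ge0 t : 0 <= F t. Proof. by apply: sumr_ge0 => k _; exact: sqr_ge0. Qed.

Let g_ge0 t : 0 <= g t. Proof. exact: inner_ge0. Qed.

Let cg : continuous g.
Proof.
have La k : L2 m om (psi k) by exact: L2_subset.
have -> : g = fun t => \sum_(i < N) a i t * \sum_(j < N) a j t * inner m om (psi i) (psi j).
  by apply/funext => t; rewrite /g /z (inner_sum_sum mom (a ^~ t) (a ^~ t)).
have ca k : continuous (a k).
  move=> t; apply: cvgMr; apply: continuous_comp; last exact: continuous_expR.
  by apply: cvgMr; exact: cvg_id.
move=> t; apply: cvg_sum => i; apply: cvgM; first exact: ca.
by apply: cvg_sum => j; apply: cvgMl; exact: ca.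
Qed.

(** The spectral inequality bounds the modes of [z s] below the frequency [lam] by [g s]
    plus the contribution of the higher modes, and the latter are small at time [s]
    because between [s] and [t] they grow by at least [exp (lam^2 * (t - s))]. *)
Let pointwise lam s t : 0 < lam -> s <= t ->
  F s <= 2 * expR (beta * lam) * g s +
    3 * expR (beta * lam) * expR (- 2 * lam ^+ 2 * (t - s)) * F t.
Proof.
move=> lam0 st.
pose P := [pred k : nat | Num.sqrt (mu k) <= lam].
pose low x := \sum_(k < N | P k) a k s * psi k x.
pose high x := \sum_(k < N | ~~ P k) a k s * psi k x.
have Llow : L2 m om low by apply: L2_subset; exact: Lz.
have Lhigh : L2 m Om high by exact: (Lz (predC P)).
pose Fh := \sum_(k < N | ~~ P k) a k s ^+ 2.
have FE : F s = \sum_(k < N | P k) a k s ^+ 2 + Fh.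
  by rewrite /F (bigID (fun k : 'I_N => P k)).
have high_le : inner m om high high <= Fh.
  apply: le_trans (inner_subset_le Lhigh) _.
  by have -> : inner m Om high high = Fh by exact: (orthonormal_sqr N (predC P) (a ^~ s)).
have low_le : inner m om low low <= 2 * g s + 2 * Fh.
  have Lzs : L2 m om (z s) by apply: L2_subset; exact: (Lz predT).
  have Lh : L2 m om (fun x => -1 * high x) by apply: L2_Z => //; exact: L2_subset.
  have -> : low = fun x => z s x + -1 * high x.
    apply/funext => x; rewrite /z (bigID (fun k : 'I_N => P k)) /= -/(low x) -/(high x).
    by rewrite mulN1r addrK.
  apply: le_trans (inner_sqrD_le mom Lzs Lh) _.
  rewrite innerZl//; [|exact: L2_subset..].
  rewrite innerZr//; [|exact: L2_subset..].
  by rewrite -/(g s); lra.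
have Fh_le : Fh <= expR (- 2 * lam ^+ 2 * (t - s)) * F t.
  rewrite /F (bigID (fun k : 'I_N => P k)) /= mulrDr ler_wpDl//.
    by rewrite mulr_ge0 ?expR_ge0// sumr_ge0// => k _; exact: sqr_ge0.
  rewrite big_distrr /=; apply: ler_sum => k; rewrite -ltNge => lamk.
  have muk : lam ^+ 2 < mu k.
    rewrite -[ltRHS]sqr_sqrtr//; rewrite ltrXn2r// ?nnegrE ?sqrtr_ge0// ?ltW//.
  rewrite /a !exprMn [leRHS]mulrCA ler_wpM2l ?sqr_ge0// !expr2 -!expRD ler_expR.
  have : lam ^+ 2 * (t - s) <= mu k * (t - s) by rewrite ler_wpM2r ?subr_ge0// ltW.
  by rewrite expr2; lra.
have e1 : 1 <= expR (beta * lam) by rewrite -expR0 ler_expR mulr_ge0// ltW.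
have h1 := spec N (a ^~ s) lam0; rewrite -/low in h1.
rewrite FE.
have Fh0 : 0 <= Fh by apply: sumr_ge0 => k _; exact: sqr_ge0.
set E := expR (beta * lam) in e1 h1 *.
apply: (@le_trans _ _ (E * (2 * g s + 2 * Fh) + Fh)).
  by rewrite lerD2r; apply: le_trans h1 _; rewrite ler_wpM2l// expR_ge0.
rewrite -mulrA [X in _ <= _ + X](_ : _ = 3 * E * (expR (- 2 * lam ^+ 2 * (t - s)) * F t)); last by ring.
have : 3 * E * Fh <= 3 * E * (expR (- 2 * lam ^+ 2 * (t - s)) * F t).
  by rewrite ler_wpM2l//; lra.
nra.
Qed.

Let I s t := \int[leb]_(x in `[s, t]) g x.

Let I_ge0 s t : 0 <= I s t. Proof. by apply: Rintegral_ge0 => x _. Qed.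

Let I_split s t u : s <= t -> t <= u -> I s u = I s t + I t u.
Proof. by move=> st tu; apply: Rintegral_itv_split => //; exact: continuous_integrable_itv. Qed.

(** [pointwise] between [x] and [s + tau], averaged over the times [x] in the first part
    of the window [[s, s + tau]], of length [delta * tau]; from any such [x] the high
    modes still have a time [(1 - delta) * tau] to grow. *)
Let window lam s tau delta : 0 < lam -> 0 < tau -> 0 < delta < 1 ->
  delta * tau * expR (- (beta * lam)) / 3 * F s <=
    I s (s + tau) + delta * tau * expR (- 2 * lam ^+ 2 * ((1 - delta) * tau)) * F (s + tau).
Proof.
move=> lam0 tau0 /andP[d0 d1].
have dt0 : 0 < delta * tau by rewrite mulr_gt0.
have dt1 : delta * tau <= tau by rewrite ger_pMl// ltW.
set E := expR (beta * lam); set e := expR (- 2 * lam ^+ 2 * _).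
have E0 : 0 < E by exact: expR_gt0.
have ge : leb.-integrable `[s, s + delta * tau] (EFin \o g) by exact: continuous_integrable_itv.
have cge (c : R) : leb.-integrable `[s, s + delta * tau] (EFin \o cst c).
  by apply: continuous_integrable_itv; exact: cst_continuous.
have gE : leb.-integrable `[s, s + delta * tau] (EFin \o (fun x => 2 * E * g x)).
  by apply: continuous_integrable_itv => t; apply: cvgMr; exact: cg.
have : \int[leb]_(x in `[s, s + delta * tau]) (cst (F s) x) <=
       \int[leb]_(x in `[s, s + delta * tau]) (2 * E * g x + 3 * E * e * F (s + tau)).
  apply: le_Rintegral => //.
    apply: continuous_integrable_itv => t; apply: cvgD; last exact: cvg_cst.
    by apply: cvgMr; exact: cg.
  move=> x; rewrite /= in_itv /= => /andP[sx xs].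
  apply: le_trans (F_le sx) _; apply: (le_trans (pointwise lam0 (_ : x <= s + tau))).
    by lra.
  rewrite lerD2l ler_wpM2r// ler_wpM2l//.
  rewrite ler_expR !mulNr lerN2 ler_wpM2l//; [by rewrite !mulr_ge0// ltW|by lra].
rewrite (@RintegralD _ _ _ leb _ (fun x => 2 * E * g x) (cst (3 * E * e * F (s + tau))))//.
rewrite RintegralZl// !Rintegral_cst// lebesgue_itv_cc; last by lra.
have : I s (s + delta * tau) <= I s (s + tau).
  rewrite (@I_split s (s + delta * tau) (s + tau)); [|lra..].
  by rewrite lerDl.
rewrite -/(I s _) => I1 h.
have F1 := F_ge0 (s + tau).
have e0 : 0 <= e by exact: expR_ge0.
rewrite expRN -/E -(ler_pM2l (_ : 0 < 3 * E)); last by lra.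
rewrite [leLHS](_ : _ = F s * (s + delta * tau - s)); last by field; rewrite gt_eqF.
apply: le_trans h _.
have hE : E * I s (s + delta * tau) <= E * I s (s + tau) by rewrite ler_pM2l.
have EI0 : 0 <= E * I s (s + tau) by rewrite mulr_ge0// ltW.
lra.
Qed.

(** The frequency cut-off on a window of length [tau] is [obs_rate T / tau]. It satisfies
    [obs_rate T * (1 - T) = beta + 2 T / beta]: the term [beta] is what the telescoping
    in [observability] needs at leading order, and [2 T / beta] leaves room for the
    numerical constants, yet vanishes with [T]. *)
Definition obs_rate (T : R) := (beta + 2 / beta * T) / (1 - T).

(** The inverse of the coefficient of [F S] in the first window of [observability], which
    has length [T / 2]. *)
Definition obs_cost (T : R) := 6 / T ^+ 2 * expR (2 * beta * obs_rate T / T).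

(** The interval [[S, S + T]] is tiled by windows of lengths [T/2], [T/4], and so on.
    Writing [r] for [obs_rate T], [window] with [lam = r / tau] and [delta = T] bounds
    [f tau * F s], where [f tau] is of order [exp (- beta r / tau)], by the observation
    on the window plus a term of order [exp (- 2 r^2 (1 - T) / tau) * F (s + tau)]. Since
    [r * (1 - T) >= beta], this last coefficient is at most [f (tau / 2)], so that the
    inequalities of consecutive windows telescope and leave [f (T / 2) * F S] on the
    left, whence a cost of order [exp (2 beta r / T)].

    Lengths decreasing with ratio [q] would require [r] close to [beta / (2 q)] and a
    first window of length [(1 - q) * T], hence a cost
    [exp (beta^2 / (2 q (1 - q) T))]: the ratio 1/2 is the best one. *)
Lemma observability (S T : R) : 0 < T -> T <= 2^-1 -> F S <= obs_cost T * I S (S + T).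
Proof.
move=> T0 T2.
have [r rD] : exists r, r = obs_rate T by exists (obs_rate T).
pose t k := S + T - T / 2 ^+ k; pose tau k : R := T / 2 ^+ k.+1.
have b0 : 0 < 2 / beta by rewrite divr_gt0.
have rE : r * (1 - T) = beta + 2 / beta * T by rewrite rD /obs_rate divfK//; lra.
have r_beta : beta <= r.
  rewrite rD /obs_rate ler_pdivlMr; last by lra.
  by have := mulr_gt0 b0 T0; have := mulr_gt0 beta_gt0 T0; lra.
pose f (x : R) : R := T * x * expR (- (beta * (r / x))) / 3.
have tau0 k : 0 < tau k by rewrite divr_gt0// exprn_gt0.
have tauS k : tau k.+1 = tau k / 2.
  by rewrite /tau [2 ^+ k.+2]exprSr invfM mulrA.
have tS k : t k.+1 = t k + tau k.
  rewrite /t /tau exprS; have k0 : 2 ^+ k != 0 :> R by rewrite expf_neq0.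
  by field.
have tau_le k : tau k <= T / 2.
  elim: k => [|k IH]; first by rewrite /tau expr1.
  by rewrite tauS; have := tau0 k; lra.
have step k : f (tau k) * F (t k) - f (tau k.+1) * F (t k.+1) <= I (t k) (t k.+1).
  have x0 := tau0 k; have xT := tau_le k.
  rewrite tS tauS; move: (tau k) x0 xT => x x0 xT.
  have r0 : 0 < r by exact: lt_le_trans r_beta.
  have lam0 : 0 < r / x by rewrite divr_gt0.
  have d01 : 0 < T < 1 by lra.
  have := window (t k) lam0 x0 d01; rewrite -/(f x) => w.
  rewrite lerBlDr; apply: le_trans w _; rewrite lerD2l ler_wpM2r//.
  rewrite /f [leRHS](_ : _ = T * x * (expR (- (beta * (r / (x / 2)))) / 6)); last by field.
  rewrite ler_pM2l ?mulr_gt0//.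
  rewrite ler_pdivlMr//.
  (* The term 2 T / beta of the rate gains an exponent 4 r T / (beta x) >= 8, since
     r >= beta and x <= T / 2, and exp 8 absorbs the factor 6. *)
  apply: (@le_trans _ _ (expR (- 2 * (r / x) ^+ 2 * ((1 - T) * x)) * expR 8)).
    rewrite ler_wpM2l ?expR_ge0//; apply: le_trans (expR_ge1Dx 8); lra.
  rewrite -expRD ler_expR.
  rewrite (_ : - 2 * (r / x) ^+ 2 * ((1 - T) * x) = - 2 * r * (r * (1 - T)) / x); last first.
    by field; rewrite gt_eqF.
  rewrite rE (_ : - (beta * (r / (x / 2))) = - 2 * r * beta / x); last by field; rewrite gt_eqF.
  rewrite -(ler_pM2r x0) mulrDl !divfK; [|lra..].
  have : 8 * x <= 2 * r * (2 / beta * T).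
    have : 4 * T <= 2 * r * (2 / beta * T).
      have : 2 <= r * (2 / beta).
        by rewrite mulrA ler_pdivlMr// mulrC ler_pM2r.
      nra.
    lra.
  lra.
have sumstep n : f (tau 0%N) * F (t 0%N) <= I (t 0%N) (t n) + f (tau n) * F (t n).
  elim: n => [|n IH]; first by rewrite lerDr.
  have tn k : t k <= t k.+1 by rewrite tS lerDl ltW.
  have t0n : t 0%N <= t n by elim: {IH} n => // n IH; exact: le_trans (tn n).
  by rewrite (I_split t0n (tn n)); have := step n; lra.
have t0E : t 0%N = S by rewrite /t expr0 divr1 addrK.
have tT n : t n <= S + T by rewrite /t lerBlDr lerDl divr_ge0 ?exprn_ge0// ltW.
have St n : S <= t n.
  rewrite /t -addrA lerDl subr_ge0 ler_pdivrMr ?exprn_gt0// ler_peMr//.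
    exact: ltW.
  by apply: exprn_ege1; lra.
have bound n : f (tau 0%N) * F S <= I S (S + T) + tau n * F (S + T).
  have := sumstep n; rewrite t0E => /le_trans; apply; apply: lerD.
    by rewrite (I_split (St n) (tT n)) lerDl.
  have fx x : 0 < x -> f x <= x.
    move=> x0; have e1 : expR (- (beta * (r / x))) <= 1.
      rewrite -expR0 ler_expR oppr_le0 mulr_ge0 ?ltW// divr_gt0//.
      exact: lt_le_trans r_beta.
    rewrite /f; have := expR_gt0 (- (beta * (r / x))).
    move: (expR _) e1 => e e1 e0.
    have Te : T * e <= 1 by rewrite -[leRHS]mulr1 ler_pM// ?ltW//; lra.
    have : x * (T * e) <= x * 1 by rewrite ler_pM2l.
    lra.
  apply: ler_pM => //; [|exact: fx|exact: F_le].
  by rewrite /f !mulr_ge0 ?expR_ge0// ltW.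
have lim_bound : f (tau 0%N) * F S <= I S (S + T).
  have cb : I S (S + T) + tau n * F (S + T) @[n --> \oo] --> I S (S + T).
    rewrite -[X in _ --> X]addr0 -[X in _ --> _ + X](mul0r (F (S + T))).
    apply: cvgD; first exact: cvg_cst.
    apply: cvgMl.
    rewrite (_ : tau = geometric (T / 2) 2^-1); first by apply: cvg_geometric; rewrite ger0_norm; lra.
    by apply/funext => n; rewrite /tau /= exprS invfM mulrA exprVn.
  rewrite -(cvg_lim _ cb)//; apply: limr_ge; first by apply/cvg_ex; eexists; exact: cb.
  by apply: nearW.
have f0 : f (tau 0%N) = (obs_cost T)^-1.
  rewrite /f /tau expr1 /obs_cost.
  rewrite (_ : - (beta * (r / (T / 2))) = - (2 * beta * obs_rate T / T)); last first.
    by rewrite rD; field; rewrite gt_eqF.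
  rewrite expRN; have := expR_gt0 (2 * beta * obs_rate T / T).
  move: (expR _) => e e0.
  by field; rewrite !gt_eqF.
have c0 : 0 < obs_cost T by rewrite /obs_cost mulr_gt0 ?expR_gt0// divr_gt0// exprn_gt0.
by rewrite -ler_pdivrMl// -f0.
Qed.

End combination.
End observability.

(** * The control cost *)

Section cost.
Context {R : realType}.
Variable beta : R.
Hypothesis beta_gt0 : 0 < beta.

(** The observability estimate holds for times at most 1/2; over a longer time only the
    last part, of length 1/2, is observed. *)
Definition control_cost (T : R) : R := obs_cost beta (Num.min T 2^-1).

Lemma control_cost_gt0 T : 0 < T -> 0 < control_cost T.
Proof.
move=> T0; rewrite /control_cost /obs_cost mulr_gt0 ?expR_gt0// divr_gt0//.
by rewrite exprn_gt0// lt_min T0 invr_gt0 ltr0n.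
Qed.

(** The factor [T^-2] of the cost is negligible at this scale:
    [ln (T^-2) = 4 ln (T^(-1/2)) <= 4 T^(-1/2)]. *)
Lemma ln_control_cost_le T : 0 < T -> T < 2^-1 ->
  T * ln (control_cost T) <= T * ln 6 + 4 * Num.sqrt T + 2 * beta * obs_rate beta T.
Proof.
move=> T0 T2; rewrite /control_cost min_l; last exact: ltW.
rewrite /obs_cost.
have T20 : 0 < T ^- 2 by rewrite invr_gt0 exprn_gt0.
rewrite lnM ?posrE ?expR_gt0 ?mulr_gt0// expRK lnM ?posrE//.
have s0 : 0 < Num.sqrt T by rewrite sqrtr_gt0.
have sT : Num.sqrt T ^+ 2 = T by rewrite sqr_sqrtr// ltW.
have : ln (T ^- 2) <= 4 / Num.sqrt T.
  have -> : T ^- 2 = (Num.sqrt T)^-1 ^+ 4 by rewrite -{1}sT -exprM exprVn.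
  rewrite lnXn ?invr_gt0// -[leLHS]mulr_natl ler_wpM2l//.
  by apply/ltW/ln_sublinear; rewrite invr_gt0.
move=> /(ler_wpM2l (ltW T0)) h.
rewrite -addrA mulrDr -[leRHS]addrA lerD2l mulrDr; apply: lerD.
  apply: le_trans h _; rewrite -{1}sT expr2 mulrA mulrAC mulfK ?gt_eqF//.
  by rewrite mulrC.
by rewrite mulrC divfK ?gt_eqF.
Qed.

(** The first two terms of [ln_control_cost_le] vanish with [T], and [obs_rate T] tends
    to [beta]. *)
Lemma limsup_control_cost :
  (limf_esup (fun T : R => (T * ln (control_cost T))%:E) (0%R : R)^'+ <= (2 * beta ^+ 2)%:E)%E.
Proof.
apply/lee_addgt0Pr => e e0; apply: limf_esup_le; rewrite /=.
have hc : T * ln 6 + 4 * Num.sqrt T + 2 * beta * obs_rate beta T @[T --> (0 : R)^'+]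
    --> 0 * ln 6 + 4 * Num.sqrt 0 + 2 * beta * ((beta + 2 / beta * 0) / (1 - 0)).
  apply: cvg_at_right_filter; apply: cvgD; first apply: cvgD.
  - by apply: cvgMl; exact: cvg_id.
  - by apply: cvgMr; exact: sqrt_continuous.
  - apply: cvgMr; apply: cvgM.
      by apply: cvgD; [exact: cvg_cst|apply: cvgMr; exact: cvg_id].
    by apply: cvgV; [rewrite subr0 oner_neq0|apply: cvgB; [exact: cvg_cst|exact: cvg_id]].
rewrite sqrtr0 mul0r !mulr0 !add0r addr0 subr0 divr1 -mulrA -expr2 in hc.
have /cvgrPdist_le/(_ _ e0) hn := hc.
near=> T; rewrite /= -EFinD lee_fin.
have T0 : 0 < T by near: T; exact: nbhs_right_gt.
apply: le_trans (ln_control_cost_le T0 _) _.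
  by near: T; apply: nbhs_right_lt; rewrite invr_gt0.
rewrite -lerBlDl; apply: le_trans (ler_norm _) _; rewrite distrC.
by near: T.
Unshelve. all: by end_near.
Qed.

End cost.

(** * The space H10 *)

Section sqnorm_convergence.
Context {disp : measure_display} {X : measurableType disp} {R : realType}.
Variables (mu : {measure set X -> \bar R}) (A : set X).
Hypothesis mA : measurable A.

(** Convergence to 0 of extended nonnegative quantities without prior knowledge that
    they are finite. *)
Lemma ge0_cvge0P (I : Type) (F : set_system I) {FF : Filter F} (u : I -> \bar R) :
  (forall n, 0 <= u n)%E ->
  (u @ F --> 0%E <-> forall e : R, 0 < e -> \forall n \near F, (u n <= e%:E)%E).
Proof.
move=> u0; split=> [cu e e0|h].
  have oe : nbhs (0%E : \bar R) [set y | (y < e%:E)%E].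
    by apply: open_ereal_lt'; rewrite lte_fin.
  by near=> n; apply: ltW; near: n; exact: (cu _ oe).
apply/fine_cvgP; split.
  near=> n; have un : (u n <= 1%:E)%E by near: n; exact: h.
  by rewrite ge0_fin_numE// (le_lt_trans un) ?ltry.
apply/cvgrPdist_le => e e0; near=> n.
have un : (u n <= e%:E)%E by near: n; exact: h.
rewrite /= sub0r normrN ger0_norm ?fine_ge0// -lee_fin fineK// ge0_fin_numE//.
exact: le_lt_trans un (ltry _).
Unshelve. all: by end_near.
Qed.

Lemma sqnorm_cvg0D (f g : nat -> X -> R) :
  (forall n, measurable_fun A (f n)) -> (forall n, measurable_fun A (g n)) ->
  sqnorm mu A (f n) @[n --> \oo] --> 0%E -> sqnorm mu A (g n) @[n --> \oo] --> 0%E ->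
  sqnorm mu A (fun x => f n x + g n x) @[n --> \oo] --> 0%E.
Proof.
move=> mf mg.
move=> /(ge0_cvge0P (fun n => sqnorm_ge0 mu A (f n))) cf.
move=> /(ge0_cvge0P (fun n => sqnorm_ge0 mu A (g n))) cg.
apply/(ge0_cvge0P (fun n => sqnorm_ge0 mu A _)) => e e0.
have e4 : 0 < e / 4 by rewrite divr_gt0.
near=> n; apply: le_trans (sqnormD_le mu mA (mf n) (mg n)) _.
have -> : e%:E = (2%:E * (e / 4)%:E + 2%:E * (e / 4)%:E)%E.
  by rewrite -!EFinM -EFinD; congr EFin; field.
have cfn : (sqnorm mu A (f n) <= (e / 4)%:E)%E by near: n; exact: cf.
have cgn : (sqnorm mu A (g n) <= (e / 4)%:E)%E by near: n; exact: cg.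
by apply: leeD; exact: lee_wpmul2l.
Unshelve. all: by end_near.
Qed.

Lemma sqnorm_cvg0Z (c : R) (f : nat -> X -> R) : (forall n, measurable_fun A (f n)) ->
  sqnorm mu A (f n) @[n --> \oo] --> 0%E ->
  sqnorm mu A (fun x => c * f n x) @[n --> \oo] --> 0%E.
Proof.
move=> mf cf; under eq_fun do rewrite sqnormZ//.
by rewrite -(mule0 (c ^+ 2)%:E); apply: cvgeZl.
Qed.

End sqnorm_convergence.

Section test_functions.
Context {R : realType} {d : nat}.
Implicit Types f g phi : 'rV[R]_d -> R.

Let comb f (c : R) g : 'rV[R]_d -> R := fun x => f x + c * g x.

Lemma derivable_comb f g c x (v : 'rV[R]_d) : derivable f x v -> derivable g x v ->
  derivable (comb f c g) x v.
Proof. by move=> df dg; apply: derivableD => //; exact: derivableZ. Qed.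

Lemma partial_comb i f g c :
  (forall x, derivable f x (delta_mx ord0 i)) ->
  (forall x, derivable g x (delta_mx ord0 i)) ->
  partial i (comb f c g) = comb (partial i f) c (partial i g).
Proof.
move=> df dg; apply/funext => x; rewrite /partial /comb.
have := deriveD (df x) (@derivableZ _ _ _ _ c _ _ (dg x)).
by rewrite deriveZ.
Qed.

Lemma foldr_partial_comb k f g c s : Ck k f -> Ck k g -> (size s <= k)%N ->
  foldr (@partial R d) (comb f c g) s =
  comb (foldr (@partial R d) f s) c (foldr (@partial R d) g s).
Proof.
move=> Cf Cg; elim: s => //= i s IH sk.
rewrite IH; last exact: ltnW.
by apply: partial_comb => x; [apply: (Cf s _).2|apply: (Cg s _).2] => //; exact: ltnW.
Qed.

Lemma Ck_comb k f g c : Ck k f -> Ck k g -> Ck k (comb f c g).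
Proof.
move=> Cf Cg s sk; rewrite (foldr_partial_comb c Cf Cg sk).
have [cf df] := Cf s sk; have [cg dg] := Cg s sk; split=> [x|ks i x].
  exact: (continuousD (cf x) (continuousM (@cst_continuous _ _ c x) (cg x))).
by apply: derivable_comb; [exact: df|exact: dg].
Qed.

Lemma test_function_comb Omega f g c : test_function Omega f -> test_function Omega g ->
  test_function Omega (comb f c g).
Proof.
move=> [Cf cf sf] [Cg cg sg].
have sub : closure [set x | comb f c g x != 0] `<=`
    closure [set x | f x != 0] `|` closure [set x | g x != 0].
  rewrite -closureU; apply: closureS => x /=; rewrite /comb => h.
  have [f0|] := eqVneq (f x) 0; last by left.
  by right; apply: contra_neq h => g0; rewrite f0 g0 mulr0 addr0.
split; first by move=> k; exact: Ck_comb.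
- apply: subclosed_compact sub; first exact: closed_closure.
  exact: compactU.
- by move=> x /sub[/sf|/sg].
Qed.

Lemma test_function0 (Omega : set 'rV[R]_d) : test_function Omega (fun=> 0).
Proof.
have p0 s : foldr (@partial R d) (fun=> 0) s = fun=> 0.
  elim: s => //= i s ->; apply/funext => x; exact: derive_cst.
have supp0 : [set x : 'rV[R]_d | (0 : R) != 0] = set0.
  by apply/seteqP; split => x //=; rewrite eqxx.
split.
- move=> k s sk; rewrite p0; split=> [|_ i x]; first exact: cst_continuous.
  exact: derivable_cst.
- by rewrite supp0 closure0; exact: compact0.
- by rewrite supp0 closure0.
Qed.

Lemma measurable_test_function Omega phi : test_function Omega phi ->
  measurable_fun setT phi.
Proof.
by case=> C _ _; apply: continuous_measurable_rV; have [] := C 0%N [::] isT.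
Qed.

Lemma measurable_partial_test_function Omega phi i : test_function Omega phi ->
  measurable_fun setT (partial i phi).
Proof.
by case=> C _ _; apply: continuous_measurable_rV; have [] := C 1%N [:: i] isT.
Qed.

End test_functions.

Section H10_space.
Context {R : realType} {d : nat}.
Notation leb_d := (@lebesgue_rV R d).
Variable Omega : set 'rV[R]_d.
Hypothesis mO : measurable Omega.
Implicit Types (f : 'rV[R]_d -> R) (G : 'I_d -> 'rV[R]_d -> R).

Lemma H10_0 : H10 Omega (fun=> 0) (fun _ _ => 0).
Proof.
have L0 : L2 leb_d Omega (fun=> 0) by exact: L2_0.
split => //; exists (fun _ _ => 0); split => [n|| i].
- exact: test_function0.
- apply: cvg_near_cst; apply: nearW => n; rewrite -[RHS](integral0 leb_d Omega).
  by apply: eq_integral => x _; rewrite /= subr0 expr0n.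
- apply: cvg_near_cst; apply: nearW => n; rewrite -[RHS](integral0 leb_d Omega).
  apply: eq_integral => x _ /=; rewrite subr0.
  by rewrite (_ : partial i (fun=> 0) x = 0) ?expr0n//; exact: derive_cst.
Qed.

Lemma H10_comb f G f' G' (c : R) : H10 Omega f G -> H10 Omega f' G' ->
  H10 Omega (fun x => f x + c * f' x) (fun i x => G i x + c * G' i x).
Proof.
move=> [Lf LG [phi [tphi cphi cG]]] [Lf' LG' [phi' [tphi' cphi' cG']]].
have mf : measurable_fun Omega f by have [] := Lf.
have mf' : measurable_fun Omega f' by have [] := Lf'.
have mG i : measurable_fun Omega (G i) by have [] := LG i.
have mG' i : measurable_fun Omega (G' i) by have [] := LG' i.
have mt n : measurable_fun Omega (phi n).
  exact: measurable_funS (measurable_test_function (tphi n)).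
have mt' n : measurable_fun Omega (phi' n).
  exact: measurable_funS (measurable_test_function (tphi' n)).
have mp n i : measurable_fun Omega (partial i (phi n)).
  exact: measurable_funS (measurable_partial_test_function i (tphi n)).
have mp' n i : measurable_fun Omega (partial i (phi' n)).
  exact: measurable_funS (measurable_partial_test_function i (tphi' n)).
split => [|i|].
- by apply: L2_D => //; exact: L2_Z.
- by apply: L2_D => //; exact: L2_Z.
exists (fun n x => phi n x + c * phi' n x); split=> [n||i].
- exact: test_function_comb.
- rewrite (_ : (fun n => _) = fun n => sqnorm leb_d Omega (fun x =>
     (phi n x - f x) + c * (phi' n x - f' x))); last first.
    by apply/funext => n; apply: eq_integral => x _; congr EFin; rewrite /=; ring.
  apply: sqnorm_cvg0D => //.
  + by move=> n; exact: measurable_funB.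
  + by move=> n; apply: measurable_funM => //; exact: measurable_funB.
  + by apply: sqnorm_cvg0Z => // n; exact: measurable_funB.
- rewrite (_ : (fun n => _) = fun n => sqnorm leb_d Omega (fun x =>
     (partial i (phi n) x - G i x) + c * (partial i (phi' n) x - G' i x))); last first.
    apply/funext => n; apply: eq_integral => x _; congr EFin.
    have [C _ _] := tphi n; have [C' _ _] := tphi' n.
    have -> : partial i (fun x => phi n x + c * phi' n x) =
        fun x => partial i (phi n) x + c * partial i (phi' n) x.
      apply: partial_comb => y; first by have [_ /(_ isT i y)] := C 1%N [::] isT.
      by have [_ /(_ isT i y)] := C' 1%N [::] isT.
    by rewrite /=; ring.
  apply: sqnorm_cvg0D => //.
  + by move=> n; exact: measurable_funB.
  + by move=> n; apply: measurable_funM => //; exact: measurable_funB.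
  + exact: cG.
  + apply: (@sqnorm_cvg0Z _ _ _ _ _ _ c (fun n x => partial i (phi' n) x - G' i x)) => //.
      by move=> n; exact: measurable_funB.
    exact: cG'.
Qed.

Lemma H10_sum (N : nat) (c : nat -> R) (f : nat -> 'rV[R]_d -> R)
    (G : nat -> 'I_d -> 'rV[R]_d -> R) :
  (forall k, H10 Omega (f k) (G k)) ->
  H10 Omega (fun x => \sum_(k < N) c k * f k x) (fun i x => \sum_(k < N) c k * G k i x).
Proof.
move=> HfG; elim: N => [|N IH].
  have -> : (fun x => \sum_(k < 0) c k * f k x) = fun=> 0.
    by apply/funext => x; rewrite big_ord0.
  have -> : (fun i x => \sum_(k < 0) c k * G k i x) = fun _ _ => 0.
    by apply/funext => i; apply/funext => x; rewrite big_ord0.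
  exact: H10_0.
have -> : (fun x => \sum_(k < N.+1) c k * f k x) =
    fun x => \sum_(k < N) c k * f k x + c N * f N x.
  by apply/funext => x; rewrite big_ord_recr.
have -> : (fun i x => \sum_(k < N.+1) c k * G k i x) =
    fun i x => \sum_(k < N) c k * G k i x + c N * G N i x.
  by apply/funext => i; apply/funext => x; rewrite big_ord_recr.
exact: (H10_comb _ IH (HfG N)).
Qed.

(** A diagonal argument: the k-th approximant is replaced by a test function at squared
    distance at most [1 / (k + 1)] from it, for the function and all its partial
    derivatives at once. *)
Lemma H10_closed f G (fk : nat -> 'rV[R]_d -> R)
    (Gk : nat -> 'I_d -> 'rV[R]_d -> R) :
  L2 leb_d Omega f -> (forall i, L2 leb_d Omega (G i)) ->
  (forall k, H10 Omega (fk k) (Gk k)) ->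
  sqnorm leb_d Omega (fun x => fk k x - f x) @[k --> \oo] --> 0%E ->
  (forall i, sqnorm leb_d Omega (fun x => Gk k i x - G i x) @[k --> \oo] --> 0%E) ->
  H10 Omega f G.
Proof.
move=> Lf LG Hk cf cG; split => //.
have mf : measurable_fun Omega f by have [] := Lf.
have mG i : measurable_fun Omega (G i) by have [] := LG i.
have mfk k : measurable_fun Omega (fk k) by have [[]] := Hk k.
have mGk k i : measurable_fun Omega (Gk k i) by have [_ /(_ i) []] := Hk k.
have /choice[phi phiP] : forall k, exists phi, [/\ test_function Omega phi,
    (sqnorm leb_d Omega (fun x => phi x - fk k x)%R <= (k.+1%:R^-1)%:E)%E &
    forall i, (sqnorm leb_d Omega (fun x => partial i phi x - Gk k i x)%R <= (k.+1%:R^-1)%:E)%E].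
  move=> k; have [_ _ [phi [tphi cphi cgphi]]] := Hk k.
  have k0 : 0 < k.+1%:R^-1 :> R by rewrite invr_gt0.
  have /(ge0_cvge0P (fun n => sqnorm_ge0 _ _ _))/(_ _ k0) near1 := cphi.
  have near2 : \forall n \near \oo, forall i,
      (sqnorm leb_d Omega (partial i (phi n) \- Gk k i)%R <= (k.+1%:R^-1)%:E)%E.
    apply: filter_forall => i.
    by have /(ge0_cvge0P (fun n => sqnorm_ge0 _ _ _))/(_ _ k0) := cgphi i.
  have [n [n1 n2]] := filter_ex (filterI near1 near2).
  by exists (phi n).
have mphi k : measurable_fun Omega (phi k).
  by have [t _ _] := phiP k; exact: measurable_funS (measurable_test_function t).
have mpphi k i : measurable_fun Omega (partial i (phi k)).
  by have [t _ _] := phiP k; exact: measurable_funS (measurable_partial_test_function i t).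
have small (u : nat -> \bar R) : (forall k, 0 <= u k)%E ->
    (forall k, u k <= (k.+1%:R^-1)%:E)%E -> u @ \oo --> 0%E.
  move=> u0 uk; apply/ge0_cvge0P => // e e0.
  near=> k; apply: le_trans (uk k) _; rewrite lee_fin invf_ple ?posrE//.
  rewrite (@le_trans _ _ k%:R) ?ler_nat// ltW//.
  by near: k; exact: nbhs_infty_gtr.
exists phi; split => [n||i]; first by have [] := phiP n.
- rewrite (_ : (fun n => _) = fun n => sqnorm leb_d Omega (fun x =>
     (phi n x - fk n x) + (fk n x - f x))); last first.
    by apply/funext => n; apply: eq_integral => x _; congr EFin; rewrite /=; ring.
  apply: sqnorm_cvg0D => //; [|by move=> n; exact: measurable_funB..|].
    by move=> n; exact: measurable_funB.
  by apply: small => k; [exact: sqnorm_ge0|have [] := phiP k].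
- rewrite (_ : (fun n => _) = fun n => sqnorm leb_d Omega (fun x =>
     (partial i (phi n) x - Gk n i x) + (Gk n i x - G i x))); last first.
    by apply/funext => n; apply: eq_integral => x _; congr EFin; rewrite /=; ring.
  apply: sqnorm_cvg0D => //; [|by move=> n; exact: measurable_funB..|].
    by move=> n; exact: measurable_funB.
  by apply: small => k; [exact: sqnorm_ge0|have [_ _ /(_ i)] := phiP k].
Unshelve. all: by end_near.
Qed.

End H10_space.

(** * Duhamel's formula *)

Section duhamel.
Context {R : realType}.
Notation leb := (@lebesgue_measure R).

Lemma Rintegral_expR (c r t : R) : r <= t ->
  \int[leb]_(s in `[r, t]) (c * expR (c * s)) = expR (c * t) - expR (c * r).
Proof.
rewrite le_eqVlt => /predU1P[->|rt].
  by rewrite subrr set_itv1 Rintegral_set1.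
have cE : continuous (fun s : R => expR (c * s)).
  move=> s; apply: continuous_comp; last exact: continuous_expR.
  by apply: cvgMr; exact: cvg_id.
have dE (s : R) : is_derive s 1 (fun s : R => expR (c * s)) (c * expR (c * s)).
  have := is_derive1_comp (is_derive_expR (c * s)) (is_deriveZ c (is_derive_id s (1 : R))).
  by rewrite [c%:A]mulr1 mulrC.
rewrite /Rintegral (@continuous_FTC2 _ _ (fun s : R => expR (c * s)))//.
- by apply: continuous_subspaceT => s; apply: cvgMr; exact: cE.
- split.
  + by move=> s _; have [] := dE s.
  + by apply: cvg_at_right_filter; exact: cE.
  + by apply: cvg_at_left_filter; exact: cE.
- by move=> s _; rewrite derive1E; exact: derive_val.
Qed.

Lemma integrable_continuousM (a b : R) (k f : R -> R) : continuous k ->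
  leb.-integrable `[a, b] (EFin \o f) ->
  leb.-integrable `[a, b] (EFin \o (fun s => k s * f s)).
Proof.
move=> ck fi.
have kb : [bounded k x | x in `[a, b]%classic].
  have /compact_bounded[M [Mr kM]] := continuous_compact
    (continuous_subspaceT ck) (@segment_compact R a b).
  by exists M; split => // x Mx y aby; apply: (kM x Mx); exists y.
have mk : measurable_fun `[a, b]%classic k.
  by apply: measurable_funS (continuous_measurable_fun ck).
have := @integrableMr _ _ _ leb `[a, b]%classic (measurable_itv `[a, b]) k _ mk kb fi.
by congr (_.-integrable _ _); apply/funext => s /=; rewrite EFinM.
Qed.

Variables (t : R) (k f : R -> R).
Hypotheses (ki : leb.-integrable `[0, t] (EFin \o k)) (fi : leb.-integrable `[0, t] (EFin \o f)).

(* h is the integrand on the triangle r <= s of the square [0, t] x [0, t]. *)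
Let h (p : measurableTypeR R * measurableTypeR R) : R := if p.2 <= p.1 then k p.1 * f p.2 else 0.

Let hi : (leb \x leb)%E.-integrable (`[0, t]%classic `*` `[0, t]%classic) (EFin \o h).
Proof.
have mk : measurable_fun `[0, t]%classic k by apply/measurable_EFinP; exact: measurable_int ki.
have mf : measurable_fun `[0, t]%classic f by apply/measurable_EFinP; exact: measurable_int fi.
have mA : measurable (`[0, t]%classic : set (measurableTypeR R)) by exact: measurable_itv.
have mkf : measurable_fun (`[0, t]%classic `*` `[0, t]%classic)
    (fun p : measurableTypeR R * measurableTypeR R => k p.1 * f p.2).
  apply: measurable_funM; first exact: measurable_fun_prod1.
  exact: measurable_fun_prod2.
have mh : measurable_fun (`[0, t]%classic `*` `[0, t]%classic) h.
  apply: measurable_fun_if => //.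
  - exact: measurableX.
  - apply: measurable_fun_ler.
      by apply: measurable_funS measurable_snd.
    by apply: measurable_funS measurable_fst.
  - by apply: measurable_funS mkf => //; exact: measurableX.
apply: le_integrable (integrable_tensor mA mA ki fi) => //.
- exact: measurableX.
- exact/measurable_EFinP.
- move=> p _ /=; rewrite lee_fin /h; case: ifP => // _.
  by rewrite normr0.
Qed.

Let hE1 s : `[0, t]%classic s ->
  \int[leb]_(r in `[0, t]) h (s, r) = k s * \int[leb]_(r in `[0, s]) f r.
Proof.
rewrite /= in_itv /= => /andP[s0 st].
have its : `[0, t]%classic `&` [set r | r <= s] = `[0, s]%classic.
  apply/seteqP; split => r /=; rewrite !in_itv /=; first by case=> /andP[-> _] ->.
  by move=> /andP[-> rs]; split => //=; exact: le_trans rs st.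
have fs : leb.-integrable `[0, s] (EFin \o f).
  by apply: integrableS fi => //; rewrite -its; exact: subIsetl.
rewrite -RintegralZl// -its Rintegral_mkcondr; apply: eq_Rintegral => r _.
by rewrite patchE /h /=; case: ifPn => rs; [rewrite mem_set|rewrite memNset//; exact/negP].
Qed.

Let hE2 r : `[0, t]%classic r ->
  \int[leb]_(s in `[0, t]) h (s, r) = f r * \int[leb]_(s in `[r, t]) k s.
Proof.
rewrite /= in_itv /= => /andP[r0 rt].
have its : `[0, t]%classic `&` [set s | r <= s] = `[r, t]%classic.
  apply/seteqP; split => s /=; rewrite !in_itv /=; first by case=> /andP[_ ->] ->.
  by move=> /andP[rs ->]; split => //=; rewrite andbT; exact: le_trans r0 rs.
have ks : leb.-integrable `[r, t] (EFin \o k).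
  by apply: integrableS ki => //; rewrite -its; exact: subIsetl.
rewrite mulrC -RintegralZr// -its Rintegral_mkcondr; apply: eq_Rintegral => s _.
by rewrite patchE /h /=; case: ifPn => rs; [rewrite mem_set|rewrite memNset//; exact/negP].
Qed.

Lemma triangle_integrable :
  leb.-integrable `[0, t] (EFin \o (fun s => k s * \int[leb]_(r in `[0, s]) f r)).
Proof.
have mA : measurable (`[0, t]%classic : set (measurableTypeR R)) by exact: measurable_itv.
apply: eq_integrable (integrable_Rintegral_prod mA mA hi) => // s /set_mem st.
by rewrite hE1.
Qed.

(** Fubini's theorem on the triangle [r <= s <= t]. It stands for an integration by
    parts against the primitive of a function [f] that is merely integrable. *)
Lemma triangle_swap :
  \int[leb]_(s in `[0, t]) (k s * \int[leb]_(r in `[0, s]) f r) =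
  \int[leb]_(r in `[0, t]) (f r * \int[leb]_(s in `[r, t]) k s).
Proof.
have mA : measurable (`[0, t]%classic : set (measurableTypeR R)) by exact: measurable_itv.
transitivity (\int[leb]_(s in `[0, t]) \int[leb]_(r in `[0, t]) h (s, r)).
  by apply: eq_Rintegral => s /set_mem st; rewrite hE1.
rewrite (Rintegral_prod_swap mA mA hi).
by apply: eq_Rintegral => r /set_mem rt; rewrite hE2.
Qed.

End duhamel.

Section linear_ode.
Context {R : realType}.
Notation leb := (@lebesgue_measure R).
Variables (mu a0 T : R) (f : R -> R).
Hypothesis T0 : 0 <= T.
Hypothesis fi : leb.-integrable `[0, T] (EFin \o f).

(** The solution of [a' + mu a = f] with [a 0 = a0]. *)
Definition duhamel (t : R) : R :=
  expR (- mu * t) * (a0 + \int[leb]_(r in `[0, t]) (expR (mu * r) * f r)).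

Let cexp (c : R) : continuous (fun s : R => expR (c * s)).
Proof.
move=> s; apply: continuous_comp; last exact: continuous_expR.
by apply: cvgMr; exact: cvg_id.
Qed.

Let ccexp (c : R) : continuous (fun s : R => c * expR (c * s)).
Proof. by move=> s; apply: cvgMr; exact: cexp. Qed.

Let sub t : t <= T -> `[0, t]%classic `<=` `[0, T]%classic.
Proof. by move=> tT; apply: subset_itvl; rewrite bnd_simp. Qed.

Let efi t : t <= T -> leb.-integrable `[0, t] (EFin \o (fun s => expR (mu * s) * f s)).
Proof.
move=> tT; apply: integrable_continuousM; first exact: cexp.
by apply: integrableS fi => //; exact: sub.
Qed.

Lemma duhamel_continuous : {within `[0, T], continuous duhamel}.
Proof.
have cF := @parameterized_integral_continuous R 0 T _ T0 (efi (lexx T)).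
have cE : {within `[0, T], continuous (fun s : R => expR (- mu * s))}.
  exact: continuous_subspaceT (@cexp _).
move=> x; apply: cvgM; first exact: cE.
by apply: cvgD; [exact: cvg_cst|exact: cF].
Qed.

(** [triangle_swap] with [k s = - mu exp (- mu s)], whose integral over [[r, t]] is
    explicit. *)
Lemma duhamel_solves t : 0 <= t <= T ->
  duhamel t - a0 + mu * \int[leb]_(s in `[0, t]) duhamel s = \int[leb]_(s in `[0, t]) f s.
Proof.
move=> /andP[t0 tT].
pose Phi s := \int[leb]_(r in `[0, s]) (expR (mu * r) * f r).
have ki (c : R) : leb.-integrable `[0, t] (EFin \o (fun s => c * expR (c * s))).
  exact: continuous_integrable_itv.
have ei (c : R) : leb.-integrable `[0, t] (EFin \o (fun s => expR (c * s))).
  exact: continuous_integrable_itv.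
have i1 : leb.-integrable `[0, t] (EFin \o (fun s => expR (- mu * s) * a0)).
  by apply: continuous_integrable_itv => s; apply: cvgMl; exact: cexp.
have fit : leb.-integrable `[0, t] (EFin \o f) by apply: integrableS fi => //; exact: sub.
have := triangle_swap (ki (- mu)) (efi tT).
have -> : \int[leb]_(r in `[0, t])
    (expR (mu * r) * f r * \int[leb]_(s in `[r, t]) (- mu * expR (- mu * s))) =
    \int[leb]_(r in `[0, t]) (expR (- mu * t) * (expR (mu * r) * f r) - f r).
  apply: eq_Rintegral => r; rewrite inE /= in_itv /= => /andP[r0 rt].
  rewrite Rintegral_expR// mulrBr; congr (_ - _); first by rewrite mulrC.
  by rewrite mulrAC -expRD mulNr subrr expR0 mul1r.
rewrite RintegralB//; last first.
  by apply: integrable_continuousM; [exact: cst_continuous|exact: efi].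
rewrite RintegralZl//; last exact: efi.
rewrite -/(Phi t) => E.
have Dl : \int[leb]_(s in `[0, t]) duhamel s =
    \int[leb]_(s in `[0, t]) (expR (- mu * s) * a0) +
    \int[leb]_(s in `[0, t]) (expR (- mu * s) * Phi s).
  rewrite -RintegralD//; last exact: (triangle_integrable (ei (- mu)) (efi tT)).
  by apply: eq_Rintegral => s _; rewrite /duhamel mulrDr.
have E1 : \int[leb]_(s in `[0, t]) (- mu * expR (- mu * s) * Phi s) =
    - mu * \int[leb]_(s in `[0, t]) (expR (- mu * s) * Phi s).
  rewrite -RintegralZl//; last exact: (triangle_integrable (ei (- mu)) (efi tT)).
  by apply: eq_Rintegral => s _; rewrite mulrA.
have E2 : - mu * \int[leb]_(s in `[0, t]) (expR (- mu * s) * a0) =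
    (expR (- mu * t) - 1) * a0.
  rewrite RintegralZr// mulrA -RintegralZl// Rintegral_expR//.
  by rewrite mulr0 expR0.
rewrite E1 in E.
rewrite Dl mulrDr /duhamel -/(Phi t).
lra.
Qed.

(** The integrating factor [exp (mu s)]: an integral solution [a] is [a0] plus the
    primitive of [h = f - mu a], and [triangle_swap] with [k s = mu exp (mu s)] computes
    [exp (mu T) * a T]. *)
Lemma duhamel_unique (a : R -> R) : leb.-integrable `[0, T] (EFin \o a) ->
  (forall t, 0 <= t <= T ->
    a t - a0 + mu * \int[leb]_(s in `[0, t]) a s = \int[leb]_(s in `[0, t]) f s) ->
  a T = duhamel T.
Proof.
move=> ai aE.
pose h s := f s - mu * a s.
have mai : leb.-integrable `[0, T] (EFin \o (fun s => mu * a s)).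
  by apply: integrable_continuousM => //; exact: cst_continuous.
have hi : leb.-integrable `[0, T] (EFin \o h).
  exact: (@integrableB _ _ _ leb `[0, T]%classic (measurable_itv _) _ _ fi mai).
have hE t : 0 <= t <= T -> a t = a0 + \int[leb]_(s in `[0, t]) h s.
  move=> /[dup] /andP[t0 tT] /aE e.
  have iS (g : R -> R) : leb.-integrable `[0, T] (EFin \o g) -> leb.-integrable `[0, t] (EFin \o g).
    by apply: integrableS => //; exact: sub.
  rewrite RintegralB//; [|exact: iS..]; rewrite RintegralZl//; last exact: iS.
  lra.
have ki : leb.-integrable `[0, T] (EFin \o (fun s => mu * expR (mu * s))).
  exact: continuous_integrable_itv.
have emi : leb.-integrable `[0, T] (EFin \o (fun s => expR (mu * s) * (mu * a s))).
  by apply: integrable_continuousM => //; exact: cexp.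
have ehi : leb.-integrable `[0, T] (EFin \o (fun s => expR (mu * s) * h s)).
  by apply: integrable_continuousM => //; exact: cexp.
have eci : leb.-integrable `[0, T] (EFin \o (fun s => mu * expR (mu * s) * a0)).
  by apply: continuous_integrable_itv => s; apply: cvgMl; exact: ccexp.
have := triangle_swap ki hi.
have -> : \int[leb]_(r in `[0, T]) (h r * \int[leb]_(s in `[r, T]) (mu * expR (mu * s))) =
    \int[leb]_(r in `[0, T]) (expR (mu * T) * h r - expR (mu * r) * h r).
  apply: eq_Rintegral => r; rewrite inE /= in_itv /= => /andP[r0 rt].
  by rewrite Rintegral_expR// mulrBr ![h r * _]mulrC.
have -> : \int[leb]_(s in `[0, T]) (mu * expR (mu * s) * \int[leb]_(r in `[0, s]) h r) =
    \int[leb]_(s in `[0, T]) (expR (mu * s) * (mu * a s) - mu * expR (mu * s) * a0).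
  apply: eq_Rintegral => s; rewrite inE /= in_itv /= => st.
  by rewrite (hE s st); ring.
rewrite RintegralB// RintegralB//; last first.
  by apply: integrable_continuousM => //; exact: cst_continuous.
rewrite RintegralZr// Rintegral_expR// mulr0 expR0 RintegralZl//.
have -> : \int[leb]_(s in `[0, T]) (expR (mu * s) * h s) =
    \int[leb]_(s in `[0, T]) (expR (mu * s) * f s) -
    \int[leb]_(s in `[0, T]) (expR (mu * s) * (mu * a s)).
  rewrite -RintegralB//; last exact: efi.
  by apply: eq_Rintegral => s _; rewrite mulrBr.
have TT : 0 <= T <= T by rewrite T0 lexx.
have -> : \int[leb]_(s in `[0, T]) h s = a T - a0 by rewrite (hE T TT); lra.
move=> E; apply: (mulfI (lt0r_neq0 (expR_gt0 (mu * T)))).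
rewrite /duhamel mulrA -expRD mulNr subrr expR0 mul1r.
lra.
Qed.

End linear_ode.

(** * Limits and products in L2 *)

(* Cylinders are built on open time intervals, while the time integrals of the weak
   formulation are taken over closed ones. *)
Section interval_endpoints.
Context {R : realType}.
Notation leb := (@lebesgue_measure R).
Variables (a b : R) (f : R -> R).
Hypothesis fi : leb.-integrable `]a, b[ (EFin \o f).

Let mf : measurable_fun `]a, b[%classic f.
Proof. by apply/measurable_EFinP; exact: measurable_int fi. Qed.

Lemma integrable_itv_oo_cc : leb.-integrable `[a, b] (EFin \o f).
Proof.
have /integrableP[_ fy] := fi; apply/integrableP; split.
  by apply/measurable_EFinP; exact: measurable_fun_itv_cc mf.
rewrite (@integral_itv_bndoo R a b _ true false)//.
by apply: measurableT_comp => //; exact/measurable_EFinP.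
Qed.

Lemma Rintegral_itv_oo_cc :
  \int[leb]_(x in `]a, b[) f x = \int[leb]_(x in `[a, b]) f x.
Proof.
rewrite /Rintegral; congr fine; rewrite (@integral_itv_bndoo R a b _ true false)//.
exact/measurable_EFinP.
Qed.

End interval_endpoints.

Section L2_limits.
Context {disp : measure_display} {X : measurableType disp} {R : realType}.
Variables (mu : {measure set X -> \bar R}) (A : set X).
Hypothesis mA : measurable A.

Lemma inner_cvg (f : nat -> X -> R) (g h : X -> R) :
  (forall n, L2 mu A (f n)) -> L2 mu A g -> L2 mu A h ->
  inner mu A (fun x => f n x - g x) (fun x => f n x - g x) @[n --> \oo] --> 0 ->
  inner mu A (f n) h @[n --> \oo] --> inner mu A g h.
Proof.
move=> Lf Lg Lh cfg; apply/cvgrPdist_le => e e0.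
have H0 : 0 <= inner mu A h h := inner_ge0 _ _ _.
have e1 : 0 < e ^+ 2 / (inner mu A h h + 1) by rewrite divr_gt0 ?exprn_gt0// ltr_wpDl.
have /cvgrPdist_le/(_ _ e1) cn := cfg.
near=> n.
have : `|0 - inner mu A (fun x => f n x - g x) (fun x => f n x - g x)| <=
    e ^+ 2 / (inner mu A h h + 1) by near: n.
rewrite sub0r normrN ger0_norm ?inner_ge0// => fn.
rewrite distrC -innerBl// -(@ler_pXn2r _ 2)//; last by rewrite nnegrE ltW.
rewrite real_normK ?num_real//.
apply: le_trans (cauchy_schwarz mA (L2_B mA (Lf n) Lg) Lh) _.
apply: le_trans (ler_wpM2r H0 fn) _.
rewrite mulrAC ler_pdivrMr ?ltr_wpDl// ler_wpM2l ?sqr_ge0//; lra.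
Unshelve. all: by end_near.
Qed.

(** The function [g] is only supposed measurable: the inequality is used for sections of
    a function on a product, which are square-integrable for almost every parameter. *)
Lemma bessel (psi : nat -> X -> R) (g : X -> R) (N : nat) :
  (forall m, L2 mu A (psi m)) ->
  (forall m n, inner mu A (psi m) (psi n) = (m == n)%:R) ->
  measurable_fun A g ->
  ((\sum_(m < N) inner mu A g (psi m) ^+ 2)%:E <= sqnorm mu A g)%E.
Proof.
move=> Lpsi ortho mg.
have := leey (sqnorm mu A g); rewrite le_eqVlt => /predU1P[->|gy]; first exact: leey.
have Lg : L2 mu A g by [].
rewrite sqnormE// lee_fin.
pose p x := \sum_(m < N) inner mu A g (psi m) * psi m x.
have Lp : L2 mu A p by apply: L2_sum => // m _; exact: L2_Z.
have gp : inner mu A g p = \sum_(m < N) inner mu A g (psi m) ^+ 2.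
  rewrite inner_sumr//; last by move=> m _; exact: L2_Z.
  by apply: eq_bigr => m _; rewrite innerZr// expr2.
have pp : inner mu A p p = \sum_(m < N) inner mu A g (psi m) ^+ 2.
  exact: (orthonormal_sqr mA Lpsi ortho N predT (fun m => inner mu A g (psi m))).
have := inner_ge0 mu A (fun x => g x - p x).
by rewrite inner_sqrB// gp pp; lra.
Qed.

Lemma integrable_Rsum I (r : seq I) (F : I -> X -> R) :
  (forall i, mu.-integrable A (EFin \o F i)) ->
  mu.-integrable A (EFin \o (fun x => \sum_(i <- r) F i x)).
Proof.
move=> Fi; elim: r => [|i r IH].
  apply: eq_integrable (integrable0 mu A) => // x _ /=.
  by rewrite big_nil.
apply: eq_integrable (integrableD mA (Fi i) IH) => // x _ /=.
by rewrite big_cons.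
Qed.

Lemma Rintegral_sum I (r : seq I) (F : I -> X -> R) :
  (forall i, mu.-integrable A (EFin \o F i)) ->
  \int[mu]_(x in A) (\sum_(i <- r) F i x) = \sum_(i <- r) \int[mu]_(x in A) F i x.
Proof.
move=> Fi; elim: r => [|i r IH].
  rewrite big_nil /Rintegral; under eq_integral do rewrite big_nil.
  by rewrite integral0.
rewrite big_cons -IH -RintegralD//; last exact: integrable_Rsum.
by apply: eq_Rintegral => x _; rewrite big_cons.
Qed.

End L2_limits.

Section product_L2.
Context {d1 d2 : measure_display} {X : measurableType d1} {Y : measurableType d2}
  {R : realType}.
Variables (m1 : {sigma_finite_measure set X -> \bar R})
  (m2 : {sigma_finite_measure set Y -> \bar R}).
Variables (A : set X) (B : set Y).
Hypotheses (mA : measurable A) (mB : measurable B).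

Lemma inner_tensor (a a' : X -> R) (b b' : Y -> R) :
  L2 m1 A a -> L2 m1 A a' -> L2 m2 B b -> L2 m2 B b' ->
  inner (m1 \x m2)%E (A `*` B) (fun p : X * Y => a p.1 * b p.2) (fun p : X * Y => a' p.1 * b' p.2)
  = inner m1 A a a' * inner m2 B b b'.
Proof.
move=> La La' Lb Lb'.
have ia : m1.-integrable A (EFin \o (fun x => a x * a' x)) by exact: L2_mul_integrable.
have ib : m2.-integrable B (EFin \o (fun x => b x * b' x)) by exact: L2_mul_integrable.
transitivity (\int[(m1 \x m2)%E]_(p in A `*` B) ((a p.1 * a' p.1) * (b p.2 * b' p.2))).
  by apply: eq_Rintegral => p _; ring.
rewrite (Rintegral_prod mA mB (integrable_tensor mA mB ia ib)) /= /inner -RintegralZr//.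
by apply: eq_Rintegral => x _; rewrite -RintegralZl.
Qed.

Lemma sqnorm_prod (f : X * Y -> R) : measurable_fun (A `*` B) f ->
  (sqnorm (m1 \x m2) (A `*` B) f =
   \int[m1]_(x in A) sqnorm m2 B (fun y => f (x, y)))%E.
Proof.
move=> mf; rewrite /sqnorm ge0_integral_prod//; last 2 first.
- by apply: measurable_sqr.
- by move=> p; rewrite lee_fin sqr_ge0.
Qed.

Lemma measurable_sqnorm_section (f : X * Y -> R) : measurable_fun (A `*` B) f ->
  measurable_fun A (fun x => sqnorm m2 B (fun y => f (x, y))).
Proof.
move=> mf.
apply: (@measurable_integral_prod _ _ _ _ _ m2 A B mA mB (fun p => (f p ^+ 2)%:E)).
  by apply: measurable_sqr.
by move=> p; rewrite lee_fin sqr_ge0.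
Qed.

Lemma ae_L2_section (f : X * Y -> R) : L2 (m1 \x m2)%E (A `*` B) f ->
  {ae m1, forall x, A x -> L2 m2 B (fun y => f (x, y))}.
Proof.
move=> [mf fy].
have iF : m1.-integrable A (fun x => sqnorm m2 B (fun y => f (x, y))).
  apply/integrableP; split; first exact: measurable_sqnorm_section.
  by under eq_integral do rewrite gee0_abs ?sqnorm_ge0//; rewrite -sqnorm_prod.
have := integrable_ae mA iF; apply: filterS => x h Ax; split.
  exact: measurable_fun_section mf Ax.
by have := h Ax; rewrite ge0_fin_numE ?sqnorm_ge0.
Qed.

(** The squared norms being summable in [k], the sum of the squared norms of the
    sections is integrable by Tonelli's theorem, hence finite almost everywhere. *)
Lemma ae_section_cvg0 (h : nat -> X * Y -> R) :
  (forall k, measurable_fun (A `*` B) (h k)) ->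
  (forall k, (sqnorm (m1 \x m2) (A `*` B) (h k) <= (2^-1 ^+ k)%:E)%E) ->
  {ae m1, forall x, A x -> sqnorm m2 B (fun y => h k (x, y)) @[k --> \oo] --> 0%E}.
Proof.
move=> mh hk.
pose S x := (\sum_(k <oo) sqnorm m2 B (fun y => h k (x, y)))%E.
have mk k : measurable_fun A (fun x => sqnorm m2 B (fun y => h k (x, y))).
  exact: measurable_sqnorm_section.
have iS : m1.-integrable A S.
  apply/integrableP; split.
    by apply: ge0_emeasurable_sum => // k x _ _; exact: sqnorm_ge0.
  under eq_integral => x _.
    rewrite gee0_abs; last by apply: nneseries_ge0 => k _ _; exact: sqnorm_ge0.
    over.
  rewrite integral_nneseries//; last by move=> k x _; exact: sqnorm_ge0.
  apply: le_lt_trans (@geometric_half_lty R).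
  apply: lee_nneseries => [k _ _|k _].
    by apply: integral_ge0 => x _; exact: sqnorm_ge0.
  by rewrite -sqnorm_prod.
have := integrable_ae mA iS; apply: filterS => x hx Ax.
have s0 k : (0 <= sqnorm m2 B (fun y => h k (x, y)))%E by exact: sqnorm_ge0.
have S0 : (0 <= S x)%E by exact: nneseries_ge0.
have Sfin := hx Ax.
pose u k := fine (sqnorm m2 B (fun y => h k (x, y))).
have sS n : (\sum_(0 <= k < n) sqnorm m2 B (fun y => h k (x, y)) <= S x)%E.
  exact: nneseries_lim_ge.
have uE k : sqnorm m2 B (fun y => h k (x, y)) = (u k)%:E.
  rewrite fineK// ge0_fin_numE//; apply: le_lt_trans (_ : S x < +oo)%E; last first.
    by rewrite -ge0_fin_numE.
  apply: le_trans (sS k.+1); rewrite big_nat_recr//= leeDr//.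
  exact: sume_ge0.
have cu : cvgn (series u).
  apply: nondecreasing_is_cvgn.
    by apply: nondecreasing_series => k _ _; exact: fine_ge0.
  exists (fine (S x)) => _ [n _ <-]; rewrite -lee_fin fineK// /series /= -sumEFin.
  by apply: le_trans (sS n); apply: lee_sum => k _; rewrite uE.
under eq_fun do rewrite uE.
by apply: cvg_EFin; [exact: nearW|exact: cvg_series_cvg_0].
Qed.

End product_L2.

(** * Energy estimates for Duhamel's formula *)

Section duhamel_L2.
Context {R : realType}.
Notation leb := (@lebesgue_measure R).
Variables (T : R).
Hypothesis T0 : 0 <= T.

Lemma L2_continuous_itv (g : R -> R) : {within `[0, T], continuous g} -> L2 leb `[0, T] g.
Proof.
move=> cg.
have mg : measurable_fun `[0, T]%classic g by exact: subspace_continuous_measurable_fun.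
split=> //.
have : leb.-integrable `[0, T] (EFin \o (fun t => g t * g t)).
  apply: continuous_compact_integrable; first exact: segment_compact.
  by move=> x; apply: cvgM; exact: cg.
move=> /integrableP[_]; apply: le_lt_trans; rewrite le_eqVlt; apply/orP; left; apply/eqP.
by apply: eq_integral => x _; rewrite /= -expr2 ger0_norm ?sqr_ge0.
Qed.

Lemma L2_cst_itv (c : R) : L2 leb `[0, T] (cst c).
Proof. by apply: L2_continuous_itv; apply: continuous_subspaceT; exact: cst_continuous. Qed.

Lemma L2_itv_integrable (f : R -> R) : L2 leb `[0, T] f -> leb.-integrable `[0, T] (EFin \o f).
Proof.
move=> Lf; have := @L2_mul_integrable _ _ _ leb _ (measurable_itv _) _ _ Lf (L2_cst_itv 1).
by congr (_.-integrable _ _); apply/funext => x /=; rewrite mulr1.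
Qed.

Variables (mu a0 : R) (f : R -> R).
Hypotheses (mu0 : 0 <= mu) (Lf : L2 leb `[0, T] f).

Let fi : leb.-integrable `[0, T] (EFin \o f). Proof. exact: L2_itv_integrable. Qed.

Let f2i : leb.-integrable `[0, T] (EFin \o (fun s => f s ^+ 2)).
Proof.
have := @L2_mul_integrable _ _ _ leb _ (measurable_itv _) _ _ Lf Lf.
by congr (_.-integrable _ _); apply/funext => x /=; rewrite expr2.
Qed.

Lemma L2_duhamel : L2 leb `[0, T] (duhamel mu a0 f).
Proof. by apply: L2_continuous_itv; exact: duhamel_continuous. Qed.

Let Q := inner leb `[0, T]%classic f f.

Let QE : Q = \int[leb]_(s in `[0, T]) (f s ^+ 2).
Proof. by apply: eq_Rintegral => s _; rewrite expr2. Qed.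

(* C t is the integral of exp (- mu (t - s)) f(s)^2 over [0, t]. *)
Let C t := duhamel mu 0 (fun s => f s ^+ 2) t.

Let sub t : t <= T -> `[0, t]%classic `<=` `[0, T]%classic.
Proof. by move=> tT; apply: subset_itvl; rewrite bnd_simp. Qed.

Let cexp (c : R) : continuous (fun s : R => expR (c * s)).
Proof.
move=> s; apply: continuous_comp; last exact: continuous_expR.
by apply: cvgMr; exact: cvg_id.
Qed.

Let CE t : 0 <= t <= T -> C t = \int[leb]_(s in `[0, t]) (expR (- mu * (t - s)) * f s ^+ 2).
Proof.
move=> /andP[t0 tT]; rewrite /C /duhamel add0r -RintegralZl//; last first.
  apply: integrable_continuousM; first exact: cexp.
  by apply: integrableS f2i => //; exact: sub.
by apply: eq_Rintegral => s _; rewrite mulrA -expRD; congr (expR _ * _); ring.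
Qed.

Let cshift t : continuous (fun s : R => expR (- mu * (t - s))).
Proof.
move=> s; apply: continuous_comp; last exact: continuous_expR.
by apply: cvgMr; apply: cvgB; [exact: cvg_cst|exact: cvg_id].
Qed.

Let C_le t : 0 <= t <= T -> 0 <= C t <= Q.
Proof.
move=> /[dup] tT /andP[t0 tT']; rewrite CE//; apply/andP; split.
  by apply: Rintegral_ge0 => s _; rewrite mulr_ge0 ?sqr_ge0 ?expR_ge0.
have f2t : leb.-integrable `[0, t] (EFin \o (fun s => f s ^+ 2)).
  by apply: integrableS f2i => //; exact: sub.
rewrite QE (Rintegral_itv_split t0 tT')// ler_wpDr//.
  by apply: Rintegral_ge0 => s _; exact: sqr_ge0.
apply: le_Rintegral => //.
  by apply: integrable_continuousM; [exact: cshift|].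
move=> s; rewrite /= in_itv /= => /andP[s0 st].
rewrite ler_piMl ?sqr_ge0// -[leRHS]expR0 ler_expR mulNr oppr_le0 mulr_ge0//.
by rewrite subr_ge0.
Qed.

(** Cauchy-Schwarz against the constant 1, keeping one factor [exp (- mu (t - s))]: the
    bound by [C] retains the decay that [duhamel_energy] integrates in time. *)
Let conv_sqr_le t : 0 <= t <= T -> duhamel mu 0 f t ^+ 2 <= t * C t.
Proof.
move=> /[dup] tT /andP[t0 tT'].
have Lft : L2 leb `[0, t] f.
  by apply: L2_subset Lf => //; exact: sub.
pose g s := expR (- mu * (t - s)) * f s.
have git : leb.-integrable `[0, t] (EFin \o (fun s => expR (- mu * (t - s)) * f s ^+ 2)).
  apply: integrable_continuousM; first exact: cshift.
  by apply: integrableS f2i => //; exact: sub.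
have ge1 s : `[0, t]%classic s -> expR (- mu * (t - s)) <= 1.
  rewrite /= in_itv /= => /andP[s0 st].
  by rewrite -expR0 ler_expR mulNr oppr_le0 mulr_ge0// subr_ge0.
have g2 s : `[0, t]%classic s -> g s * g s <= expR (- mu * (t - s)) * f s ^+ 2.
  move=> st; rewrite /g mulrACA -expr2 -[f s * f s]expr2 ler_wpM2r ?sqr_ge0//.
  by rewrite expr2 ler_piMl ?expR_ge0// ge1.
have mg : measurable_fun `[0, t]%classic g.
  apply: measurable_funM; last by have [] := Lft.
  by apply: measurable_funTS; exact: continuous_measurable_fun.
have Lg : L2 leb `[0, t] g.
  split=> //; case/integrableP : git => _; apply: le_lt_trans.
  apply: ge0_le_integral => //.
  - by move=> s _; rewrite lee_fin sqr_ge0.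
  - exact: measurable_sqr.
  - apply/measurable_EFinP; apply: measurableT_comp => //; apply: measurable_funM.
      by apply: measurable_funTS; exact: continuous_measurable_fun.
    by apply: measurable_funX; have [] := Lft.
  - move=> s st; rewrite lee_fin ger0_norm; last first.
      by apply: mulr_ge0; [exact: expR_ge0|exact: sqr_ge0].
    by rewrite expr2; exact: g2.
have L1 : L2 leb `[0, t] (cst 1).
  by apply: L2_subset (L2_cst_itv 1) => //; exact: sub.
rewrite (_ : duhamel mu 0 f t = inner leb `[0, t]%classic (cst 1) g); last first.
  rewrite /duhamel add0r -RintegralZl//; last first.
    apply: integrable_continuousM; first exact: cexp.
    by apply: integrableS fi => //; exact: sub.
  by apply: eq_Rintegral => s _; rewrite /cst mul1r mulrA -expRD /g; congr (expR _ * _); ring.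
apply: le_trans (cauchy_schwarz _ L1 Lg) _ => //.
have -> : inner leb `[0, t]%classic (cst 1) (cst 1) = t.
  rewrite /inner /cst mulr1 Rintegral_cst// mul1r lebesgue_itv_cc//.
  by rewrite subr0.
rewrite ler_wpM2l// CE//.
by apply: le_Rintegral => //; exact: L2_mul_integrable.
Qed.

Let duhamelE t : duhamel mu a0 f t = expR (- mu * t) * a0 + duhamel mu 0 f t.
Proof. by rewrite /duhamel add0r mulrDr. Qed.

(** The bound is independent of [mu], which makes it summable over the modes of a heat
    equation. *)
Lemma duhamel_bound t : 0 <= t <= T ->
  duhamel mu a0 f t ^+ 2 <= 2 * a0 ^+ 2 + 2 * T * inner leb `[0, T]%classic f f.
Proof.
move=> /[dup] tT /andP[t0 tT'].
have h1 : (expR (- mu * t) * a0) ^+ 2 <= a0 ^+ 2.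
  rewrite exprMn ler_piMl ?sqr_ge0// expr2 -expRD -expR0 ler_expR.
  have : 0 <= mu * t by rewrite mulr_ge0.
  lra.
have h2 : duhamel mu 0 f t ^+ 2 <= T * Q.
  apply: le_trans (conv_sqr_le tT) _; have /andP[c0 cQ] := C_le tT.
  exact: ler_pM.
rewrite duhamelE -/Q.
have := sqr_ge0 (expR (- mu * t) * a0 - duhamel mu 0 f t).
move: h1 h2; rewrite !expr2; lra.
Qed.

(** The gain of a factor [mu] is the energy estimate of the heat equation, mode by mode.
    The function [C] solves [C' + mu C = f^2] with [C 0 = 0], so that [mu] times its
    integral is at most that of [f^2]. *)
Lemma duhamel_energy : mu * inner leb `[0, T]%classic (duhamel mu a0 f) (duhamel mu a0 f) <=
  2 * a0 ^+ 2 + 2 * T * inner leb `[0, T]%classic f f.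
Proof.
have TT : 0 <= T <= T by rewrite T0 lexx.
have cC : {within `[0, T], continuous C} by exact: duhamel_continuous.
have Ci : leb.-integrable `[0, T] (EFin \o C).
  by apply: L2_itv_integrable; exact: L2_continuous_itv.
have muC : mu * \int[leb]_(t in `[0, T]) C t <= Q.
  have := duhamel_solves mu 0 f2i TT; rewrite -QE -/(C T).
  by have /andP[] := C_le TT; lra.
have ei : leb.-integrable `[0, T] (EFin \o (fun t => (- 2 * mu) * expR ((- 2 * mu) * t))).
  apply: continuous_integrable_itv => t; apply: cvgMr; exact: cexp.
have TCi : leb.-integrable `[0, T] (EFin \o (fun t => 2 * T * mu * C t)).
  by apply: integrable_continuousM => //; exact: cst_continuous.
have aei : leb.-integrable `[0, T]
    (EFin \o (fun t => - a0 ^+ 2 * ((- 2 * mu) * expR ((- 2 * mu) * t)))).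
  by apply: integrable_continuousM => //; exact: cst_continuous.
have Ldd := @L2_mul_integrable _ _ _ leb _ (measurable_itv _) _ _ L2_duhamel L2_duhamel.
rewrite [X in mu * X]/inner -RintegralZl//.
apply: (@le_trans _ _ (\int[leb]_(t in `[0, T])
    (- a0 ^+ 2 * ((- 2 * mu) * expR ((- 2 * mu) * t)) + 2 * T * mu * C t))).
  apply: le_Rintegral => //.
  - by apply: integrable_continuousM => //; exact: cst_continuous.
  - exact: (@integrableD _ _ _ leb `[0, T]%classic (measurable_itv _) _ _ aei TCi).
  move=> t; rewrite /= in_itv /= => /[dup] tT /andP[t0 tT'].
  have c2 := conv_sqr_le tT; have /andP[c0 _] := C_le tT.
  have {}c2 : duhamel mu 0 f t ^+ 2 <= T * C t.
    by apply: le_trans c2 _; rewrite ler_wpM2r.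
  rewrite duhamelE -[_ * _ * t]mulrA.
  have -> : expR (- 2 * (mu * t)) = expR (- mu * t) ^+ 2.
    by rewrite expr2 -expRD; congr expR; ring.
  move: (expR _) (duhamel _ _ _ _) c2 => e c; rewrite expr2 => c2.
  have := mulr_ge0 mu0 (sqr_ge0 (e * a0 - c)).
  have := ler_wpM2l mu0 c2.
  rewrite !expr2; lra.
rewrite RintegralD// (@RintegralZl _ _ _ leb _ _ (- a0 ^+ 2))//.
rewrite (@RintegralZl _ _ _ leb _ C (2 * T * mu))// Rintegral_expR// mulr0 expR0.
have e0 : 0 <= expR (- 2 * mu * T) by exact: expR_ge0.
have a2 : 0 <= a0 ^+ 2 by exact: sqr_ge0.
rewrite -/Q.
have := ler_wpM2l T0 muC; have := mulr_ge0 a2 e0.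
lra.
Qed.

End duhamel_L2.

(** * Functions on space-time cylinders *)

Lemma big_ord_subr {V : zmodType} (F : nat -> V) (m n : nat) : (m <= n)%N ->
  \sum_(k < n) F k - \sum_(k < m) F k = \sum_(k < n | (m <= k)%N) F k.
Proof.
move=> mn; rewrite (bigID (fun k : 'I_n => (m <= k)%N)) /=.
have -> : \sum_(k < m) F k = \sum_(k < n | ~~ (m <= k)%N) F k.
  by rewrite (big_ord_widen n F mn); apply: eq_bigl => k; rewrite -ltnNge.
by rewrite addrK.
Qed.

Section L2_endpoints.
Context {R : realType}.
Notation leb := (@lebesgue_measure R).

Lemma L2_itv_oo_cc (a b : R) (g : R -> R) : L2 leb `]a, b[ g -> L2 leb `[a, b] g.
Proof.
move=> [mg gy]; split; first exact: measurable_fun_itv_cc mg.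
rewrite /sqnorm (@integral_itv_bndoo R a b _ true false)//.
exact: measurable_sqr.
Qed.

Lemma L2_itv_cc_oo (a b : R) (g : R -> R) : L2 leb `[a, b] g -> L2 leb `]a, b[ g.
Proof. by move=> Lg; apply: L2_subset Lg => //; exact: subset_itv_oo_cc. Qed.

Lemma inner_itv_oo_cc (a b : R) (g h : R -> R) : L2 leb `]a, b[ g -> L2 leb `]a, b[ h ->
  inner leb `]a, b[%classic g h = inner leb `[a, b]%classic g h.
Proof. by move=> Lg Lh; apply: Rintegral_itv_oo_cc; exact: L2_mul_integrable. Qed.

End L2_endpoints.

Section cylinder_theory.
Context {R : realType} {d : nat}.
Notation leb := (@lebesgue_measure R).
Notation leb_d := (@lebesgue_rV R d).
Notation leb_cyl := (leb \x leb_d)%E.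
Variable Omega : set 'rV[R]_d.
Hypothesis mO : measurable Omega.
Implicit Types (t : R) (h : R * 'rV[R]_d -> R) (v : 'rV[R]_d -> R).

Lemma measurable_cylinder t : measurable (cylinder t Omega).
Proof. by apply: measurableX. Qed.

Lemma cylinder_subset t t' : t <= t' -> cylinder t Omega `<=` cylinder t' Omega.
Proof.
move=> tt' [s x] [/= st Ox]; split => //=; move: st; rewrite !in_itv /= => /andP[-> /=].
by move=> /lt_le_trans; exact.
Qed.

Lemma integrable_section_itv t h : leb_cyl.-integrable (cylinder t Omega) (EFin \o h) ->
  leb.-integrable `[0, t] (EFin \o (fun s => \int[leb_d]_(x in Omega) h (s, x))).
Proof.
move=> hi; apply: integrable_itv_oo_cc.
by apply: integrable_Rintegral_prod hi.
Qed.

Lemma Rintegral_cylinder t h : leb_cyl.-integrable (cylinder t Omega) (EFin \o h) ->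
  \int[leb]_(s in `[0, t]) \int[leb_d]_(x in Omega) h (s, x) =
  \int[leb_cyl]_(p in cylinder t Omega) h p.
Proof.
move=> hi; rewrite -Rintegral_itv_oo_cc.
  by rewrite (Rintegral_prod _ _ hi).
by apply: integrable_Rintegral_prod hi.
Qed.

Lemma L2_cylinder_tensor t (a : R -> R) v : L2 leb `[0, t] a -> L2 leb_d Omega v ->
  L2 leb_cyl (cylinder t Omega) (fun p => a p.1 * v p.2).
Proof. by move=> La Lv; apply: L2_tensor => //; exact: L2_itv_cc_oo. Qed.

Lemma L2_cylinder_lift t v : L2 leb_d Omega v ->
  L2 leb_cyl (cylinder t Omega) (fun p => v p.2).
Proof.
move=> Lv; have := L2_cylinder_tensor (L2_cst_itv t 1) Lv.
by apply: L2_eq => p _; rewrite /cst mul1r.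
Qed.

Lemma inner_cylinder_tensor t (a a' : R -> R) v v' :
  L2 leb `[0, t] a -> L2 leb `[0, t] a' -> L2 leb_d Omega v -> L2 leb_d Omega v' ->
  inner leb_cyl (cylinder t Omega) (fun p => a p.1 * v p.2) (fun p => a' p.1 * v' p.2) =
  inner leb `[0, t]%classic a a' * inner leb_d Omega v v'.
Proof.
move=> La La' Lv Lv'; rewrite -inner_itv_oo_cc; [|exact: L2_itv_cc_oo..].
by apply: inner_tensor => //; exact: L2_itv_cc_oo.
Qed.

Lemma inner_cylinder_tensor_lift t (a : R -> R) v v' :
  L2 leb `[0, t] a -> L2 leb_d Omega v -> L2 leb_d Omega v' ->
  inner leb_cyl (cylinder t Omega) (fun p => a p.1 * v p.2) (fun p => v' p.2) =
  (\int[leb]_(s in `[0, t]) a s) * inner leb_d Omega v v'.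
Proof.
move=> La Lv Lv'.
transitivity (inner leb_cyl (cylinder t Omega) (fun p => a p.1 * v p.2)
    (fun p => cst 1 p.1 * v' p.2)).
  by apply: inner_eq => // p _; rewrite /cst mul1r.
rewrite inner_cylinder_tensor//; last exact: L2_cst_itv.
by congr (_ * _); apply: eq_Rintegral => s _; rewrite mulr1.
Qed.

Lemma grad_innerE (G H : 'I_d -> 'rV[R]_d -> R) :
  (forall i, L2 leb_d Omega (G i)) -> (forall i, L2 leb_d Omega (H i)) ->
  grad_inner Omega G H = \sum_i inner leb_d Omega (G i) (H i).
Proof. by move=> LG LH; apply: Rintegral_sum => // i; exact: L2_mul_integrable. Qed.

(** Together with [Rintegral_grad_inner], this turns the time integrals of the weak
    formulation into inner products in space-time, which are continuous. *)
Lemma Rintegral_inner t h v : L2 leb_cyl (cylinder t Omega) h -> L2 leb_d Omega v ->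
  \int[leb]_(s in `[0, t]) inner leb_d Omega (fun x => h (s, x)) v =
  inner leb_cyl (cylinder t Omega) h (fun p => v p.2).
Proof.
move=> Lh Lv; apply: (@Rintegral_cylinder t (fun p => h p * v p.2)).
by apply: L2_mul_integrable => //; [exact: measurable_cylinder|exact: L2_cylinder_lift].
Qed.

Lemma integrable_inner t h v : L2 leb_cyl (cylinder t Omega) h -> L2 leb_d Omega v ->
  leb.-integrable `[0, t] (EFin \o (fun s => inner leb_d Omega (fun x => h (s, x)) v)).
Proof.
move=> Lh Lv; apply: (@integrable_section_itv t (fun p => h p * v p.2)).
by apply: L2_mul_integrable => //; [exact: measurable_cylinder|exact: L2_cylinder_lift].
Qed.

Section gradients.
Variables (t : R) (G : 'I_d -> R * 'rV[R]_d -> R) (H : 'I_d -> 'rV[R]_d -> R).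
Hypotheses (LG : forall i, L2 leb_cyl (cylinder t Omega) (G i))
  (LH : forall i, L2 leb_d Omega (H i)).

Let GHi i : leb_cyl.-integrable (cylinder t Omega) (EFin \o (fun p => G i p * H i p.2)).
Proof.
by apply: L2_mul_integrable => //; [exact: measurable_cylinder|exact: L2_cylinder_lift].
Qed.

Let sumi : leb_cyl.-integrable (cylinder t Omega)
  (EFin \o (fun p => \sum_i G i p * H i p.2)).
Proof. by apply: integrable_Rsum => //; exact: measurable_cylinder. Qed.

Lemma Rintegral_grad_inner :
  \int[leb]_(s in `[0, t]) grad_inner Omega (fun i x => G i (s, x)) H =
  \sum_i inner leb_cyl (cylinder t Omega) (G i) (fun p => H i p.2).
Proof.
rewrite (Rintegral_cylinder sumi) Rintegral_sum//.
exact: measurable_cylinder.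
Qed.

Lemma integrable_grad_inner :
  leb.-integrable `[0, t] (EFin \o (fun s => grad_inner Omega (fun i x => G i (s, x)) H)).
Proof. exact: (integrable_section_itv sumi). Qed.

End gradients.

Lemma L2_cylinder_subset t t' h : t <= t' -> L2 leb_cyl (cylinder t' Omega) h ->
  L2 leb_cyl (cylinder t Omega) h /\
  inner leb_cyl (cylinder t Omega) h h <= inner leb_cyl (cylinder t' Omega) h h.
Proof.
move=> tt' Lh; have sub := @cylinder_subset _ _ tt'.
have [mC mC'] := (measurable_cylinder t, measurable_cylinder t').
by split; [exact: L2_subset Lh|exact: inner_subset_le].
Qed.

End cylinder_theory.

(** * Weak solutions of the heat equation *)

Section heat_equation.
Context {R : realType} {d : nat}.
Notation leb := (@lebesgue_measure R).
Notation leb_d := (@lebesgue_rV R d).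
Notation leb_cyl := (leb \x leb_d)%E.
Variables (Omega : set 'rV[R]_d) (mu : nat -> R) (psi : nat -> 'rV[R]_d -> R)
  (Gpsi : nat -> 'I_d -> 'rV[R]_d -> R).
Hypothesis mO : measurable Omega.
Hypothesis Hpsi : forall k, H10 Omega (psi k) (Gpsi k).
Hypothesis eigen : forall k v Gv, H10 Omega v Gv ->
  grad_inner Omega (Gpsi k) Gv = mu k * inner leb_d Omega (psi k) v.
Hypothesis basis : orthonormal_basis Omega psi.

Let Lpsi k : L2 leb_d Omega (psi k). Proof. by have [] := Hpsi k. Qed.

Let LGpsi k i : L2 leb_d Omega (Gpsi k i). Proof. by have [_ /(_ i)] := Hpsi k. Qed.

Let ortho k l : inner leb_d Omega (psi k) (psi l) = (k == l)%:R.
Proof. by have [_ ->] := basis. Qed.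

Lemma eigenvalue_ge0 k : 0 <= mu k.
Proof.
have := eigen k (Hpsi k); rewrite ortho eqxx mulr1 => <-.
by rewrite grad_innerE//; apply: sumr_ge0 => i _; exact: inner_ge0.
Qed.

Lemma sqnorm_partial_sum_cvg (v : 'rV[R]_d -> R) : L2 leb_d Omega v ->
  inner leb_d Omega (fun x => \sum_(k < n) inner leb_d Omega v (psi k) * psi k x - v x)
    (fun x => \sum_(k < n) inner leb_d Omega v (psi k) * psi k x - v x) @[n --> \oo] --> 0.
Proof.
move=> Lv; have [_ _ /(_ v Lv)] := basis.
have LS n : L2 leb_d Omega (fun x => v x - \sum_(k < n) inner leb_d Omega v (psi k) * psi k x).
  by apply: L2_B => //; apply: L2_sum => // k _; exact: L2_Z.
under eq_fun do rewrite sqnormE//.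
move=> /fine_cvgP[_]; apply: cvg_trans; apply: near_eq_cvg; apply: nearW => n /=.
by apply: eq_Rintegral => x _; ring.
Qed.

Section solution.
Variables (T : R) (f : R * 'rV[R]_d -> R) (y0 : 'rV[R]_d -> R).
Hypotheses (T0 : 0 <= T) (Lf : L2 leb_cyl (cylinder T Omega) f) (Ly0 : L2 leb_d Omega y0).

Definition source_coef k s := inner leb_d Omega (fun x => f (s, x)) (psi k).

Definition modal k := duhamel (mu k) (inner leb_d Omega y0 (psi k)) (source_coef k).

Let mf : measurable_fun (cylinder T Omega) f. Proof. by have [] := Lf. Qed.

Let source_coef_integrable k : leb.-integrable `[0, T] (EFin \o source_coef k).
Proof. exact: integrable_inner. Qed.

Let msource k : measurable_fun `]0, T[%classic (source_coef k).
Proof.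
have /measurable_int/measurable_EFinP := source_coef_integrable k.
by apply: measurable_funS => //; exact: subset_itv_oo_cc.
Qed.

(** Bessel's inequality for the slices of the source, integrated in time. *)
Let source_bessel N :
  (\sum_(k < N) sqnorm leb `]0%R, T[ (source_coef k) <= (inner leb_cyl (cylinder T Omega) f f)%:E)%E.
Proof.
rewrite -sqnormE//; last exact: measurable_cylinder.
have -> : sqnorm leb_cyl (cylinder T Omega) f =
    (\int[leb]_(s in `]0%R, T[) sqnorm leb_d Omega (fun x => f (s, x)))%E.
  exact: (sqnorm_prod leb leb_d (measurable_itv `]0, T[) mO mf).
rewrite {1}/sqnorm -ge0_integral_sum//; last 2 first.
- by move=> k; apply: measurable_sqr; exact: msource.
- by move=> k x _; rewrite lee_fin sqr_ge0.
apply: ge0_le_integral => //.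
- by move=> s _; apply: sume_ge0 => k _; rewrite lee_fin sqr_ge0.
- by apply: emeasurable_sum => k; apply: measurable_sqr; exact: msource.
- by apply: measurable_sqnorm_section mf.
- move=> s sT; rewrite sumEFin; apply: bessel => //.
  exact: (measurable_fun_section (measurable_itv `]0, T[) mO mf).
Qed.

Lemma L2_source_coef k : L2 leb `[0, T] (source_coef k).
Proof.
apply: L2_itv_oo_cc; split; first exact: msource.
apply: le_lt_trans (ltry (inner leb_cyl (cylinder T Omega) f f)).
apply: le_trans (source_bessel k.+1); rewrite big_ord_recr /= leeDr//.
by apply: sume_ge0 => i _; exact: sqnorm_ge0.
Qed.

Lemma sum_source_coef_le N :
  \sum_(k < N) inner leb `[0, T]%classic (source_coef k) (source_coef k) <=
  inner leb_cyl (cylinder T Omega) f f.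
Proof.
rewrite -lee_fin -sumEFin; apply: le_trans (source_bessel N).
rewrite le_eqVlt; apply/orP; left; apply/eqP; apply: eq_bigr => k _.
have Lk := L2_itv_cc_oo (L2_source_coef k).
by rewrite sqnormE// inner_itv_oo_cc.
Qed.

Lemma modal_continuous k : {within `[0, T], continuous (modal k)}.
Proof. exact: duhamel_continuous. Qed.

Lemma modal0 k : modal k 0 = inner leb_d Omega y0 (psi k).
Proof.
by rewrite /modal /duhamel set_itv1 Rintegral_set1 mulr0 expR0 mul1r addr0.
Qed.

Lemma L2_modal k : L2 leb `[0, T] (modal k).
Proof. exact: L2_duhamel (L2_source_coef k). Qed.

(** Bounds both the square of the k-th mode at all times and its energy, and is summable
    over [k]: its partial sums [vb] control the convergence of the Galerkin sums and of
    their gradients alike. *)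
Let bound k := 2 * inner leb_d Omega y0 (psi k) ^+ 2 +
  2 * T * inner leb `[0, T]%classic (source_coef k) (source_coef k).

Let bound_ge0 k : 0 <= bound k.
Proof. by rewrite addr_ge0// mulr_ge0 ?sqr_ge0 ?inner_ge0 ?mulr_ge0. Qed.

Let modal_sqr_le k t : 0 <= t <= T -> modal k t ^+ 2 <= bound k.
Proof. by move=> tT; apply: duhamel_bound => //; [exact: eigenvalue_ge0|exact: L2_source_coef]. Qed.

Let modal_energy k : mu k * inner leb `[0, T]%classic (modal k) (modal k) <= bound k.
Proof. by apply: duhamel_energy => //; [exact: eigenvalue_ge0|exact: L2_source_coef]. Qed.

Let vb N := \sum_(k < N) bound k.

Let cvb : cvgn vb.
Proof.
apply: nondecreasing_is_cvgn.
  move=> m n mn; rewrite -subr_ge0 /vb (big_ord_subr _ mn).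
  by apply: sumr_ge0 => k _; exact: bound_ge0.
exists (2 * inner leb_d Omega y0 y0 + 2 * T * inner leb_cyl (cylinder T Omega) f f).
move=> _ [N _ <-]; rewrite /vb big_split /= -!mulr_sumr; apply: lerD.
  rewrite ler_wpM2l// -lee_fin -sqnormE//; apply: bessel => //.
  by have [] := Ly0.
by rewrite ler_wpM2l ?mulr_ge0// sum_source_coef_le.
Qed.

Let V := limn vb.

Let galerkin N t x := \sum_(k < N) modal k t * psi k x.

Let Lgal N t : L2 leb_d Omega (galerkin N t).
Proof. by apply: L2_sum => // k _; exact: L2_Z. Qed.

(** For each time the Galerkin sums converge; the rate [V - vb N] given by [L2_complete]
    does not depend on the time. *)
Let slice t : exists yt : 'rV[R]_d -> R, 0 <= t <= T -> L2 leb_d Omega yt /\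
  forall N, inner leb_d Omega (fun x => yt x - galerkin N t x)
    (fun x => yt x - galerkin N t x) <= V - vb N.
Proof.
have [tT|ntT] := boolP (0 <= t <= T); last by exists (fun=> 0).
have diff m n : (m <= n)%N -> inner leb_d Omega (fun x => galerkin n t x - galerkin m t x)
    (fun x => galerkin n t x - galerkin m t x) <= vb n - vb m.
  move=> mn; rewrite /vb (big_ord_subr _ mn).
  have -> : (fun x => galerkin n t x - galerkin m t x) =
      fun x => \sum_(k < n | (m <= k)%N) modal k t * psi k x.
    apply/funext => x.
    exact: (big_ord_subr (fun k => modal k t * psi k x) mn).
  rewrite (orthonormal_sqr mO Lpsi ortho n (fun k => (m <= k)%N) (modal ^~ t)).
  by apply: ler_sum => k _; exact: modal_sqr_le.
by have [yt [_ _ Lyt ytN]] := L2_complete mO (Lgal ^~ t) diff cvb; exists yt.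
Qed.

Let ggrad N i (p : R * 'rV[R]_d) := \sum_(k < N) modal k p.1 * Gpsi k i p.2.

Let Lterm k i : L2 leb_cyl (cylinder T Omega) (fun p => modal k p.1 * Gpsi k i p.2).
Proof. by apply: L2_cylinder_tensor => //; exact: L2_modal. Qed.

Let Lggrad N i : L2 leb_cyl (cylinder T Omega) (ggrad N i).
Proof. by apply: L2_sum => //; exact: measurable_cylinder. Qed.

(** By the eigenvalue equation, the gradients of the eigenfunctions are orthogonal with
    squared norms [mu k], so that the energy estimate of each mode applies. *)
Let ggrad_diff i m n : (m <= n)%N ->
  inner leb_cyl (cylinder T Omega) (fun p => ggrad n i p - ggrad m i p)
    (fun p => ggrad n i p - ggrad m i p) <= vb n - vb m.
Proof.
move=> mn; rewrite /vb (big_ord_subr _ mn).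
pose D j p := \sum_(k < n | (m <= k)%N) modal k p.1 * Gpsi k j p.2.
have -> : (fun p => ggrad n i p - ggrad m i p) = D i.
  apply/funext => p.
  exact: (big_ord_subr (fun k => modal k p.1 * Gpsi k i p.2) mn).
have mC := measurable_cylinder mO T.
have DE j : inner leb_cyl (cylinder T Omega) (D j) (D j) =
    \sum_(k < n | (m <= k)%N) \sum_(l < n | (m <= l)%N)
      inner leb `[0, T]%classic (modal k) (modal l) * inner leb_d Omega (Gpsi k j) (Gpsi l j).
  rewrite inner_suml//; last by apply: L2_sum.
  apply: eq_bigr => k _; rewrite inner_sumr//; apply: eq_bigr => l _.
  by rewrite inner_cylinder_tensor//; exact: L2_modal.
apply: (@le_trans _ _ (\sum_j inner leb_cyl (cylinder T Omega) (D j) (D j))).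
  by rewrite (bigD1 i)//= lerDl sumr_ge0// => j _; exact: inner_ge0.
under eq_bigr do rewrite DE.
rewrite exchange_big /=; apply: ler_sum => k mk.
rewrite exchange_big /=.
under eq_bigr => l _ do rewrite -mulr_sumr -grad_innerE// (eigen k (Hpsi l)) ortho.
rewrite (bigD1 k)//= eqxx mulr1 big1 ?addr0; first by rewrite mulrC; exact: modal_energy.
by move=> l /andP[_ lk]; rewrite eq_sym (negbTE (lk : (l : nat) != k)) !mulr0.
Qed.

Section limits.
Variables (y : R -> 'rV[R]_d -> R) (G : 'I_d -> R * 'rV[R]_d -> R).
Hypothesis Ly : forall t, 0 <= t <= T -> L2 leb_d Omega (y t).
Hypothesis y_gal : forall t, 0 <= t <= T -> forall N,
  inner leb_d Omega (fun x => y t x - galerkin N t x) (fun x => y t x - galerkin N t x) <= V - vb N.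
Hypothesis LG : forall i, L2 leb_cyl (cylinder T Omega) (G i).
Hypothesis G_gal : forall i N,
  inner leb_cyl (cylinder T Omega) (fun p => G i p - ggrad N i p) (fun p => G i p - ggrad N i p)
    <= V - vb N.

Let tail_cvg0 : V - vb N @[N --> \oo] --> 0.
Proof. by rewrite -(subrr V); apply: cvgB; [exact: cvg_cst|exact: cvb]. Qed.

(** The Galerkin sums are continuous in time and converge uniformly in time. *)
Let y_continuous t : 0 <= t <= T ->
  sqnorm leb_d Omega (y s \- y t) @[s --> within `[0, T]%classic (nbhs t)] --> 0%E.
Proof.
move=> tT; apply/(ge0_cvge0P (fun s => sqnorm_ge0 _ _ _)) => e e0.
(* The difference of y s and y t is split in three: the increment g of the Galerkin sum
   and the errors a and b at both times. Applying |p + q|^2 <= 2 |p|^2 + 2 |q|^2 twice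
   gives weights 2, 4 and 4, whence e / 10. *)
have aux (a b g r v : R) : v <= e / 10 -> a <= v -> b <= v ->
  r <= 2 * g + 2 * (-1 * (-1 * b)) -> g <= e / 10 -> 2 * a + 2 * r <= e by lra.
have e10 : 0 < e / 10 by rewrite divr_gt0.
have [N VN] : exists N, V - vb N <= e / 10.
  have /cvgrPdist_le/(_ _ e10)[N _ /(_ N (leqnn N))] := tail_cvg0.
  by rewrite /= sub0r normrN => h; exists N; exact: le_trans (ler_norm _) h.
have modal_cvg k : modal k s @[s --> within `[0, T]%classic (nbhs t)] --> modal k t.
  have tA : `[0, T]%classic t by rewrite /= in_itv.
  rewrite (nbhs_subspace_in tA); exact: (@modal_continuous k t).
have gal_cvg : \sum_(k < N) (modal k s - modal k t) ^+ 2
    @[s --> within `[0, T]%classic (nbhs t)] --> 0.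
  have z : \sum_(k < N) 0 = 0 :> R by rewrite big1.
  rewrite -[X in _ --> X]z.
  apply: cvg_sum => k.
  have d0 : modal k s - modal k t @[s --> within `[0, T]%classic (nbhs t)] -->
      modal k t - modal k t.
    by apply: cvgB; [exact: modal_cvg|exact: cvg_cst].
  have FW : Filter (within `[0, T]%classic (nbhs t)) by exact: within_filter.
  by have := cvgM d0 d0; rewrite subrr mul0r => /(_ FW).
have /cvgrPdist_le/(_ _ e10) gn := gal_cvg.
near=> s.
have sT : 0 <= s <= T.
  have : `[0, T]%classic s by near: s; exact: withinT.
  by rewrite /= in_itv.
have gst : \sum_(k < N) (modal k s - modal k t) ^+ 2 <= e / 10.
  apply: le_trans (ler_norm _) _; rewrite -normrN -[X in `|X|]sub0r.
  by near: s.
have Lys := Ly sT; have Lyt := Ly tT.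
have Lgst := L2_B mO (Lgal N s) (Lgal N t).
have Ls := L2_B mO Lys (Lgal N s).
have Lt0 := L2_B mO Lyt (Lgal N t).
have Lt := L2_Z mO (-1) Lt0.
have Lr := L2_D mO Lgst Lt.
have -> : (y s \- y t) = fun x => (y s x - galerkin N s x) +
    ((galerkin N s x - galerkin N t x) + -1 * (y t x - galerkin N t x)).
  by apply/funext => x /=; ring.
rewrite (sqnormE mO (L2_D mO Ls Lr)) lee_fin.
apply: le_trans (inner_sqrD_le mO Ls Lr) _.
have := inner_sqrD_le mO Lgst Lt.
rewrite (innerZl mO _ Lt0 Lt) (innerZr mO _ Lt0 Lt0).
move=> hr; apply: (aux _ _ _ _ _ VN (y_gal sT N) (y_gal tT N) hr).
rewrite -[leLHS](_ : \sum_(k < N) (modal k s - modal k t) ^+ 2 = _)//.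
rewrite -(orthonormal_sqr mO Lpsi ortho N xpredT (fun k => modal k s - modal k t)).
by apply: eq_Rintegral => x _; rewrite /galerkin -sumrB; congr (_ * _);
  apply: eq_bigr => k _; rewrite mulrBl.
Unshelve. all: by end_near.
Qed.

Let y_initial : {ae leb_d, forall x, Omega x -> y 0 x = y0 x}.
Proof.
have t0 : 0 <= (0 : R) <= T by apply/andP; split.
have Ld : L2 leb_d Omega (fun x => y 0 x - y0 x) by apply: L2_B => //; exact: Ly.
have d0 : inner leb_d Omega (fun x => y 0 x - y0 x) (fun x => y 0 x - y0 x) <= 0.
  have c0 := sqnorm_partial_sum_cvg Ly0.
  have c : 2 * (V - vb N) + 2 * inner leb_d Omega (fun x => galerkin N 0 x - y0 x)
      (fun x => galerkin N 0 x - y0 x) @[N --> \oo] --> 0.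
    have gE N : galerkin N 0 = fun x => \sum_(k < N) inner leb_d Omega y0 (psi k) * psi k x.
      by apply/funext => x; apply: eq_bigr => k _; rewrite modal0.
    rewrite -[X in _ --> X](addr0 0) -[X in _ --> X + _](mulr0 2) -[X in _ --> _ + X](mulr0 2).
    apply: cvgD; first by apply: cvgMr.
    by apply: cvgMr; under eq_fun do rewrite gE.
  rewrite -[leRHS](cvg_lim _ c)//; apply: limr_ge; first by apply/cvg_ex; exists 0.
  apply: nearW => N.
  have L1 : L2 leb_d Omega (fun x => y 0 x - galerkin N 0 x) by apply: L2_B => //; exact: Ly.
  have L2' : L2 leb_d Omega (fun x => galerkin N 0 x - y0 x) by exact: L2_B.
  have -> : inner leb_d Omega (fun x => y 0 x - y0 x) (fun x => y 0 x - y0 x) =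
      inner leb_d Omega (fun x => (y 0 x - galerkin N 0 x) + (galerkin N 0 x - y0 x))
        (fun x => (y 0 x - galerkin N 0 x) + (galerkin N 0 x - y0 x)).
    by apply: inner_eq => x _; ring.
  apply: le_trans (inner_sqrD_le mO L1 L2') _.
  by rewrite lerD2r ler_wpM2l// y_gal.
have : sqnorm leb_d Omega (fun x => y 0 x - y0 x) = 0%E.
  rewrite sqnormE//; congr EFin; apply/le_anti; rewrite d0; exact: inner_ge0.
move=> /(sqnorm_eq0_ae mO)[|N [mN N0 h]]; first by have [] := Ld.
exists N; split=> // x /= hx; apply: h => /= h'; apply: hx => Ox.
by apply/eqP; rewrite -subr_eq0 (h' Ox).
Qed.

(** Galerkin sums are in [H10] with known gradients. Along the subsequence [M] the
    gradients converge geometrically in space-time, hence for almost every time by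
    [ae_section_cvg0], and [H10_closed] applies at such a time. *)
Let ae_H10 : {ae leb, forall t, t \in `]0, T[ -> H10 Omega (y t) (fun i x => G i (t, x))}.
Proof.
have /choice[M MV] : forall k : nat, exists N, V - vb N <= 2^-1 ^+ k.
  move=> k; have k0 : 0 < 2^-1 ^+ k :> R by rewrite exprn_gt0.
  have /cvgrPdist_le/(_ _ k0)[N _ /(_ N (leqnn N))] := tail_cvg0.
  by rewrite /= sub0r normrN => h; exists N; exact: le_trans (ler_norm _) h.
have mC := measurable_cylinder mO T.
have LGB k i : L2 leb_cyl (cylinder T Omega) (fun p => G i p - ggrad (M k) i p).
  by apply: L2_B.
have ae1 i : {ae leb, forall t, `]0, T[%classic t ->
    sqnorm leb_d Omega (fun x => G i (t, x) - ggrad (M k) i (t, x)) @[k --> \oo] --> 0%E}.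
  apply: (ae_section_cvg0 (m1 := leb) (m2 := leb_d) (measurable_itv `]0, T[) mO
    (h := fun k p => G i p - ggrad (M k) i p)) => k; first by have [] := LGB k i.
  rewrite [leLHS](@sqnormE _ _ _ leb_cyl _ mC _ (LGB k i)) lee_fin.
  exact: le_trans (G_gal i (M k)) (MV k).
have ae2 i : {ae leb, forall t, `]0, T[%classic t -> L2 leb_d Omega (fun x => G i (t, x))}.
  exact: (ae_L2_section (m1 := leb) (m2 := leb_d) (measurable_itv `]0, T[) mO (LG i)).
have FA : Filter (almost_everywhere leb) by exact: ae_filter_ringOfSetsType.
have ae12 : {ae leb, forall t, forall i, `]0, T[%classic t ->
    L2 leb_d Omega (fun x => G i (t, x)) /\
    sqnorm leb_d Omega (fun x => G i (t, x) - ggrad (M k) i (t, x)) @[k --> \oo] --> 0%E}.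
  apply: filter_forall => i; apply: (@filterS2 _ _ FA _ _ _ _ (ae1 i) (ae2 i)) => t h1 h2 tT.
  by split; [exact: h2|exact: h1].
apply: (@filterS _ _ FA _ _ _ ae12) => t h tT.
have tT' : 0 <= t <= T by move: tT; rewrite in_itv /= => /andP[/ltW -> /ltW].
have flip (u w : 'rV[R]_d -> R) :
    sqnorm leb_d Omega (fun x => u x - w x) = sqnorm leb_d Omega (fun x => w x - u x).
  by apply: eq_integral => x _; rewrite -sqrrN opprB.
apply: (H10_closed mO (fk := fun k => galerkin (M k) t)
  (Gk := fun k i x => ggrad (M k) i (t, x))).
- exact: Ly.
- by move=> i; have [] := h i tT.
- by move=> k; exact: (H10_sum mO (M k) (modal ^~ t) Hpsi).
- apply/(ge0_cvge0P (fun s => sqnorm_ge0 _ _ _)) => e e0.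
  have h2 : `|2^-1 : R| < 1 by rewrite ger0_norm; lra.
  have /cvgrPdist_le/(_ _ e0) gk := cvg_geometric 1 h2.
  near=> k.
  rewrite flip sqnormE//; last by apply: L2_B => //; exact: Ly.
  rewrite lee_fin; apply: le_trans (y_gal tT' (M k)) _; apply: le_trans (MV k) _.
  have : `|0 - geometric 1 2^-1 k| <= e by near: k.
  by rewrite /= sub0r normrN mul1r; exact: le_trans (ler_norm _).
- by move=> i; under eq_fun do rewrite flip; have [] := h i tT.
Unshelve. all: by end_near.
Qed.

(** For a Galerkin sum [duhamel_solves] gives the equation, with the source tested
    against the truncation [P N] of [v]; every term passes to the limit. *)
Let weak_equation v Gv : H10 Omega v Gv -> forall t, 0 <= t <= T ->
  inner leb_d Omega (y t) v - inner leb_d Omega (y 0) v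
    + \int[leb]_(s in `[0, t]) grad_inner Omega (fun i x => G i (s, x)) Gv
  = \int[leb]_(s in `[0, t]) inner leb_d Omega (fun x => f (s, x)) v.
Proof.
move=> HvG t tT; have [Lv LGv _] := HvG; have /andP[t0 tT'] := tT.
have mC := measurable_cylinder mO t.
have Lft : L2 leb_cyl (cylinder t Omega) f by have [] := L2_cylinder_subset mO tT' Lf.
have LGt i : L2 leb_cyl (cylinder t Omega) (G i) by have [] := L2_cylinder_subset mO tT' (LG i).
have Lgt N i : L2 leb_cyl (cylinder t Omega) (ggrad N i).
  by have [] := L2_cylinder_subset mO tT' (Lggrad N i).
have Lmt k : L2 leb `[0, t] (modal k).
  by apply: L2_subset (L2_modal k) => //; apply: subset_itvl; rewrite bnd_simp.
rewrite (Rintegral_grad_inner mO LGt LGv) (Rintegral_inner mO Lft Lv).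
pose vk k := inner leb_d Omega v (psi k).
pose P N x := \sum_(k < N) vk k * psi k x.
have LP N : L2 leb_d Omega (P N) by apply: L2_sum => // k _; exact: L2_Z.
have cvg_y s : 0 <= s <= T ->
    inner leb_d Omega (galerkin N s) v @[N --> \oo] --> inner leb_d Omega (y s) v.
  move=> sT; apply: inner_cvg => //; first exact: Ly.
  apply: (squeeze_cvgr _ (cvg_cst 0) tail_cvg0); apply: nearW => N.
  rewrite inner_ge0 /=; apply: le_trans (y_gal sT N).
  by rewrite le_eqVlt; apply/orP; left; apply/eqP; apply: eq_Rintegral => x _; ring.
have cvg_G : \sum_i inner leb_cyl (cylinder t Omega) (ggrad N i) (fun p => Gv i p.2) @[N --> \oo]
    --> \sum_i inner leb_cyl (cylinder t Omega) (G i) (fun p => Gv i p.2).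
  apply: cvg_sum => i.
  apply: (@inner_cvg _ _ _ leb_cyl _ mC (fun N => ggrad N i) (G i) (fun p => Gv i p.2)).
  - by move=> N; exact: Lgt.
  - exact: LGt.
  - exact: L2_cylinder_lift.
  apply: (squeeze_cvgr _ (cvg_cst 0) tail_cvg0); apply: nearW => N.
  rewrite inner_ge0 /=; apply: le_trans (G_gal i N).
  have LGg : L2 leb_cyl (cylinder T Omega) (fun p => ggrad N i p - G i p).
    by apply: L2_B => //; exact: measurable_cylinder.
  have [_ h] := L2_cylinder_subset mO tT' LGg; apply: le_trans h _.
  by rewrite le_eqVlt; apply/orP; left; apply/eqP; apply: eq_Rintegral => x _; ring.
have cvg_f : inner leb_cyl (cylinder t Omega) (fun p => P N p.2) f @[N --> \oo] -->
    inner leb_cyl (cylinder t Omega) (fun p => v p.2) f.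
  apply: (@inner_cvg _ _ _ leb_cyl _ mC (fun N p => P N p.2) (fun p => v p.2) f).
  - by move=> N; exact: L2_cylinder_lift.
  - exact: L2_cylinder_lift.
  - exact: Lft.
  have dE N : inner leb_cyl (cylinder t Omega) (fun p => P N p.2 - v p.2)
      (fun p => P N p.2 - v p.2) =
      t * inner leb_d Omega (fun x => P N x - v x) (fun x => P N x - v x).
    have LPv : L2 leb_d Omega (fun x => P N x - v x) by exact: L2_B.
    transitivity (inner leb_cyl (cylinder t Omega)
        (fun p => cst 1 p.1 * (P N p.2 - v p.2)) (fun p => P N p.2 - v p.2)).
      by apply: eq_Rintegral => p _; rewrite /cst mul1r.
    rewrite (inner_cylinder_tensor_lift mO (L2_cst_itv t 1) LPv LPv).
    by rewrite /cst Rintegral_cst// lebesgue_itv_cc// mul1r subr0.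
  have c : t * inner leb_d Omega (fun x => P N x - v x) (fun x => P N x - v x)
      @[N --> \oo] --> t * 0.
    by apply: cvgMr; exact: sqnorm_partial_sum_cvg.
  rewrite mulr0 in c; apply: cvg_trans c; apply: near_eq_cvg.
  by apply: nearW => N; rewrite dE.
have gal_inner N s : inner leb_d Omega (galerkin N s) v = \sum_(k < N) modal k s * vk k.
  rewrite inner_suml//; last by move=> k _; exact: L2_Z.
  by apply: eq_bigr => k _; rewrite innerZl// innerC.
have gal_grad N : \sum_i inner leb_cyl (cylinder t Omega) (ggrad N i) (fun p => Gv i p.2) =
    \sum_(k < N) (\int[leb]_(s in `[0, t]) modal k s) * (mu k * vk k).
  have Lk k i : L2 leb_cyl (cylinder t Omega) (fun p => modal k p.1 * Gpsi k i p.2).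
    exact: L2_cylinder_tensor.
  under eq_bigr => i _.
    rewrite inner_suml//; last exact: L2_cylinder_lift.
    under eq_bigr => k _ do rewrite (inner_cylinder_tensor_lift mO (Lmt k) (LGpsi k i) (LGv i)).
    over.
  rewrite exchange_big /=; apply: eq_bigr => k _.
  by rewrite -mulr_sumr -grad_innerE// (eigen k HvG) /vk (innerC _ _ v).
have gal_source N : inner leb_cyl (cylinder t Omega) (fun p => P N p.2) f =
    \sum_(k < N) vk k * \int[leb]_(s in `[0, t]) source_coef k s.
  have Lpk k : L2 leb_cyl (cylinder t Omega) (fun p => psi k p.2) by exact: L2_cylinder_lift.
  rewrite inner_suml//; last by move=> k _; apply: L2_Z.
  apply: eq_bigr => k _; rewrite innerZl// innerC; congr (_ * _).
  by rewrite -(Rintegral_inner mO Lft (Lpsi k)).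
have galE N : inner leb_d Omega (galerkin N t) v - inner leb_d Omega (galerkin N 0) v +
    \sum_i inner leb_cyl (cylinder t Omega) (ggrad N i) (fun p => Gv i p.2) =
    inner leb_cyl (cylinder t Omega) (fun p => P N p.2) f.
  rewrite !gal_inner gal_grad gal_source -sumrB -big_split /=; apply: eq_bigr => k _.
  have Lsk := L2_itv_integrable (L2_source_coef k).
  rewrite -(duhamel_solves (mu k) (inner leb_d Omega y0 (psi k)) Lsk tT).
  by rewrite modal0 /modal; ring.
rewrite [RHS]innerC; apply/esym; apply: (@cvg_unique _ (@Rhausdorff R) _ _ _ _ cvg_f).
rewrite -(_ : (fun N => inner leb_d Omega (galerkin N t) v - inner leb_d Omega (galerkin N 0) v +
    \sum_i inner leb_cyl (cylinder t Omega) (ggrad N i) (fun p => Gv i p.2)) =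
    fun N => inner leb_cyl (cylinder t Omega) (fun p => P N p.2) f); last first.
  by apply/funext => N; exact: galE.
apply: cvgD cvg_G; apply: cvgB; first exact: cvg_y.
by apply: cvg_y; apply/andP; split.
Qed.

Lemma galerkin_limit_solves : weak_heat_solution Omega T f y0 y.
Proof.
split.
- by move=> t; rewrite in_itv; exact: Ly.
- by move=> t; rewrite in_itv; exact: y_continuous.
- exact: y_initial.
- exists G; split=> //; exact: weak_equation.
Qed.

End limits.

Lemma weak_heat_solution_exists : exists y, weak_heat_solution Omega T f y0 y.
Proof.
have /choice[y yP] := slice.
have mC := measurable_cylinder mO T.
have /choice[G GP] : forall i, exists G : R * 'rV[R]_d -> R,
    L2 leb_cyl (cylinder T Omega) G /\ forall N,
    inner leb_cyl (cylinder T Omega) (fun p => G p - ggrad N i p) (fun p => G p - ggrad N i p)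
      <= V - vb N.
  move=> i.
  have [g [_ _ Lg gN]] := @L2_complete _ _ _ leb_cyl _ mC (fun N => ggrad N i) vb V
    (fun N => Lggrad N i) (@ggrad_diff i) cvb.
  by exists g.
exists y; apply: (@galerkin_limit_solves y G).
- by move=> t /yP[].
- by move=> t /yP[].
- by move=> i; have [] := GP i.
- by move=> i; have [] := GP i.
Qed.

Section uniqueness.
Variables (y : R -> 'rV[R]_d -> R) (k : nat).
Hypothesis sol : weak_heat_solution Omega T f y0 y.

Let a t := inner leb_d Omega (y t) (psi k).

Let Ly t : 0 <= t <= T -> L2 leb_d Omega (y t).
Proof. by have [h _ _ _] := sol => tT; apply: h; rewrite in_itv. Qed.

Let a_continuous : {within `[0, T], continuous a}.
Proof.
apply/subspace_continuousP => t /= ; rewrite in_itv /= => tT.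
have FW : Filter (within `[0, T]%classic (nbhs t)) by exact: within_filter.
have [_ cy _ _] := sol.
have tI : t \in `[0, T] by rewrite in_itv.
have /(ge0_cvge0P (fun s => sqnorm_ge0 _ _ _)) cyt := cy t tI.
apply/cvgrPdist_le => e e0.
have e2 : 0 < e ^+ 2 by rewrite exprn_gt0.
have nT : within `[0, T]%classic (nbhs t) `[0, T]%classic by exact: withinT.
apply: (@filterS2 _ _ FW _ _ _ _ nT (cyt _ e2)) => s.
rewrite /= in_itv /= => sT ys.
have Ld := L2_B mO (Ly sT) (Ly tT).
have {}ys : inner leb_d Omega (fun x => y s x - y t x) (fun x => y s x - y t x) <= e ^+ 2.
  by rewrite -lee_fin -(sqnormE mO Ld).
rewrite distrC -(innerBl mO (Ly sT) (Ly tT) (Lpsi k)).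
rewrite -(@ler_pXn2r _ 2)//; last by rewrite nnegrE ltW.
rewrite real_normK ?num_real//.
apply: le_trans (cauchy_schwarz mO Ld (Lpsi k)) _.
by rewrite ortho eqxx mulr1.
Qed.

Let a_integrable : leb.-integrable `[0, T] (EFin \o a).
Proof.
by apply: continuous_compact_integrable a_continuous; exact: segment_compact.
Qed.

Let a_initial : a 0 = inner leb_d Omega y0 (psi k).
Proof.
have [_ _ ae0 _] := sol.
have t0 : 0 <= (0 : R) <= T by apply/andP; split.
rewrite /a /inner /Rintegral; congr fine; apply: ae_eq_integral => //.
- exact: measurable_int (L2_mul_integrable mO (Ly t0) (Lpsi k)).
- exact: measurable_int (L2_mul_integrable mO Ly0 (Lpsi k)).
- have FA : Filter (almost_everywhere leb_d) by exact: ae_filter_ringOfSetsType.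
  by apply: (@filterS _ _ FA _ _ _ ae0) => x h Ox; rewrite h.
Qed.

(** The weak equation tested with [psi k]; the term [mu k * a s] comes from the
    eigenvalue equation of [psi k] tested with [y s], which is in [H10] for almost
    every [s]. *)
Let a_equation t : 0 <= t <= T ->
  a t - a 0 + mu k * \int[leb]_(s in `[0, t]) a s = \int[leb]_(s in `[0, t]) source_coef k s.
Proof.
move=> /[dup] tT /andP[t0 tT'].
have [_ _ _ [G [LG HG weq]]] := sol.
have tI : t \in `[0, T] by rewrite in_itv.
rewrite -(weq _ _ (Hpsi k) t tI); congr (_ + _).
have LGt i : L2 leb_cyl (cylinder t Omega) (G i) by have [] := L2_cylinder_subset mO tT' (LG i).
have sub : `]0, t[%classic `<=` `[0, t]%classic by exact: subset_itv_oo_cc.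
have gi : leb.-integrable `]0, t[
    (EFin \o (fun s => grad_inner Omega (fun i x => G i (s, x)) (Gpsi k))).
  by apply: integrableS (integrable_grad_inner mO LGt (LGpsi k)).
have ai : leb.-integrable `]0, t[ (EFin \o a).
  apply: integrableS a_integrable => //; apply: subset_trans sub _.
  by apply: subset_itvl; rewrite bnd_simp.
have mai : leb.-integrable `]0, t[ (EFin \o (fun s => mu k * a s)).
  exact: (@integrableZl _ _ _ leb `]0, t[%classic (measurable_itv _) (mu k) _ ai).
rewrite -(Rintegral_itv_oo_cc ai) -(Rintegral_itv_oo_cc gi) -RintegralZl//.
rewrite /Rintegral; congr fine; apply: ae_eq_integral => //.
- exact: measurable_int mai.
- exact: measurable_int gi.
have FA : Filter (almost_everywhere leb) by exact: ae_filter_ringOfSetsType.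
apply: (@filterS _ _ FA _ _ _ HG) => s h; rewrite /= in_itv /= => /andP[s0 st].
have sT : s \in `]0, T[ by rewrite in_itv /= s0 (lt_le_trans st).
have HyG := h sT; congr EFin.
rewrite /a innerC -(eigen k HyG); apply: eq_Rintegral => x _.
by apply: eq_bigr => i _; rewrite mulrC.
Qed.

(** The coefficient of [y] on [psi k] is an integral solution of the differential
    equation that defines [modal k], so [duhamel_unique] identifies them. *)
Lemma weak_solution_modal : inner leb_d Omega (y T) (psi k) = modal k T.
Proof.
apply: (duhamel_unique T0 (L2_itv_integrable (L2_source_coef k)) a_integrable) => t tT.
by rewrite -a_initial; exact: a_equation.
Qed.

End uniqueness.

End solution.
End heat_equation.

(** * Null controls *)

Section null_control.
Context {R : realType} {d : nat}.
Notation leb := (@lebesgue_measure R).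
Notation leb_d := (@lebesgue_rV R d).
Notation leb_cyl := (leb \x leb_d)%E.

(** For coefficients with finitely many nonzero terms the finitely supported sum in
    [low_modes] is a genuine finite sum: outside the first [N] indices its terms are 0. *)
Lemma low_modesE (mu : nat -> R) (psi : nat -> 'rV[R]_d -> R) (lambda : R) N (b : nat -> R) :
  low_modes mu psi lambda (fun k => if (k < N)%N then b k else 0) =
  fun x => \sum_(k < N | Num.sqrt (mu k) <= lambda) b k * psi k x.
Proof.
apply/funext => x; rewrite /low_modes.
rewrite (@fsbigE _ _ _ _ _ [seq k <- index_iota 0 N | Num.sqrt (mu k) <= lambda]).
- rewrite big_filter_cond big_mkord.
  apply: eq_big => [k|k _]; last by rewrite ltn_ord.
  by apply/andP/idP => [[]//|kl]; split=> //; exact/mem_set.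
- by rewrite filter_uniq// iota_uniq.
- by move=> k /=; rewrite mem_filter => /andP[].
- move=> k /= kl; rewrite mem_filter kl mem_index_iota /= => /negbTE ->.
  by rewrite mul0r.
Qed.

Lemma finite_spectral_inequality (Omega omega : set 'rV[R]_d) (mu : nat -> R)
    (psi : nat -> 'rV[R]_d -> R) (beta : R) :
  measurable Omega -> measurable omega -> omega `<=` Omega ->
  (forall k, L2 leb_d Omega (psi k)) ->
  (forall k l, inner leb_d Omega (psi k) (psi l) = (k == l)%:R) ->
  (forall (lambda : R) (b : nat -> R), 0 < lambda -> cvgn (series (fun m => b m ^+ 2)) ->
     (sqnorm leb_d Omega (low_modes mu psi lambda b)
      <= (expR (beta * lambda))%:E * sqnorm leb_d omega (low_modes mu psi lambda b))%E) ->
  forall (lambda : R) N (b : nat -> R), 0 < lambda ->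
  \sum_(k < N | Num.sqrt (mu k) <= lambda) b k ^+ 2 <= expR (beta * lambda) *
  inner leb_d omega (fun x => \sum_(k < N | Num.sqrt (mu k) <= lambda) b k * psi k x)
             (fun x => \sum_(k < N | Num.sqrt (mu k) <= lambda) b k * psi k x).
Proof.
move=> mO mo oO Lpsi ortho spec lambda N b lambda0.
pose b' k := if (k < N)%N then b k else 0.
have cb : cvgn (series (fun m => b' m ^+ 2)).
  apply/cvg_ex; exists (series (fun m => b' m ^+ 2) N).
  apply: cvg_near_cst; exists N => // n /= Nn; rewrite /series /= (big_cat_nat (leq0n N) Nn)/=.
  rewrite [X in _ + X]big_nat [X in _ + X]big1 ?addr0// => k /andP[Nk _].
  by rewrite /b' ltnNge Nk /= expr0n.
have := spec lambda b' lambda0 cb; rewrite low_modesE.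
pose P := fun k : nat => Num.sqrt (mu k) <= lambda.
have Ls : L2 leb_d Omega (fun x => \sum_(k < N | P k) b k * psi k x).
  by apply: L2_sum => // k _; exact: L2_Z.
rewrite (sqnormE mO Ls) (sqnormE mo (L2_subset mO mo oO Ls)) -EFinM lee_fin.
by rewrite (orthonormal_sqr mO Lpsi ortho N P b).
Qed.

Variables (Omega omega : set 'rV[R]_d) (mu : nat -> R) (psi : nat -> 'rV[R]_d -> R)
  (Gpsi : nat -> 'I_d -> 'rV[R]_d -> R) (beta : R).
Hypotheses (mO : measurable Omega) (mo : measurable omega) (oO : omega `<=` Omega).
Hypothesis Hpsi : forall k, H10 Omega (psi k) (Gpsi k).
Hypothesis eigen : forall k v Gv, H10 Omega v Gv ->
  grad_inner Omega (Gpsi k) Gv = mu k * inner leb_d Omega (psi k) v.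
Hypothesis basis : orthonormal_basis Omega psi.
Hypothesis beta_gt0 : 0 < beta.
Hypothesis spec : forall (lambda : R) N (b : nat -> R), 0 < lambda ->
  \sum_(k < N | Num.sqrt (mu k) <= lambda) b k ^+ 2 <= expR (beta * lambda) *
  inner leb_d omega (fun x => \sum_(k < N | Num.sqrt (mu k) <= lambda) b k * psi k x)
             (fun x => \sum_(k < N | Num.sqrt (mu k) <= lambda) b k * psi k x).
Variables (T : R) (y0 : 'rV[R]_d -> R).
Hypotheses (T0 : 0 < T) (Ly0 : L2 leb_d Omega y0).

Let Lpsi k : L2 leb_d Omega (psi k). Proof. by have [] := Hpsi k. Qed.

Let Lpsi_o k : L2 leb_d omega (psi k). Proof. exact: (L2_subset mO mo oO (Lpsi k)). Qed.

Let ortho k l : inner leb_d Omega (psi k) (psi l) = (k == l)%:R.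
Proof. by have [_ ->] := basis. Qed.

Let mode k (p : R * 'rV[R]_d) := expR (mu k * p.1) * psi k p.2.

Let Lexp (c : R) : L2 leb `[0, T] (fun t => expR (c * t)).
Proof.
apply: L2_continuous_itv; apply: continuous_subspaceT => s.
apply: continuous_comp; last exact: continuous_expR.
by apply: cvgMr; exact: cvg_id.
Qed.

Let Lmode k : L2 leb_cyl (cylinder T omega) (mode k).
Proof. exact: (L2_cylinder_tensor mo (Lexp (mu k)) (Lpsi_o k)). Qed.

Let mC : measurable (cylinder T omega). Proof. exact: measurable_cylinder. Qed.

(** [observability] on the last part, of length [T1], of the time interval; the earlier
    times only help, as the coefficients [b k * exp (mu k * t)] grow with [t]. *)
Let finite_observability N (b : nat -> R) :
  \sum_(k < N) b k ^+ 2 <= control_cost beta T *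
  inner leb_cyl (cylinder T omega) (fun p => \sum_(k < N) b k * mode k p)
    (fun p => \sum_(k < N) b k * mode k p).
Proof.
have mu0 k : 0 <= mu k by exact: eigenvalue_ge0 mO Hpsi eigen basis k.
pose z t x := \sum_(k < N) (b k * expR (mu k * t)) * psi k x.
pose g t := inner leb_d omega (z t) (z t).
pose h p := \sum_(k < N) b k * mode k p.
have Lh : L2 leb_cyl (cylinder T omega) h by apply: L2_sum => // k _; exact: L2_Z.
have hi := @L2_mul_integrable _ _ _ leb_cyl _ mC _ _ Lh Lh.
have gE t : g t = \int[leb_d]_(x in omega) (h (t, x) * h (t, x)).
  by apply: eq_Rintegral => x _; congr (_ * _); apply: eq_bigr => k _; rewrite /mode /= mulrA.
have gi : leb.-integrable `[0, T] (EFin \o g).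
  apply: eq_integrable (integrable_section_itv mo hi) => // t _.
  by rewrite /= gE.
have -> : inner leb_cyl (cylinder T omega) h h = \int[leb]_(t in `[0, T]) g t.
  rewrite /inner -(Rintegral_cylinder mo hi).
  by apply: eq_Rintegral => t _; rewrite gE.
pose T1 := Num.min T 2^-1; pose S := T - T1.
have T1T : T1 <= T by rewrite /T1 ge_min lexx.
have T10 : 0 < T1 by rewrite lt_min T0 invr_gt0 ltr0n.
have S0 : 0 <= S by rewrite subr_ge0.
have ST : S <= T by rewrite /S; lra.
apply: (@le_trans _ _ (\sum_(k < N) (b k * expR (mu k * S)) ^+ 2)).
  apply: ler_sum => k _; rewrite exprMn ler_peMr ?sqr_ge0//.
  by rewrite -[leLHS](expr1n _ 2) lerXn2r ?nnegrE ?expR_ge0// -expR0 ler_expR mulr_ge0.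
have := observability mO mo oO mu0 beta_gt0 Lpsi ortho spec N b S T10.
rewrite (_ : S + T1 = T); last by rewrite /S; ring.
have T12 : T1 <= 2^-1 by rewrite /T1 ge_min lexx orbT.
move=> /(_ T12) obs; apply: (le_trans obs).
rewrite -/(control_cost beta T) ler_wpM2l//; first by rewrite ltW// control_cost_gt0.
rewrite (Rintegral_itv_split S0 ST gi) lerDr.
by apply: Rintegral_ge0 => t _; exact: inner_ge0.
Qed.

(** Duality between observability and control: [moment_problem] reduces the existence of
    [u] to [<P, y0>^2 <= K |y0|^2 |sum b k e k|^2] where [P = sum b k psi k] and the
    [e k] are the modes in its statement, which is Cauchy-Schwarz followed by
    [finite_observability]. *)
Lemma null_control_exists : exists u : R * 'rV[R]_d -> R,
  [/\ measurable_fun setT u, forall p, ~ cylinder T omega p -> u p = 0,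
      L2 leb_cyl (cylinder T omega) u,
      forall k, inner leb_cyl (cylinder T omega) u (fun p => expR (mu k * p.1) * psi k p.2)
        = - inner leb_d Omega y0 (psi k) &
      inner leb_cyl (cylinder T omega) u u <= control_cost beta T * inner leb_d Omega y0 y0].
Proof.
apply: (@moment_problem _ _ _ leb_cyl _ mC mode (fun k => - inner leb_d Omega y0 (psi k))) => //.
  by rewrite mulr_ge0 ?inner_ge0// ltW// control_cost_gt0.
move=> N b; pose P x := \sum_(k < N) b k * psi k x.
have LP : L2 leb_d Omega P by apply: L2_sum => // k _; exact: L2_Z.
have -> : \sum_(k < N) b k * - inner leb_d Omega y0 (psi k) = - inner leb_d Omega P y0.
  rewrite inner_suml//; last by move=> k _; exact: L2_Z.
  by rewrite -sumrN; apply: eq_bigr => k _; rewrite innerZl// mulrN innerC.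
rewrite sqrrN; apply: le_trans (cauchy_schwarz mO LP Ly0) _.
rewrite (orthonormal_sqr mO Lpsi ortho N predT b) mulrAC.
by rewrite ler_wpM2r ?inner_ge0//; exact: finite_observability.
Qed.

Section controlled_solution.
Variable u : R * 'rV[R]_d -> R.
Hypotheses (mu_ : measurable_fun setT u) (u0 : forall p, ~ cylinder T omega p -> u p = 0).
Hypothesis Lu : L2 leb_cyl (cylinder T omega) u.
Hypothesis umode : forall k,
  inner leb_cyl (cylinder T omega) u (fun p => expR (mu k * p.1) * psi k p.2)
  = - inner leb_d Omega y0 (psi k).

Let sub : cylinder T omega `<=` cylinder T Omega.
Proof. by move=> [t x] [/= tT ox]; split => //; exact: oO. Qed.

Lemma L2_control : L2 leb_cyl (cylinder T Omega) u.
Proof.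
split; first exact: measurable_funTS.
have [_] := Lu; apply: le_lt_trans; rewrite le_eqVlt; apply/orP; left; apply/eqP.
rewrite /sqnorm integral_mkcond [RHS]integral_mkcond; apply: eq_integral => p _.
rewrite !patchE; case: ifPn => [/set_mem pO|/negP pO].
  case: ifPn => // /negP po; rewrite u0 ?expr0n// => h; apply: po; exact/mem_set.
by rewrite ifF//; apply/negP => /set_mem h; apply: pO; apply/mem_set; exact: sub.
Qed.

Lemma control_indic : (fun p => \1_omega p.2 * u p) = u.
Proof.
apply/funext => -[t x] /=; rewrite indicE.
have [_|xo] := boolP (x \in omega); first exact: mul1r.
by rewrite mul0r u0// => -[_ /= /mem_set]; exact/negP.
Qed.

(** By Duhamel's formula this coefficient is [exp (- mu k T)] times the sum of
    [<y0, psi k>] and of the moment prescribed for [u], which cancel. *)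
Lemma controlled_mode0 k : modal Omega mu psi u y0 k T = 0.
Proof.
have LuO := L2_control; have T0' := ltW T0.
have Li := L2_itv_integrable (L2_source_coef mO Hpsi basis LuO k).
have mCO := measurable_cylinder mO T.
have LmO : L2 leb_cyl (cylinder T Omega) (mode k) by exact: (L2_cylinder_tensor mO (Lexp (mu k)) (Lpsi k)).
have umi := @L2_mul_integrable _ _ _ leb_cyl _ mCO _ _ LuO LmO.
have e1 : \int[leb]_(s in `[0, T]) (expR (mu k * s) * source_coef Omega psi u k s) =
    \int[leb]_(s in `[0, T]) \int[leb_d]_(x in Omega) (u (s, x) * mode k (s, x)).
  have LO := ae_L2_section (m1 := leb) (m2 := leb_d) (measurable_itv `]0, T[) mO LuO.
  have iL : leb.-integrable `[0, T]
      (EFin \o (fun s => expR (mu k * s) * source_coef Omega psi u k s)).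
    apply: integrable_continuousM => // s; apply: continuous_comp; last exact: continuous_expR.
    by apply: cvgMr; exact: cvg_id.
  have iR := integrable_section_itv mO umi.
  have so : `]0, T[%classic `<=` `[0, T]%classic by exact: subset_itv_oo_cc.
  have iLo : leb.-integrable `]0, T[
      (EFin \o (fun s => expR (mu k * s) * source_coef Omega psi u k s)).
    by apply: integrableS iL.
  have iRo : leb.-integrable `]0, T[
      (EFin \o (fun s => \int[leb_d]_(x in Omega) (u (s, x) * mode k (s, x)))).
    by apply: integrableS iR.
  rewrite -(Rintegral_itv_oo_cc iLo) -(Rintegral_itv_oo_cc iRo).
  rewrite /Rintegral; congr fine; apply: ae_eq_integral => //.
  - exact: measurable_int iLo.
  - exact: measurable_int iRo.
  have FA : Filter (almost_everywhere leb) by exact: ae_filter_ringOfSetsType.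
  apply: (@filterS _ _ FA _ _ _ LO) => s Ls /Ls {}Ls; congr EFin.
  rewrite /source_coef /inner -RintegralZl//; last exact: L2_mul_integrable.
  by apply: eq_Rintegral => x _; rewrite /mode /=; ring.
have e2 : \int[leb_cyl]_(p in cylinder T Omega) (u p * mode k p) =
    inner leb_cyl (cylinder T omega) u (mode k).
  rewrite /inner Rintegral_mkcond [RHS]Rintegral_mkcond; apply: eq_Rintegral => p _.
  rewrite !patchE; case: ifPn => [/set_mem pO|/negP pO].
    case: ifPn => // /negP po; rewrite u0 ?mul0r// => h; apply: po; exact/mem_set.
  by rewrite ifF//; apply/negP => /set_mem h; apply: pO; apply/mem_set; exact: sub.
by rewrite /modal /duhamel e1 (Rintegral_cylinder mO umi) e2 umode subrr mulr0.
Qed.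

Lemma controlled_solution_null y :
  weak_heat_solution Omega T u y0 y -> {ae leb_d, forall x, Omega x -> y T x = 0}.
Proof.
move=> sol; have T0' := ltW T0.
have LyT : L2 leb_d Omega (y T).
  by have [h _ _ _] := sol; apply: h; rewrite in_itv /= lexx andbT.
have yT0 k : inner leb_d Omega (y T) (psi k) = 0.
  by rewrite (weak_solution_modal mO Hpsi eigen basis T0' L2_control Ly0 k sol) controlled_mode0.
apply: (sqnorm_eq0_ae mO); first by have [] := LyT.
have [_ _ /(_ _ LyT)] := basis.
under eq_fun => n.
  rewrite (@sqnorm_eq _ _ _ leb_d Omega _ (y T)); last first.
    by move=> x _; rewrite big1 ?subr0// => k _; rewrite yT0 mul0r.
  over.
by move=> /cvg_lim => /(_ (@ereal_hausdorff R)); rewrite lim_cst.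
Qed.

End controlled_solution.
End null_control.

Theorem theorem19 (R : realType) (d : nat) (d_ge1 : (1 <= d)%N)
  (Omega : set 'rV[R]_d) (Omega_domain : domain Omega)
  (Omega_smooth : Ck_boundary 2 Omega)
  (omega : set 'rV[R]_d) (omega_open : open omega) (omega_neq0 : omega !=set0)
  (omega_sub : omega `<=` Omega)
  (mu : nat -> R) (psi : nat -> 'rV[R]_d -> R)
  (spectrum : dirichlet_spectrum Omega mu psi)
  (kappa1 theta1 : R) (kappa1_gt0 : 0 < kappa1) (theta1_gt0 : 0 < theta1)
  (weyl : forall r : R, 0 < r ->
     (counting [set m : nat | (mu m <= r)%R] <= (kappa1 * r `^ theta1)%:E)%E)
  (basis : orthonormal_basis Omega psi)
  (beta : R) (beta_gt0 : 0 < beta)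
  (spectral_ineq : forall (lambda : R) (b : nat -> R), 0 < lambda ->
     cvgn (series (fun m => b m ^+ 2)) ->
     (sqnorm (lebesgue_rV d) Omega (low_modes mu psi lambda b)
      <= (expR (beta * lambda))%:E *
         sqnorm (lebesgue_rV d) omega (low_modes mu psi lambda b))%E) :
  exists K : R -> R,
    (forall T : R, 0 < T ->
       0 < K T /\
       forall y0 : 'rV[R]_d -> R, L2 (lebesgue_rV d) Omega y0 ->
       exists u : R * 'rV[R]_d -> R,
         [/\ L2 (lebesgue_measure \x lebesgue_rV d)%E (cylinder T omega) u,
             (sqnorm (lebesgue_measure \x lebesgue_rV d)
                (cylinder T omega) u
              <= (K T)%:E * sqnorm (lebesgue_rV d) Omega y0)%E,
             exists y, weak_heat_solution Omega T
               (fun p => \1_omega p.2 * u p) y0 y &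
             forall y, weak_heat_solution Omega T
               (fun p => \1_omega p.2 * u p) y0 y ->
               {ae lebesgue_rV d, forall x, Omega x -> y T x = 0}]) /\
    (limf_esup (fun T : R => (T * ln (K T))%:E) (0%R : R)^'+ <= (2 * beta ^+ 2)%:E)%E.
Proof.
have [domO _ _ _] := Omega_domain.
have mO := open_measurable_rV domO.
have mo := open_measurable_rV omega_open.
have [_ eig _ _] := spectrum.
have /choice[Gpsi GpsiP] : forall k, exists G, H10 Omega (psi k) G /\
    forall v Gv, H10 Omega v Gv ->
      grad_inner Omega G Gv = mu k * inner (lebesgue_rV d) Omega (psi k) v.
  by move=> k; have [G HG eG] := eig k; exists G.
have Hpsi k : H10 Omega (psi k) (Gpsi k) by have [] := GpsiP k.
have eigen k v Gv : H10 Omega v Gv ->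
    grad_inner Omega (Gpsi k) Gv = mu k * inner (lebesgue_rV d) Omega (psi k) v.
  by have [_] := GpsiP k; apply.
have [Lpsi ortho _] := basis.
have spec := finite_spectral_inequality mO mo omega_sub Lpsi ortho spectral_ineq.
exists (control_cost beta); split; last exact: limsup_control_cost.
move=> T T0; split; first exact: control_cost_gt0.
move=> y0 Ly0.
have [u [mu_ u0 Lu umode uK]] :=
  null_control_exists mO mo omega_sub Hpsi eigen basis beta_gt0 spec T0 Ly0.
have uE := control_indic u0.
exists u; rewrite uE; split => //.
- rewrite (@sqnormE _ _ _ (lebesgue_measure \x lebesgue_rV d)%E _ (measurable_cylinder mo T) _ Lu).
  rewrite (sqnormE mO Ly0) -EFinM.
  by rewrite lee_fin.
- apply: (weak_heat_solution_exists mO Hpsi eigen basis (ltW T0)) => //.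
  exact: (L2_control omega_sub mu_ u0 Lu).
- move=> y sol.
  exact: (controlled_solution_null mO omega_sub Hpsi eigen basis T0 Ly0 mu_ u0 Lu umode sol).
Qed.
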